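(* Let $n\ge 2$, let $(M,g)$ be an oriented Lorentzian $(n+1)$-manifold of class $C^r$ with $r\ge 4$, let $U\subset\mathbb{R}^n$ be a domain, $o\in U$, $\hat o\in M$, and let $F:U\to M$ be an immersion with $F(o)=\hat o$ and $F\in\mathcal{X}^4_0(M,\hat o)$. If $o$ is a degenerate light-like point of $F$, then $F(\Sigma_F)$ contains a light-like geodesic segment of $M$ passing through $\hat o$ which consists only of (images under $F$ of) degenerate light-like points.
   Context: The signature of $g$ is $(-,+,\dots,+)$. The underlying manifold is taken real analytic and $g$ of class $C^r$; $D$ is the Levi-Civita connection and $\Omega$ the Lorentzian volume form. Let $F:U\to M$ be a $C^k$-immersion ($k\ge 2$) of a domain $U$ with coordinates $(u_1,\dots,u_n)$, and put $F_{u_i}=dF(\partial/\partial u_i)$. $S_F=(s_{i,j})_{i,j=1}^n$ with $s_{i,j}=g(F_{u_i},F_{u_j})$ (the matrix of the first fundamental form $ds^2$), and $B_F=\det S_F$. $\Sigma_F=\{p\in U: B_F(p)=0\}$; its points are called light-like points. A light-like point $p$ is degenerate if $dB_F(p)=0$, and non-degenerate otherwise. The normal vector field $\tilde\nu$ along $F$ is defined by $g(\tilde\nu,w)=\Omega(F_{u_1},\dots,F_{u_n},w)$ for all tangent vectors $w$; it satisfies $g(\tilde\nu,\tilde\nu)=-B_F$. Let $\tilde h_{i,j}=g(D_{\partial/\partial u_i}F_{u_j},\tilde\nu)$, let $(\tilde s^{i,j})$ be the cofactor matrix of $S_F$, and $A_F=\sum_{i,j=1}^n\tilde s^{i,j}\tilde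 h_{i,j}$. (The mean curvature function on $U\setminus\Sigma_F$ is $H_F=A_F/(n|B_F|^{3/2})$.) $F\in\mathcal{X}^4_0(M,\hat o)$ means: $F$ is a $C^4$-immersion (germ at $o$), $F(o)=\hat o$, $o$ is a light-like point, and there is a $C^2$-function $\varphi$ near $o$ with $A_F=\varphi B_F$ identically near $o$. A light-like geodesic segment passing through $\hat o$ is the image of a geodesic $\sigma$ of $M$, defined on an open interval containing $0$, with $\sigma(0)=\hat o$, $\sigma'\neq0$ and $g(\sigma',\sigma')=0$. *)

(* Defs.v *)
(* MathComp / MathComp-Analysis. *)
From HB Require Import structures.
From mathcomp Require Import all_boot all_order all_algebra.
From mathcomp Require Import all_classical all_reals all_analysis.

Set Implicit Arguments.
Unset Strict Implicit.
Unset Printing Implicit Defensive.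

Import Order.TTheory GRing.Theory Num.Theory.
Import numFieldNormedType.Exports.

Local Open Scope classical_set_scope.
Local Open Scope ring_scope.

Section Smoothness.
Context {R : realType} {V W : normedModType R}.

(* Meant for open D and finite-dimensional V, where asking for all directional
   derivatives up to order k to exist and be continuous is the same as asking
   for the partial derivatives up to order k. *)
Fixpoint Ck (k : nat) (D : set V) (f : V -> W) : Prop :=
  (forall x, D x -> {for x, continuous f}) /\
  match k with
  | 0 => True
  | k'.+1 => forall v, (forall x, D x -> derivable f x v) /\ Ck k' D ('D_v f)
  end.

(* The k-th term of the series is the degree-k homogeneous part of the Taylor
   expansion of f at a. *)
Definition real_analytic (D : set V) (f : V -> W) : Prop :=
  (forall k, Ck k D f) /\
  forall a, D a -> \forall h \near (0 : V),
    series (fun k => (k`!%:R : R)^-1 *: iter k (fun u => 'D_h u) f a) @ \oo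
      --> f (a + h).

End Smoothness.

Variant regularity := Cfin of nat | Cinfty | Comega.

Definition at_least (k : nat) (r : regularity) : Prop :=
  match r with Cfin j => (k <= j)%N | Cinfty | Comega => True end.

Definition of_class {R : realType} {V W : normedModType R} (r : regularity)
    (D : set V) (f : V -> W) : Prop :=
  match r with
  | Cfin k => Ck k D f
  | Cinfty => forall k, Ck k D f
  | Comega => real_analytic D f
  end.

Definition minkowski (R : realType) (m : nat) : 'M[R]_m :=
  diag_mx (\row_(i < m) if (i : nat) == 0%N then -1 else 1).

(* A vector of coordinates is a row, so a bilinear form with matrix G is
   (v, w) |-> v G w^T and the differential of f at x is v |-> v *m jacobian f x.
   The orientation is given by restricting to positively oriented charts.
   The metric is given by its matrix in each chart, as a function on the range
   of that chart.  Values of [chart c] outside [cdom c], and of [cinv c] and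
   [metric c] outside [chart c @` cdom c], are irrelevant. *)
Record lorentz_manifold (R : realType) (m : nat) (r : regularity) := {
  carrier :> topologicalType ;
  carrier_hausdorff : hausdorff_space carrier ;
  carrier_second_countable : @second_countable carrier ;
  (* charts *)
  atlas : Type ;
  cdom : atlas -> set carrier ;
  chart : atlas -> carrier -> 'rV[R]_m ;
  cinv : atlas -> 'rV[R]_m -> carrier ;
  chart_at : carrier -> atlas ;
  chart_atP : forall x, cdom (chart_at x) x ;
  cdom_open : forall c, open (cdom c) ;
  crange_open : forall c, open (chart c @` cdom c) ;
  chartK : forall c x, cdom c x -> cinv c (chart c x) = x ;
  chart_continuous : forall c x, cdom c x -> {for x, continuous (chart c)} ;
  cinv_continuous : forall c y, (chart c @` cdom c) y ->
    {for y, continuous (cinv c)} ;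
  (* changes of coordinates *)
  transition_analytic : forall c d,
    real_analytic (chart c @` (cdom c `&` cdom d)) (chart d \o cinv c) ;
  transition_oriented : forall c d y, (chart c @` (cdom c `&` cdom d)) y ->
    0 < \det (jacobian (chart d \o cinv c) y) ;
  (* Lorentzian metric *)
  metric : atlas -> 'rV[R]_m -> 'M[R]_m ;
  metric_class : forall c, of_class r (chart c @` cdom c) (metric c) ;
  metric_sym : forall c y, (chart c @` cdom c) y ->
    (metric c y)^T = metric c y ;
  metric_signature : forall c y, (chart c @` cdom c) y ->
    exists2 P, P \in unitmx & P *m metric c y *m P^T = minkowski R m ;
  metric_transition : forall c d y, (chart c @` (cdom c `&` cdom d)) y ->
    let J := jacobian (chart d \o cinv c) y in
    metric c y = J *m metric d (chart d (cinv c y)) *m J^T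
}.

Section Geometry.
Context {R : realType} {m : nat} {r : regularity} (M : lorentz_manifold R m r).

(* A tangent vector of M at x is represented by its coordinates in the chart
   [chart_at M x].  The scalars, and the vanishing of vectors, computed below do
   not depend on the choice of the chart, by the compatibility conditions in
   [lorentz_manifold]. *)

Definition gmx (x : M) : 'M[R]_m :=
  metric (chart_at x) (chart (chart_at x) x).

Definition g (x : M) (v w : 'rV[R]_m) : R := (v *m gmx x *m w^T) 0 0.

(* volume form on the rows of A *)
Definition vol (x : M) (A : 'M[R]_m) : R := Num.sqrt `|\det (gmx x)| * \det A.

Definition e_ {p : nat} (i : 'I_p) : 'rV[R]_p := delta_mx 0 i.

(* Christoffel symbols of the Levi-Civita connection in the chart c *)
Definition christoffel (c : atlas M) (y : 'rV[R]_m) (k a b : 'I_m) : R :=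
  2^-1 * \sum_l invmx (metric c y) k l *
    ('D_(e_ a) (fun z => metric c z b l) y
     + 'D_(e_ b) (fun z => metric c z a l) y
     - 'D_(e_ l) (fun z => metric c z a b) y).

Section Maps.
Context {V : normedModType R}.

Definition Ck_map (k : nat) (D : set V) (F : V -> M) : Prop :=
  (forall p, D p -> {for p, continuous F}) /\
  forall c, Ck k (D `&` F @^-1` cdom c) (chart c \o F).

(* dF(v) at p *)
Definition dmap (F : V -> M) (p v : V) : 'rV[R]_m :=
  'D_v (chart (chart_at (F p)) \o F) p.

(* covariant derivative D_v (dF(w)) along F at p, for constant vector fields
   v and w on V *)
Definition cov (F : V -> M) (p v w : V) : 'rV[R]_m :=
  let c := chart_at (F p) in
  let f := chart c \o F in
  'D_v ('D_w f) p +
  \row_k \sum_a \sum_b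
    christoffel c (f p) k a b * ('D_v f p) 0 a * ('D_w f p) 0 b.

Definition immersion (k : nat) (D : set V) (F : V -> M) : Prop :=
  Ck_map k D F /\ forall p, D p -> forall v, dmap F p v = 0 -> v = 0.

End Maps.

Definition geodesic (a b : R) (s : R -> M) : Prop :=
  Ck_map 2 `]a, b[%classic s /\ forall t, a < t < b -> cov s t 1 1 = 0.

Definition lightlike_geodesic_segment (x : M) (S : set M) : Prop :=
  exists (a b : R) (s : R -> M),
    [/\ a < 0 < b, geodesic a b s, s 0 = x,
        forall t, a < t < b ->
          dmap s t 1 <> 0 /\ g (s t) (dmap s t 1) (dmap s t 1) = 0
      & S = s @` `]a, b[].

End Geometry.

Section Hypersurface.
Context {R : realType} {n : nat} {r : regularity}.
Context {M : lorentz_manifold R n.+1 r}.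
Variable F : 'rV[R]_n -> M.

Definition Fu (p : 'rV[R]_n) (i : 'I_n) : 'rV[R]_n.+1 := dmap F p (e_ i).

Definition S_ (p : 'rV[R]_n) : 'M[R]_n :=
  \matrix_(i, j) g (F p) (Fu p i) (Fu p j).

Definition B_ (p : 'rV[R]_n) : R := \det (S_ p).

(* the matrix with rows F_{u_1}, ..., F_{u_n}, w *)
Definition frame (p : 'rV[R]_n) (w : 'rV[R]_n.+1) : 'M[R]_n.+1 :=
  \matrix_(i < n.+1) (if unlift ord_max i is Some j then Fu p j else w).

Definition nu (p : 'rV[R]_n) : 'rV[R]_n.+1 :=
  get [set v | forall w, g (F p) v w = vol (F p) (frame p w)].

Definition h_ (p : 'rV[R]_n) (i j : 'I_n) : R :=
  g (F p) (cov F p (e_ i) (e_ j)) (nu p).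

Definition A_ (p : 'rV[R]_n) : R :=
  \sum_i \sum_j cofactor (S_ p) i j * h_ p i j.

Definition Sigma (U : set 'rV[R]_n) : set 'rV[R]_n :=
  [set p | U p /\ B_ p = 0].

Definition degenerate_points (U : set 'rV[R]_n) : set 'rV[R]_n :=
  [set p | Sigma U p /\ forall v, 'd B_ p v = 0].

Definition calX40 (o : 'rV[R]_n) (ohat : M) : Prop :=
  exists N : set 'rV[R]_n,
    [/\ open N /\ N o, immersion 4 N F, F o = ohat, Sigma N o
      & exists2 phi : 'rV[R]_n -> R,
          Ck 2 N phi & forall p, N p -> A_ p = phi p * B_ p].

End Hypersurface.

(* Main.v *)
Require Import Defs.
From HB Require Import structures.
From mathcomp Require Import all_boot all_order all_algebra.
From mathcomp Require Import all_classical all_reals all_analysis.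
From mathcomp Require Import ring lra.

(** Read the immersion in one chart, as a map f into coordinate space with
    coordinate vectors f_1, ..., f_n, first fundamental form S and B = det S.
    Complete these vectors near o by a constant transverse vector Z, and let H
    be the Gram matrix of this frame and Q its inverse.  Write the last column
    of Q as (xi, beta); it gives the normal vector in the frame, up to a
    factor.  With b the scalar products of the f_i with Z and d that of Z with
    itself, H Q = 1 reads

      S xi + beta b = 0   and   b . xi + d beta = 1,

    and B = det H beta.  So light-like points are the zeros of beta; there xi
    spans the kernel of S and df(xi) is the light-like normal vector.

    The mean curvature hypothesis becomes a transport equation for beta.  By
    the Desnanot-Jacobi identity (cofactor_core) the cofactor matrix of S is
    - det H xi xi^T up to a multiple of beta, so A = phi B says that the
    second fundamental form on (xi, xi) is a multiple of beta.  By the Koszul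
    formula it is also, up to multiples of beta, a combination of first
    derivatives of S; contracted with xi, and with the equation S xi = - beta b
    differentiated once, it equals - dbeta(xi) / 2.  Hence dbeta(xi) = chi beta
    with chi continuous (transport).

    Follow the integral curve of xi from o.  Along it beta solves a linear
    equation and starts at 0, so it vanishes and the curve consists of
    light-like points.  Differentiating dbeta(xi) = chi beta where beta = 0,
    the partial derivatives of beta along the curve solve a linear homogeneous
    system; they start at 0 because o is degenerate.  So all the points of the
    curve are degenerate (null_flow).

    Where beta and dbeta vanish, the same identities show that the covariant
    acceleration of the curve is orthogonal to the hypersurface, that is, a
    multiple of the velocity, which is light-like.  A factor tau on xi, which
    solves its own equation together with the curve, makes the parameter
    affine (curve_geodesic), and the image is a light-like geodesic.

    The analysis needed is proved first: differentiability of maps with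
    continuous directional derivatives, the chain rule for the class C^k,
    symmetry of second derivatives, and the theorem of Picard-Lindelof
    (ode_local).  As the invariants of the hypersurface are defined in a chart
    that depends on the point, the last part transports them to one chart; the
    transformation rule of the covariant derivative (cov_coord_transform) is
    again a consequence of the Koszul formula, for the transition map. *)

Set Implicit Arguments.
Unset Strict Implicit.
Unset Printing Implicit Defensive.

Import Order.TTheory GRing.Theory Num.Theory.
Import numFieldNormedType.Exports.

Local Open Scope classical_set_scope.
Local Open Scope ring_scope.

(** * Derivatives along lines and the mean value theorem *)

Section Lines.
Context {R : realType}.

(** Directional derivatives only see the restriction of a map to a line, so
    maps on different spaces can be compared. *)
Lemma derive_eq_along_lines {V V' W : normedModType R} (f : V -> W) (g : V' -> W) x v y w :
  (forall h : R, f (h *: v + x) = g (h *: w + y)) ->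
  (derivable f x v <-> derivable g y w) /\ 'D_v f x = 'D_w g y.
Proof.
move=> E; have E0 : f x = g y by have := E 0; rewrite !scale0r !add0r.
suff Q : (fun h : R => h^-1 *: ((f \o shift x) (h *: v) - f x)) =
         (fun h : R => h^-1 *: ((g \o shift y) (h *: w) - g y)).
  by rewrite /derivable /derive Q.
by apply/funext => h /=; rewrite E E0.
Qed.

Context {V W : normedModType R}.

Lemma is_derive_line (f : V -> W) (x h : V) (s : R) :
  derivable f (s *: h + x) h ->
  is_derive s 1 (fun t : R => f (t *: h + x)) ('D_h f (s *: h + x)).
Proof.
have [E1 E2] : (derivable (fun t : R => f (t *: h + x)) s 1 <->
     derivable f (s *: h + x) h) /\
    'D_1 (fun t : R => f (t *: h + x)) s = 'D_h f (s *: h + x).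
  by apply: derive_eq_along_lines => k; rewrite [_%:A]mulr1 scalerDl addrA.
by move=> df; split; [exact/E1|exact: E2].
Qed.

(** The inner map has to be derivable along one line only, so that its
    domain V may be any normed space. *)
Lemma is_derive_comp {X : normedModType R} (f : V -> W) (h : W -> X) (x v : V) :
  derivable f x v -> differentiable h (f x) ->
  is_derive x v (h \o f) ('D_('D_v f x) h (f x)).
Proof.
move=> df dh.
have E1 : derivable f (0 *: v + x) v by rewrite scale0r add0r.
have [/derivable1_diffP D0 d2] := is_derive_line E1.
have D1 : differentiable h (f (0 *: v + x)) by rewrite scale0r add0r.
have D2 : differentiable (h \o (fun t : R => f (t *: v + x))) 0.
  exact: differentiable_comp.
have [E2 E3] : (derivable (h \o f) x v <->
     derivable (h \o (fun t : R => f (t *: v + x))) 0 1) /\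
    'D_v (h \o f) x = 'D_1 (h \o (fun t : R => f (t *: v + x))) 0.
  by apply: derive_eq_along_lines => k /=; rewrite [_%:A]mulr1 addr0.
split; first by apply/E2/derivable1_diffP.
rewrite (deriveE _ dh) E3 deriveE // diff_comp //= -(deriveE (1 : R) D0) d2.
by rewrite scale0r add0r.
Qed.

Lemma derive_scale (f : V -> W) (x v : V) (a : R) :
  derivable f x v -> 'D_(a *: v) f x = a *: 'D_v f x.
Proof.
move=> df.
have E1 : derivable f (0 *: v + x) v by rewrite scale0r add0r.
have [/derivable1_diffP D0 d2] := is_derive_line E1.
have [_ ->] : (derivable f x (a *: v) <->
     derivable (fun t : R => f (t *: v + x)) 0 a) /\
    'D_(a *: v) f x = 'D_a (fun t : R => f (t *: v + x)) 0.
  by apply: derive_eq_along_lines => k; rewrite addr0 scalerA.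
rewrite (deriveE a D0).
have -> : forall L : {linear R -> W}, L a = a *: L 1.
  by move=> L; rewrite -linearZ /= [_%:A]mulr1.
rewrite -(deriveE (1 : R) D0) d2.
by rewrite scale0r add0r.
Qed.

End Lines.

Section MeanValue.
Context {R : realType} {V : normedModType R}.
Implicit Types f : V -> R.

Lemma mean_value_line f (x h : V) :
  (forall s : R, 0 <= s <= 1 -> derivable f (s *: h + x) h) ->
  exists2 s : R, 0 < s < 1 & f (h + x) - f x = 'D_h f (s *: h + x).
Proof.
move=> df; pose phi (t : R) := f (t *: h + x).
have dphi (s : R) : 0 <= s <= 1 -> is_derive s 1 phi ('D_h f (s *: h + x)).
  by move=> /df; exact: is_derive_line.
have [||s sI] := @MVT R phi (fun s : R => 'D_h f (s *: h + x)) 0 1 ltr01.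
- by move=> s /[!in_itv] /= /andP[s0 s1]; apply: dphi; rewrite !ltW.
- apply: derivable_within_continuous => s /[!in_itv] /= s01.
  by have [] := dphi _ s01.
rewrite /phi scale1r scale0r add0r subr0 mulr1 => ->.
by exists s; rewrite ?in_itv.
Qed.

End MeanValue.

Section Open.
Context {R : realType} {V : normedModType R}.

Lemma open_ballP (D : set V) (x : V) : open D -> D x ->
  exists2 e : R, 0 < e & forall h, `|h| < e -> D (h + x).
Proof.
move=> oD Dx; have /nbhs_ballP[e /= e0 eD] : nbhs x D by exact: open_nbhs_nbhs.
exists e => // h he; apply: eD; rewrite -ball_normE /= opprD addrC subrK.
by rewrite normrN.
Qed.

Lemma norm_segment (s e : R) (h : V) : 0 <= s <= 1 -> `|h| < e -> `|s *: h| < e.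
Proof.
move=> /andP[s0 s1] he; rewrite normrZ ger0_norm //.
by rewrite (le_lt_trans _ he) // ler_piMl.
Qed.

Lemma continuous_at_eps {W : normedModType R} (f : V -> W) x :
  {for x, continuous f} -> forall e : R, 0 < e ->
  exists2 d : R, 0 < d & forall h, `|h| < d -> `|f (h + x) - f x| < e.
Proof.
move=> cf e e0.
have /cvgrPdist_lt/(_ e e0)/nbhs_ballP[d /= d0 dP] := cf.
exists d => // h hd.
rewrite distrC; apply: dP; rewrite -ball_normE /= opprD addrC subrK.
by rewrite normrN.
Qed.

End Open.

(** * Functions of class C^k *)

Section CkBasics.
Context {R : realType} {V W : normedModType R}.
Implicit Types (D : set V) (f : V -> W).

Lemma Ck_cont k D f : Ck k D f -> forall x, D x -> {for x, continuous f}.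
Proof. by case: k => [|k] []. Qed.

Lemma Ck_derivable k D f v : Ck k.+1 D f -> forall x, D x -> derivable f x v.
Proof. by move=> [_ /(_ v)[]]. Qed.

Lemma Ck_derive k D f v : Ck k.+1 D f -> Ck k D ('D_v f).
Proof. by move=> [_ /(_ v)[]]. Qed.

Lemma Ck_pred k D f : Ck k.+1 D f -> Ck k D f.
Proof.
elim: k f => [|k IH] f [cf df]; split=> // v.
by have [dv dC] := df v; split => //; exact: IH.
Qed.

Lemma Ck_le j k D f : (j <= k)%N -> Ck k D f -> Ck j D f.
Proof.
move=> /subnK <-; elim: (k - j)%N => // i IH.
by rewrite addSn => /Ck_pred.
Qed.

Lemma Ck_sub k D D' f : D' `<=` D -> Ck k D f -> Ck k D' f.
Proof.
move=> DD'; elim: k f => [|k IH] f [cf df]; split => //.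
- by move=> x /DD'; exact: cf.
- by move=> x /DD'; exact: cf.
- by move=> v; have [dv dC] := df v; split; [move=> x /DD'; exact: dv|exact: IH].
Qed.

Lemma near_open D (x : V) (P : V -> Prop) :
  open D -> D x -> (forall y, D y -> P y) -> \forall y \near x, P y.
Proof. by move=> oD Dx DP; apply: (filterS DP); exact: open_nbhs_nbhs. Qed.

(** C^k is a local property: on an open set it may be checked on any formula
    for the function. *)
Lemma Ck_ext k D f f' : open D -> (forall x, D x -> f x = f' x) ->
  Ck k D f -> Ck k D f'.
Proof.
move=> oD; elim: k f f' => [|k IH] f f' E [cf df].
  split=> // x Dx; rewrite /prop_for /continuous_at -E //.
  apply: (cvg_trans _ (cf x Dx)); apply: near_eq_cvg.
  exact: (near_open oD Dx).
split=> [x Dx|v].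
  rewrite /prop_for /continuous_at -E //.
  apply: (cvg_trans _ (cf x Dx)); apply: near_eq_cvg.
  exact: (near_open oD Dx).
have [dv dC] := df v; split => [x Dx|].
  by apply: (near_eq_derivable _ (dv x Dx)); exact: (near_open oD Dx).
apply: IH dC => x Dx.
by apply: near_eq_derive; exact: (near_open oD Dx).
Qed.

Lemma derive_ext D f f' v x : open D -> D x -> (forall x, D x -> f x = f' x) ->
  'D_v f x = 'D_v f' x.
Proof. by move=> oD Dx E; apply: near_eq_derive; exact: (near_open oD Dx). Qed.

Lemma Ck_cst k D (a : W) : Ck k D (cst a).
Proof.
elim: k a => [|k IH] a; split => //.
- by move=> x _; exact: cvg_cst.
- by move=> x _; exact: cvg_cst.
move=> v; split=> [x _|]; first exact: derivable_cst.
by have -> : 'D_v (cst a) = cst (0 : W) by apply/funext => x; exact: derive_cst.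
Qed.

Lemma Ck_add k D f g : open D -> Ck k D f -> Ck k D g ->
  Ck k D (fun x => f x + g x).
Proof.
move=> oD; elim: k f g => [|k IH] f g [cf df] [cg dg]; split => //.
- by move=> x Dx; apply: cvgD; [exact: cf|exact: cg].
- by move=> x Dx; apply: cvgD; [exact: cf|exact: cg].
move=> v; have [dfv dfC] := df v; have [dgv dgC] := dg v; split => [x Dx|].
  by apply: derivableD; [exact: dfv|exact: dgv].
apply: (Ck_ext oD _ (IH _ _ dfC dgC)) => x Dx.
by rewrite -[fun x => _]/(f + g) deriveD //; [exact: dfv|exact: dgv].
Qed.

Lemma Ck_opp k D f : open D -> Ck k D f -> Ck k D (fun x => - f x).
Proof.
move=> oD; elim: k f => [|k IH] f [cf df]; split => //.
- by move=> x Dx; apply: cvgN; exact: cf.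
- by move=> x Dx; apply: cvgN; exact: cf.
move=> v; have [dfv dfC] := df v; split => [x Dx|].
  by apply: derivableN; exact: dfv.
apply: (Ck_ext oD _ (IH _ dfC)) => x Dx.
by rewrite -[fun x => _]/(- f) deriveN //; exact: dfv.
Qed.

Lemma Ck_sum k D (I : Type) (r : seq I) (P : pred I) (F : I -> V -> W) : open D ->
  (forall i, P i -> Ck k D (F i)) -> Ck k D (fun x => \sum_(i <- r | P i) F i x).
Proof.
move=> oD CF; elim: r => [|i r IH].
  by apply: (Ck_ext oD _ (Ck_cst k D 0)) => x _; rewrite big_nil.
case Pi: (P i); last first.
  by apply: (Ck_ext oD _ IH) => x _; rewrite big_cons Pi.
apply: (Ck_ext oD _ (Ck_add oD (CF i Pi) IH)) => x _.
by rewrite big_cons Pi.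
Qed.

End CkBasics.

Section CkScalar.
Context {R : realType} {V : normedModType R}.
Implicit Types (D : set V) (f g : V -> R).

Lemma Ck_mul k D f g : open D -> Ck k D f -> Ck k D g ->
  Ck k D (fun x => f x * g x).
Proof.
move=> oD; elim: k f g => [|k IH] f g Cf Cg.
  split => // x Dx.
  by apply: cvgM; [exact: Ck_cont Cf x Dx|exact: Ck_cont Cg x Dx].
split => [x Dx|v].
  by apply: cvgM; [exact: Ck_cont Cf x Dx|exact: Ck_cont Cg x Dx].
split => [x Dx|].
  by apply: derivableM; [exact: Ck_derivable Cf x Dx|exact: Ck_derivable Cg x Dx].
have C1 := IH _ _ (Ck_pred Cf) (Ck_derive v Cg).
have C2 := IH _ _ (Ck_pred Cg) (Ck_derive v Cf).
apply: (Ck_ext oD _ (Ck_add oD C1 C2)) => x Dx.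
by rewrite -[fun x => _]/(f * g) deriveM //; [exact: Ck_derivable Cf x Dx|exact: Ck_derivable Cg x Dx].
Qed.

Lemma Ck_sub_fun k D f g : open D -> Ck k D f -> Ck k D g ->
  Ck k D (fun x => f x - g x).
Proof. by move=> oD Cf Cg; apply: Ck_add => //; exact: Ck_opp. Qed.

Lemma Ck_prod k D (I : Type) (r : seq I) (P : pred I) (F : I -> V -> R) : open D ->
  (forall i, P i -> Ck k D (F i)) -> Ck k D (fun x => \prod_(i <- r | P i) F i x).
Proof.
move=> oD CF; elim: r => [|i r IH].
  by apply: (Ck_ext oD _ (@Ck_cst R V R k D 1)) => x _; rewrite big_nil.
case Pi: (P i); last first.
  by apply: (Ck_ext oD _ IH) => x _; rewrite big_cons Pi.
apply: (Ck_ext oD _ (Ck_mul oD (CF i Pi) IH)) => x _.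
by rewrite big_cons Pi.
Qed.

Lemma Ck_inv k D f : open D -> (forall x, D x -> f x != 0) -> Ck k D f ->
  Ck k D (fun x => (f x)^-1).
Proof.
move=> oD f0; elim: k => [|k IH] Cf.
  split => // x Dx; apply: cvgV; [exact: f0|exact: Ck_cont Cf x Dx].
split => [x Dx|v].
  by apply: cvgV; [exact: f0|exact: Ck_cont Cf x Dx].
split => [x Dx|].
  by apply: derivableV; [exact: f0|exact: Ck_derivable Cf x Dx].
have C1 := IH (Ck_pred Cf).
have C2 := Ck_mul oD (Ck_opp oD (Ck_mul oD C1 C1)) (Ck_derive v Cf).
apply: (Ck_ext oD _ C2) => x Dx.
rewrite deriveV ?f0 //; last exact: Ck_derivable Cf x Dx.
by rewrite expr2 invfM.
Qed.

Lemma Ck_det k D m (A : V -> 'M[R]_m) : open D ->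
  (forall i j, Ck k D (fun x => A x i j)) -> Ck k D (fun x => \det (A x)).
Proof.
move=> oD CA; rewrite /determinant; apply: Ck_sum => // s _.
by apply: Ck_mul => //; [exact: Ck_cst|exact: Ck_prod].
Qed.

Lemma continuous_mxP m n (A : V -> 'M[R]_(m, n)) x :
  {for x, continuous A} <-> (forall i j, {for x, continuous (fun x => A x i j)}).
Proof.
split=> [H i j|H].
  apply: (cvg_comp A (fun M : 'M[R]_(m, n) => M i j) H); exact: coord_continuous.
apply/cvgrPdist_lt => e e0.
have H' : \forall t \near x,
    forall ij : 'I_m * 'I_n, `|A x ij.1 ij.2 - A t ij.1 ij.2| < e.
  by apply: filter_forall => -[i j] /=; have /cvgrPdist_lt/(_ _ e0) := H i j.
near=> t; rewrite [ltLHS]/Num.Def.normr/= mx_normrE.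
have Ht : forall ij : 'I_m * 'I_n, `|A x ij.1 ij.2 - A t ij.1 ij.2| < e by near: t.
by apply: bigmax_lt => //= i _; rewrite !mxE.
Unshelve. all: by end_near. Qed.

(** Reduces smoothness of matrix-valued maps to that of real functions, for
    which the algebraic closure properties are available. *)
Lemma Ck_mxP k D m n (A : V -> 'M[R]_(m, n)) : open D ->
  Ck k D A <-> (forall i j, Ck k D (fun x => A x i j)).
Proof.
move=> oD; elim: k A => [|k IH] A.
  split=> [[cA _] i j|CA]; split => // x Dx.
    by have /continuous_mxP := cA x Dx.
  by apply/continuous_mxP => i j; exact: Ck_cont (CA i j) x Dx.
split=> [CA i j|CA].
  split=> [x Dx|v].
    by have /continuous_mxP := Ck_cont CA Dx.
  split=> [x Dx|].
    by apply: (derivable_mxP A x v).1 => //; exact: Ck_derivable CA x Dx.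
  apply: (Ck_ext oD _ ((IH _).1 (Ck_derive v CA) i j)) => x Dx.
  by rewrite derive_mx ?mxE //; exact: Ck_derivable CA x Dx.
split=> [x Dx|v].
  by apply/continuous_mxP => i j; exact: Ck_cont (CA i j) x Dx.
have dA x : D x -> derivable A x v.
  by move=> Dx; apply/derivable_mxP => i j; exact: Ck_derivable (CA i j) x Dx.
split=> //; apply/IH => i j.
apply: (Ck_ext oD _ (Ck_derive v (CA i j))) => x Dx.
by rewrite derive_mx ?mxE //; exact: dA.
Qed.

Lemma Ck_entry k D m n (A : V -> 'M[R]_(m, n)) i j : open D ->
  Ck k D A -> Ck k D (fun x => A x i j).
Proof. by move=> oD /(Ck_mxP _ _ oD). Qed.

End CkScalar.

(** * Derivatives in finite dimension: differentiability, chain rule, symmetry *)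

Section Directions.
Context {R : realType} {V : normedModType R}.
Implicit Types (D : set V) (f : V -> R).

(** Directional derivatives need not be additive in the direction. They are
    when they are continuous: the increment along v + w is split into an
    increment along v and one along w, and the second is a derivative along
    w at a nearby point. *)
Lemma derive_dirD D f x v w : open D -> Ck 1 D f -> D x ->
  'D_(v + w) f x = 'D_v f x + 'D_w f x.
Proof.
move=> oD Cf Dx; apply: cvg_lim => //; apply/cvgrPdist_lt => e e0.
have e2 : 0 < e / 2 by rewrite divr_gt0.
have [r r0 rD] := open_ballP oD Dx.
have [d d0 dP] := continuous_at_eps (Ck_cont (Ck_derive w Cf) Dx) e2.
have /cvgrPdist_lt/(_ _ e2) Q := Ck_derivable (v := v) Cf Dx.
have N0 : 0 < `|v| + `|w| + 1 by rewrite ltr_wpDl // addr_ge0.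
pose m := Num.min r d / (`|v| + `|w| + 1).
have m0 : 0 < m by rewrite divr_gt0 // lt_min r0.
near=> k.
have k0 : k != 0 by near: k; exact: nbhs_dnbhs_neq.
have Qk : `|'D_v f x - k^-1 *: ((f \o shift x) (k *: v) - f x)| < e / 2.
  by near: k.
have km : `|k| < m by near: k; exact: dnbhs0_lt.
have small (s : R) : 0 <= s <= 1 -> `|s *: (k *: w) + k *: v| < Num.min r d.
  move=> /andP[s0 s1]; rewrite (le_lt_trans (ler_normD _ _)) // !normrZ.
  rewrite (ger0_norm s0).
  have : `|k| * (`|v| + `|w| + 1) < Num.min r d by rewrite -ltr_pdivlMr.
  have : s * (`|k| * `|w|) <= `|k| * `|w| by rewrite ler_piMl // mulr_ge0.
  have := normr_ge0 k; rewrite !mulrDr mulr1; lra.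
have [|s s01 E] := @mean_value_line R V f (k *: v + x) (k *: w).
  move=> s s01; rewrite addrA; apply: (Ck_derivable Cf (x := _)); apply: rD.
  by rewrite (lt_le_trans (small s s01)) // ge_min lexx.
have s01' : 0 <= s <= 1 by case/andP: s01 => ? ?; rewrite !ltW.
have Ds : D (s *: (k *: w) + k *: v + x).
  by apply: rD; rewrite (lt_le_trans (small s s01')) // ge_min lexx.
have -> : k^-1 *: ((f \o shift x) (k *: (v + w)) - f x) =
   k^-1 *: ((f \o shift x) (k *: v) - f x) + 'D_w f (s *: (k *: w) + k *: v + x).
  have -> : 'D_w f (s *: (k *: w) + k *: v + x) =
      k^-1 *: (f (k *: w + (k *: v + x)) - f (k *: v + x)).
    rewrite E derive_scale ?addrA; last exact: Ck_derivable Cf _ Ds.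
    by rewrite [RHS]scalerA mulVf // scale1r.
  rewrite -scalerDr; congr (_ *: _) => /=.
  have -> : k *: (v + w) + x = k *: w + (k *: v + x).
    by rewrite scalerDr addrA [k *: w + _]addrC.
  by ring.
rewrite opprD addrACA (le_lt_trans (ler_normD _ _)) // [e]splitr ltrD //.
rewrite distrC; apply: dP.
by rewrite (lt_le_trans (small s s01')) // ge_min lexx orbT.
Unshelve. all: by end_near. Qed.

Lemma derive_dir_sum D f x (I : Type) (r : seq I) (F : I -> V) :
  open D -> Ck 1 D f -> D x ->
  'D_(\sum_(i <- r) F i) f x = \sum_(i <- r) 'D_(F i) f x.
Proof.
move=> oD Cf Dx; elim: r => [|i r IH]; first by rewrite !big_nil derive0.
by rewrite !big_cons (derive_dirD _ _ oD Cf Dx) IH.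
Qed.

End Directions.

Section FiniteDim.
Context {R : realType} {n : nat}.
Implicit Types (D : set 'rV[R]_n) (f : 'rV[R]_n -> R).

Lemma derive_coord D f x v : open D -> Ck 1 D f -> D x ->
  'D_v f x = \sum_i v 0 i * 'D_(e_ i) f x.
Proof.
move=> oD Cf Dx; rewrite {1}(row_sum_delta v) (derive_dir_sum _ _ oD Cf Dx).
by apply: eq_bigr => i _; rewrite derive_scale //; exact: Ck_derivable Cf x Dx.
Qed.

Lemma derive_coordE (v x : 'rV[R]_n) i :
  is_derive x v (fun y : 'rV[R]_n => y 0 i) (v 0 i).
Proof.
have D : derivable (id : 'rV[R]_n -> _) x v by exact: derivable_id.
split; first exact: (derivable_mxP _ _ _).1 D 0 i.
by have := derive_mx D; rewrite derive_id => /matrixP/(_ 0 i); rewrite mxE.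
Qed.

Lemma Ck_coord k D i : Ck k D (fun y : 'rV[R]_n => y 0 i).
Proof.
have C0 : forall x, D x -> {for x, continuous (fun y : 'rV[R]_n => y 0 i)}.
  by move=> x _; exact: coord_continuous.
case: k => [|k]; split => // v.
split=> [x _|]; first by have [] := derive_coordE v x i.
have -> : 'D_v (fun y : 'rV[R]_n => y 0 i) = cst (v 0 i).
  by apply/funext => x; have [] := derive_coordE v x i.
exact: Ck_cst.
Qed.

Lemma norm_coord_le (h : 'rV[R]_n) i : `|h 0 i| <= `|h|.
Proof.
rewrite [leRHS]/Num.Def.normr/= mx_normrE.
by apply: (le_bigmax _ (fun i : 'I_1 * 'I_n => `|h i.1 i.2|) (0, i)).
Qed.

(** By the mean value theorem the error is the variation of the derivative
    along h between two nearby points; additivity in the direction reduces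
    it to the variation of n partial derivatives, uniformly in h. *)
Lemma Ck1_increment D f x e : open D -> Ck 1 D f -> D x -> 0 < e ->
  exists2 d : R, 0 < d & forall h, `|h| < d ->
   `|f (h + x) - f x - 'D_h f x| <= e * `|h|.
Proof.
move=> oD Cf Dx e0.
have [r r0 rD] := open_ballP oD Dx.
have N0 : 0 < (n%:R + 1 : R) by rewrite ltr_wpDl.
pose e' := e / (n%:R + 1); have e'0 : 0 < e' by rewrite divr_gt0.
have [d d0 dP] : exists2 d : R, 0 < d & forall i h, `|h| < d ->
    `|'D_(e_ i) f (h + x) - 'D_(e_ i) f x| < e'.
  have : \forall y \near x, forall i : 'I_n,
      `|'D_(e_ i) f x - 'D_(e_ i) f y| < e'.
    apply: (filter_forall (nbhs_filter x)) => i.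
    by have /cvgrPdist_lt/(_ _ e'0) := Ck_cont (Ck_derive (e_ i) Cf) Dx.
  move=> /nbhs_ballP[d /= d0 dP]; exists d => // i h hd; rewrite distrC.
  by apply: dP; rewrite -ball_normE /= opprD addrC subrK normrN.
exists (Num.min r d); first by rewrite lt_min r0.
move=> h; rewrite lt_min => /andP[hr hd].
have [s s01|s s01 ->] := @mean_value_line R _ f x h.
  by apply: (Ck_derivable Cf); apply: rD; exact: norm_segment.
have s01' : 0 <= s <= 1 by case/andP: s01 => ? ?; rewrite !ltW.
have Ds : D (s *: h + x) by apply: rD; exact: norm_segment.
rewrite !(derive_coord _ oD Cf) // -sumrB.
rewrite (le_trans (ler_norm_sum _ _ _)) //.
rewrite (@le_trans _ _ (\sum_(i < n) e' * `|h|)) //.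
  apply: ler_sum => i _; rewrite -mulrBr normrM mulrC ler_pM //.
    by apply/ltW/dP; exact: norm_segment.
  exact: norm_coord_le.
rewrite sumr_const card_ord -mulrnAl ler_wpM2r // /e' -mulr_natr -mulrA.
rewrite ler_piMr ?(ltW e0) // mulrC.
by rewrite ler_pdivrMr // mul1r lerDl.
Qed.

(** The class C^1 is stated with directional derivatives; this is the
    passage to the Frechet differential. *)
Lemma Ck1_differentiable D f x : open D -> Ck 1 D f -> D x -> differentiable f x.
Proof.
move=> oD Cf Dx.
pose L (h : 'rV[R]_n) : R := \sum_i h 0 i * 'D_(e_ i) f x.
have LE h : L h = 'D_h f x by rewrite (derive_coord h oD Cf Dx).
have linL : linear L.
  move=> a u v; rewrite /L -[X in _ = X + _]/(a * _) mulr_sumr -big_split; apply: eq_bigr => i _ /=.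
  by rewrite !mxE mulrDl mulrA.
pose LM := GRing.isLinear.Build _ _ _ _ _ linL.
pose LL : {linear 'rV[R]_n -> R} := HB.pack L LM.
have cL : continuous LL.
  move=> h; have CL : Ck 0 [set: 'rV[R]_n] L.
    apply: Ck_sum => [|i _]; first exact: openT.
    by apply: Ck_mul; [exact: openT|exact: Ck_coord|exact: Ck_cst].
  exact: (Ck_cont CL I).
have Lo : f \o shift x = cst (f x) + LL +o_ (0 : 'rV[R]_n) id.
  apply/eqaddoP => e e0.
  have [d d0 dP] := Ck1_increment oD Cf Dx e0.
  apply/nbhs_ballP; exists d => //= h; rewrite -ball_normE /= sub0r normrN => hd.
  have := dP h hd; rewrite -LE /=.
  have -> : (f \o shift x - (cst (f x) + L)) h = f (h + x) - f x - L h.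
    by rewrite -[LHS]/(f (h + x) - (f x + L h)) opprD addrA.
  by [].
have dE := diff_unique cL Lo.
by apply/diff_locallyP; rewrite dE; split => //; exact: Lo.
Qed.

Lemma differentiable_rV m (f : 'rV[R]_n -> 'rV[R]_m) x :
  (forall j, differentiable (fun y => f y 0 j) x) -> differentiable f x.
Proof.
move=> df.
have -> : f = \sum_(j < m) (fun y => f y 0 j *: delta_mx 0 j).
  by apply/funext => y; rewrite fct_sumE -row_sum_delta.
by apply: differentiable_sum => j; apply: differentiableZl.
Qed.

Lemma Ck1_differentiable_rV D m (f : 'rV[R]_n -> 'rV[R]_m) x :
  open D -> Ck 1 D f -> D x -> differentiable f x.
Proof.
move=> oD /(Ck_mxP _ _ oD) Cf Dx; apply: differentiable_rV => j.
exact: Ck1_differentiable (Cf 0 j) Dx.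
Qed.

End FiniteDim.

Section Composition.
Context {R : realType} {V : normedModType R} {m : nat}.

Lemma is_derive_compC1 (E : set 'rV[R]_m) (h : 'rV[R]_m -> R)
    (f : V -> 'rV[R]_m) (x v : V) :
  open E -> Ck 1 E h -> E (f x) -> derivable f x v ->
  is_derive x v (h \o f) (\sum_a ('D_v f x) 0 a * 'D_(e_ a) h (f x)).
Proof.
move=> oE Ch Efx df.
have [D1 D2] := is_derive_comp df (Ck1_differentiable oE Ch Efx).
by split=> //; rewrite D2 (derive_coord _ oE Ch Efx).
Qed.

Lemma Ck_comp k (D : set V) (E : set 'rV[R]_m) (h : 'rV[R]_m -> R)
    (f : V -> 'rV[R]_m) :
  open D -> open E -> (forall x, D x -> E (f x)) ->
  Ck k D f -> Ck k E h -> Ck k D (h \o f).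
Proof.
move=> oD oE DE; elim: k h => [|k IH] h Cf Ch.
  split=> // x Dx; apply: continuous_comp; first exact: (Ck_cont Cf Dx).
  exact: (Ck_cont Ch (DE x Dx)).
split=> [x Dx|v].
  apply: continuous_comp; first exact: (Ck_cont Cf Dx).
  exact: (Ck_cont Ch (DE x Dx)).
have dh x : D x ->
    is_derive x v (h \o f) (\sum_a ('D_v f x) 0 a * 'D_(e_ a) h (f x)).
  move=> Dx; apply: is_derive_compC1 (DE x Dx) _ => //.
    exact: Ck_le Ch.
  exact: (Ck_derivable Cf Dx).
split=> [x /dh[]//|].
apply: (Ck_ext oD (f := fun x => \sum_a ('D_v f x) 0 a * 'D_(e_ a) h (f x))).
  by move=> x /dh[].
apply: (Ck_sum (W := R)) => // a _; apply: Ck_mul => //.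
  by apply: Ck_entry => //; exact: Ck_derive.
by apply: (IH ('D_(e_ a) h)); [exact: Ck_pred|exact: Ck_derive].
Qed.

Lemma Ck_comp_mx k (D : set V) (E : set 'rV[R]_m) p q (h : 'rV[R]_m -> 'M[R]_(p, q))
    (f : V -> 'rV[R]_m) :
  open D -> open E -> (forall x, D x -> E (f x)) ->
  Ck k D f -> Ck k E h -> Ck k D (h \o f).
Proof.
move=> oD oE DE Cf /(Ck_mxP _ _ oE) Ch; apply/Ck_mxP => // i j.
exact: (Ck_comp oD oE DE Cf (Ch i j)).
Qed.

End Composition.

Section Schwarz.
Context {R : realType} {V : normedModType R}.
Implicit Types (D : set V) (f : V -> R).

Lemma is_derive_translate f w x v : derivable f (w + x) v ->
  is_derive x v (fun y => f (w + y)) ('D_v f (w + x)).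
Proof.
have [E1 E2] : (derivable (fun y => f (w + y)) x v <-> derivable f (w + x) v) /\
    'D_v (fun y => f (w + y)) x = 'D_v f (w + x).
  by apply: derive_eq_along_lines => h; rewrite addrCA.
by move=> df; split; [exact/E1|exact: E2].
Qed.

(** The mean value theorem, applied first along v and then along w, turns
    the mixed second difference into a mixed derivative at a nearby point.
    Its left side is symmetric in v and w. *)
Lemma second_difference D f x v w r : open D -> Ck 2 D f ->
  (forall h, `|h| < r -> D (h + x)) -> `|v| + `|w| < r ->
  exists2 h, `|h| <= `|v| + `|w| &
   f (w + (v + x)) - f (v + x) - (f (w + x) - f x) = 'D_w ('D_v f) (h + x).
Proof.
move=> oD Cf rD vwr; pose phi y := f (w + y) - f y.
have Cf1 := Ck_pred Cf.
have sz (s t : R) : 0 <= s <= 1 -> 0 <= t <= 1 ->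
    `|t *: w + s *: v| <= `|v| + `|w|.
  move=> /andP[s0 s1] /andP[t0 t1]; rewrite (le_trans (ler_normD _ _)) //.
  rewrite !normrZ !ger0_norm // addrC.
  by rewrite lerD // ler_piMl.
have inD (s t : R) : 0 <= s <= 1 -> 0 <= t <= 1 -> D (t *: w + (s *: v + x)).
  by move=> s01 t01; rewrite addrA; apply: rD; rewrite (le_lt_trans (sz _ _ s01 t01)).
have one : 0 <= (1 : R) <= 1 by rewrite ler01 lexx.
have zero : 0 <= (0 : R) <= 1 by rewrite ler01 lexx.
have dphi (s : R) : 0 <= s <= 1 ->
   is_derive (s *: v + x) v phi ('D_v f (w + (s *: v + x)) - 'D_v f (s *: v + x)).
  move=> s01; apply: is_deriveB.
    apply: is_derive_translate; apply: (Ck_derivable Cf1).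
    by have := inD _ _ s01 one; rewrite scale1r.
  apply: derivableP; apply: (Ck_derivable Cf1).
  by have := inD _ _ s01 zero; rewrite scale0r add0r.
have [s s01|s s01 ->] := @mean_value_line R V phi x v.
  by have [] := dphi s s01.
have s01' : 0 <= s <= 1 by case/andP: s01 => ? ?; rewrite !ltW.
have [_ ->] := dphi s s01'.
have [t t01|t t01 ->] := @mean_value_line R V ('D_v f) (s *: v + x) w.
  by apply: (Ck_derivable (Ck_derive v Cf)); exact: inD.
have t01' : 0 <= t <= 1 by case/andP: t01 => ? ?; rewrite !ltW.
by exists (t *: w + s *: v); [exact: sz|rewrite addrA].
Qed.

(** Schwarz's theorem. Both orders of differentiation are limits of the same
    second differences, divided by the square of the step. *)
Lemma derive2C D f x v w : open D -> Ck 2 D f -> D x ->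
  'D_v ('D_w f) x = 'D_w ('D_v f) x.
Proof.
move=> oD Cf Dx; have Cf1 := Ck_pred Cf.
suff S (e : R) : 0 < e -> `|'D_v ('D_w f) x - 'D_w ('D_v f) x| < e + e.
  apply/eqP; rewrite -subr_eq0 -normr_eq0; apply/eqP/le_anti.
  rewrite normr_ge0 andbT; apply/ler_addgt0Pr => e e0; rewrite add0r ltW //.
  by rewrite [e]splitr; apply: S; rewrite divr_gt0.
move=> e0.
have close (a b c : R) : `|a - b| < e -> `|a - c| < e -> `|b - c| < e + e.
  by rewrite -[b - c](subrKA a) distrC => H1 H2; rewrite (le_lt_trans (ler_normD _ _)) // ltrD.
have [r r0 rD] := open_ballP oD Dx.
have [d1 d10 dP1] := continuous_at_eps (Ck_cont (Ck_derive v (Ck_derive w Cf)) Dx) e0.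
have [d2 d20 dP2] := continuous_at_eps (Ck_cont (Ck_derive w (Ck_derive v Cf)) Dx) e0.
have N0 : 0 < `|v| + `|w| + 1 by rewrite ltr_wpDl // addr_ge0.
pose m := Num.min r (Num.min d1 d2).
have m0 : 0 < m by rewrite !lt_min r0 d10.
have [t t0 tN] : exists2 t, 0 < t & t * (`|v| + `|w| + 1) = m.
  by exists (m / (`|v| + `|w| + 1)); rewrite ?divr_gt0 // divfK ?gt_eqF.
have tm : `|t *: v| + `|t *: w| < m.
  by rewrite !normrZ (gtr0_norm t0) -mulrDr -tN (ltr_pM2l t0) ltrDl.
have tm' : `|t *: w| + `|t *: v| < m by rewrite addrC.
have mr : m <= r by rewrite ge_min lexx.
have md1 : m <= d1 by rewrite !ge_min lexx orbT.
have md2 : m <= d2 by rewrite !ge_min lexx !orbT.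
have [h1 h1m E1] := second_difference oD Cf rD (lt_le_trans tm mr).
have [h2 h2m E2] := second_difference oD Cf rD (lt_le_trans tm' mr).
have Dh1 : D (h1 + x) by apply: rD; rewrite (le_lt_trans h1m) // (lt_le_trans tm).
have Dh2 : D (h2 + x) by apply: rD; rewrite (le_lt_trans h2m) // (lt_le_trans tm').
have sc (a b : V) y : D y ->
    'D_(t *: a) ('D_(t *: b) f) y = t * t * 'D_a ('D_b f) y.
  move=> Dy.
  have E z : D z -> ('D_(t *: b) f) z = (cst t * 'D_b f) z.
    by move=> Dz; rewrite derive_scale //; exact: (Ck_derivable Cf1 Dz).
  have db : derivable ('D_b f) y a by exact: (Ck_derivable (Ck_derive b Cf) Dy).
  have dc : derivable (cst t : V -> R) y a by exact: derivable_cst.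
  rewrite (derive_ext _ oD Dy E) derive_scale; last first.
    exact: (derivableM dc db).
  rewrite (deriveM dc db).
  by rewrite derive_cst scaler0 addr0 -mulrA.
have E3 : 'D_w ('D_v f) (h1 + x) = 'D_v ('D_w f) (h2 + x).
  have : t * t * 'D_w ('D_v f) (h1 + x) = t * t * 'D_v ('D_w f) (h2 + x).
    apply: etrans (esym (etrans E1 (sc w v _ Dh1))) _.
    apply: etrans (etrans E2 (sc v w _ Dh2)).
    have -> : t *: w + (t *: v + x) = t *: v + (t *: w + x) by rewrite addrCA.
    move: (f (t *: v + (t *: w + x))) (f (t *: v + x)) (f (t *: w + x)) (f x).
    by move=> p1 p2 p3 p4; ring.
  by apply: mulfI; rewrite mulf_neq0 ?gt_eqF.
have Q2 : `|'D_w ('D_v f) (h1 + x) - 'D_w ('D_v f) x| < e.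
  exact: dP2 (le_lt_trans h1m (lt_le_trans tm md2)).
have Q1 : `|'D_v ('D_w f) (h2 + x) - 'D_v ('D_w f) x| < e.
  exact: dP1 (le_lt_trans h2m (lt_le_trans tm' md1)).
rewrite E3 in Q2; apply: (close _ _ _ Q1 Q2).
Qed.

Lemma derive2C_mx D p q (f : V -> 'M[R]_(p, q)) x v w :
  open D -> Ck 2 D f -> D x -> 'D_v ('D_w f) x = 'D_w ('D_v f) x.
Proof.
move=> oD Cf Dx; have Cf1 := Ck_pred Cf.
have E a b i j : 'D_a ('D_b f) x i j = 'D_a ('D_b (fun y => f y i j)) x.
  rewrite derive_mx ?mxE; last exact: (Ck_derivable (Ck_derive b Cf) Dx).
  apply: derive_ext oD Dx _ => y Dy.
  by rewrite derive_mx ?mxE //; exact: (Ck_derivable Cf1 Dy).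
apply/matrixP => i j; apply: (etrans (E v w i j)); apply: (etrans _ (esym (E w v i j))).
by apply: (derive2C v w oD _ Dx); exact: Ck_entry.
Qed.

End Schwarz.

(** * Ordinary differential equations *)

Section Antiderivative.
Context {R : realType}.

(** Integrating from - b rather than from 0 covers the times of both signs;
    the value at 0 is subtracted afterwards. *)
Lemma antiderivative (c : R -> R) (b : R) : 0 < b -> continuous c ->
  exists2 P : R -> R, P 0 = 0 & forall t : R, `|t| < b -> is_derive t 1 P (c t).
Proof.
move=> b0 cc.
have ic : (@lebesgue_measure R).-integrable `[- b, b] (EFin \o c).
  apply: continuous_compact_integrable; first exact: segment_compact.
  exact: continuous_subspaceT.
pose F (x : R) := (\int[@lebesgue_measure R]_(t in [set` `[- b, x]]) (c t))%R.
have dF (t : R) : `|t| < b -> is_derive t 1 F (c t).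
  rewrite ltr_norml => /andP[bt tb].
  have [d1 d2] := continuous_FTC1_closed tb ic bt (cc t).
  by split; [exact: d1|rewrite -derive1E].
exists (fun t => F t - F 0); first by rewrite subrr.
move=> t /dF dt; rewrite -[c t]subr0.
by apply: is_deriveB; exact: is_derive_cst.
Qed.

Lemma mean_value_bound (f df : R -> R) (a K : R) :
  continuous f -> f 0 = 0 ->
  (forall s : R, `|s| < a -> is_derive s 1 f (df s)) ->
  (forall s, `|s| < a -> `|df s| <= K) ->
  forall t, `|t| <= a -> `|f t| <= K * `|t|.
Proof.
move=> cf f0 dff dK t ta.
have inside c (l r : R) : `|l| <= a -> `|r| <= a -> c \in `]l, r[%R -> `|c| < a.
  rewrite in_itv /= !ler_norml => /andP[l1 l2] /andP[r1 r2] /andP[c1 c2].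
  by rewrite ltr_norml (le_lt_trans l1 c1) (lt_le_trans c2 r2).
have a0 : `|0 : R| <= a by rewrite normr0 (le_trans _ ta).
have [t0|t0|->] := ltgtP t 0; last by rewrite f0 !normr0 mulr0.
- have [|c cI] := @MVT R f df t 0 t0 _ (continuous_subspaceT cf).
    by move=> c cI; apply: dff; exact: inside cI.
  rewrite f0 !sub0r => /eqP; rewrite eqr_oppLR => /eqP ->.
  rewrite normrN normrM normrN ler_wpM2r //.
  by apply: dK; exact: inside cI.
- have [|c cI] := @MVT R f df 0 t t0 _ (continuous_subspaceT cf).
    by move=> c cI; apply: dff; exact: inside cI.
  rewrite f0 !subr0 => ->.
  rewrite normrM ler_wpM2r //.
  by apply: dK; exact: inside cI.
Qed.

(** How the geometric estimates of the Picard iteration are used in the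
    limit. *)
Lemma halves_le0 (d C : R) : (forall k, d <= C / 2 ^+ k) -> d <= 0.
Proof.
move=> dk; rewrite leNgt; apply/negP => d0.
have C0 : 0 < C by rewrite (lt_le_trans d0) // (le_trans (dk 0)) // expr0 divr1.
have := dk (Num.bound (C / d)); rewrite leNgt => /negP; apply.
rewrite ltr_pdivrMr ?exprn_gt0 // mulrC -ltr_pdivrMr //.
exact: upper_nthrootP.
Qed.

(** The sequence u k - 2 C / 2^k is nondecreasing and bounded above by the
    nonincreasing sequence u k + 2 C / 2^k; the supremum of the first is the
    limit, and the error bound comes for free. *)
Lemma geometric_limit (u : nat -> R) (C : R) :
  (forall k, `|u k.+1 - u k| <= C / 2 ^+ k) ->
  exists l, forall k, `|u k - l| <= 2 * C / 2 ^+ k.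
Proof.
move=> uC.
have e2 k : C / 2 ^+ k = 2 * C / 2 ^+ k - 2 * C / 2 ^+ k.+1.
  by rewrite exprS invfM; field; rewrite expf_neq0.
have C0 : 0 <= C.
  by rewrite (le_trans (normr_ge0 _) (le_trans (uC 0) _)) // expr0 divr1.
pose v k := u k - 2 * C / 2 ^+ k; pose w k := u k + 2 * C / 2 ^+ k.
have vS k : v k <= v k.+1.
  by have := uC k; rewrite /v ler_norml => /andP[+ _]; rewrite e2; lra.
have wS k : w k.+1 <= w k.
  by have := uC k; rewrite /w ler_norml => /andP[_]; rewrite e2; lra.
have vw j k : v j <= w k.
  have vm : {homo v : i j / (i <= j)%N >-> i <= j} by apply: homo_leq => //; exact: le_trans.
  have wm : {homo w : i j / (i <= j)%N >-> j <= i}.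
    by apply: homo_leq => // a b c ba cb; exact: le_trans cb ba.
  apply: (le_trans (vm _ _ (leq_maxl j k))).
  apply: (le_trans _ (wm _ _ (leq_maxr j k))).
  rewrite /v /w lerD2l ge0_cp //.
  by rewrite divr_ge0 ?mulr_ge0 // exprn_ge0.
have E0 : range v !=set0 by exists (v 0), 0.
exists (sup (range v)) => k; rewrite ler_distl.
have ub : ubound (range v) (w k) by move=> _ [j _ <-].
have := ge_sup E0 ub.
have : v k <= sup (range v).
  by apply: ub_le_sup; [exists (w k)|exists k].
by rewrite /v /w => H1 H2; rewrite lerBlDr H2 -lerBlDr H1.
Qed.

Lemma norm_rV_le n (h : 'rV[R]_n) (c : R) : 0 <= c ->
  (forall i, `|h 0 i| <= c) -> `|h| <= c.
Proof.
move=> c0 hc; rewrite [leLHS]/Num.Def.normr/= mx_normrE.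
by apply: bigmax_le => // -[i j] _ /=; rewrite (ord1 i).
Qed.

Lemma uniform_limit n (u : nat -> R -> 'rV[R]_n) (C : R) :
  (forall k, continuous (u k)) ->
  (forall k t, `|u k.+1 t - u k t| <= C / 2 ^+ k) ->
  exists2 y : R -> 'rV[R]_n, continuous y &
    forall k t, `|u k t - y t| <= 2 * C / 2 ^+ k.
Proof.
move=> cu uC.
have C0 : 0 <= C.
  by rewrite (le_trans (normr_ge0 _) (le_trans (uC 0%N 0) _)) // expr0 divr1.
have p0 k : 0 <= 2 * C / 2 ^+ k by rewrite divr_ge0 ?mulr_ge0 // exprn_ge0.
have lim t i : exists l, forall k, `|u k t 0 i - l| <= 2 * C / 2 ^+ k.
  apply: geometric_limit => k; apply: le_trans (uC k t).
  by have := norm_coord_le (u k.+1 t - u k t) i; rewrite !mxE.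
pose y t := \row_i sval (cid (lim t i)).
have yE k t : `|u k t - y t| <= 2 * C / 2 ^+ k.
  apply: norm_rV_le => // i; rewrite !mxE.
  exact: (svalP (cid (lim t i)) k).
exists y => // t; apply/cvgrPdist_lt => e e0.
have [k ke] : exists k, 2 * C / 2 ^+ k < e / 4.
  apply/not_existsP => H; have : e / 4 <= 0.
    by apply: (@halves_le0 _ (2 * C)) => k; rewrite leNgt; apply/negP; exact: H.
  by rewrite leNgt divr_gt0.
have e2 : 0 < e / 2 by rewrite divr_gt0.
have /cvgrPdist_lt/(_ _ e2) ck := cu k t.
near=> s.
have ks : `|u k t - u k s| < e / 2 by near: s.
have := yE k t; have := yE k s.
rewrite (distrC _ (y t)) => ys yt.
apply: (le_lt_trans (ler_distD (u k t) _ _)).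
have := ler_distD (u k s) (u k t) (y s); lra.
Unshelve. all: by end_near. Qed.

End Antiderivative.

Lemma near_dist {R : realType} {V : normedModType R} (x : V) (e : R) : 0 < e ->
  \forall y \near x, `|x - y| < e.
Proof. by move=> e0; apply/nbhs_ballP; exists e => // y; rewrite -ball_normE. Qed.

Lemma lipschitz_continuous {R : realType} {V W : normedModType R} (X : V -> W) (L : R) :
  (forall x y, `|X x - X y| <= L * `|x - y|) -> continuous X.
Proof.
move=> XL x; apply/cvgrPdist_lt => e e0.
have L1 : 0 < `|L| + 1 by rewrite ltr_wpDl.
have e1 : 0 < e / (`|L| + 1) by rewrite divr_gt0.
near=> y; have xy : `|x - y| < e / (`|L| + 1).
  by near: y; exact: near_dist.
rewrite ltr_pdivlMr // in xy; apply: le_lt_trans xy.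
apply: le_trans (XL x y) _; rewrite mulrC ler_wpM2l //.
by rewrite (le_trans (ler_norm L)) // lerDl.
Unshelve. all: by end_near. Qed.

Section Picard.
Context {R : realType} {n : nat}.
Implicit Types X : 'rV[R]_n -> 'rV[R]_n.

(** The retraction of the line onto [- a, a] (for a >= 0). *)
Definition clamp (a t : R) : R := Num.max (- a) (Num.min a t).

Lemma clamp_norm a t : 0 <= a -> `|clamp a t| <= a.
Proof.
move=> a0; rewrite ler_norml /clamp le_max lexx /= ge_max ge_min lexx andbT.
by rewrite (le_trans _ a0) // oppr_le0.
Qed.

Lemma clamp_id a t : `|t| <= a -> clamp a t = t.
Proof. by rewrite ler_norml /clamp => /andP[at_ ta]; rewrite (min_idPr ta) (max_idPr at_). Qed.

Lemma clamp_lipschitz a s t : `|clamp a s - clamp a t| <= 1 * `|s - t|.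
Proof.
rewrite mul1r.
have mn (c x y : R) : `|Num.min c x - Num.min c y| <= `|x - y|.
  have := ler_norm (x - y); have := ler_norm (y - x); rewrite distrC ler_norml.
  by case: (lerP c x) => ?; case: (lerP c y) => ?; move=> *; apply/andP; split; lra.
have mx (c x y : R) : `|Num.max c x - Num.max c y| <= `|x - y|.
  have := ler_norm (x - y); have := ler_norm (y - x); rewrite distrC ler_norml.
  by case: (lerP c x) => ?; case: (lerP c y) => ?; move=> *; apply/andP; split; lra.
exact: le_trans (mx _ _ _) (mn _ _ _).
Qed.

Lemma clamp_continuous a : continuous (clamp a).
Proof. exact: (@lipschitz_continuous R R R _ 1 (clamp_lipschitz a)). Qed.

Lemma is_derive_entry {V : normedModType R} p q (z : V -> 'M[R]_(p, q)) t v (d : 'M[R]_(p, q)) i j :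
  is_derive t v z d -> is_derive t v (fun s => z s i j) (d i j).
Proof.
move=> [dz <-]; split; first exact: (derivable_mxP z t v).1 dz i j.
by rewrite derive_mx // mxE.
Qed.

Lemma is_derive_rV {V : normedModType R} (z : V -> 'rV[R]_n) t v (d : 'rV[R]_n) :
  (forall i, is_derive t v (fun s => z s 0 i) (d 0 i)) -> is_derive t v z d.
Proof.
move=> dz; have D : derivable z t v.
  by apply/derivable_mxP => i0 i; rewrite (ord1 i0); have [] := dz i.
by split=> //; rewrite derive_mx //; apply/rowP => i; rewrite mxE; have [] := dz i.
Qed.

(** One step of the Picard iteration. The new curve is frozen outside of [-
    a, a], so that all iterates are continuous on the whole line and can be
    compared at every time. *)
Lemma picard_step (c : R -> 'rV[R]_n) (x0 : 'rV[R]_n) (a : R) :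
  0 < a -> continuous c ->
  exists z : R -> 'rV[R]_n, [/\ continuous z, z 0 = x0,
    (forall t, z t = z (clamp a t)) &
    forall t : R, `|t| < a -> is_derive t 1 z (c t)].
Proof.
move=> a0 cc.
have a2 : 0 < 2 * a by rewrite mulr_gt0.
have ex i : exists P : R -> R, P 0 = 0 /\
    forall t : R, `|t| < 2 * a -> is_derive t 1 P (c t 0 i).
  have [P P0 dP] := @antiderivative R (fun t => c t 0 i) (2 * a) a2
     (fun t => (continuous_mxP c t).1 (cc t) 0 i).
  by exists P.
have [P PE] := choice ex.
have idem t : clamp a (clamp a t) = clamp a t.
  by rewrite clamp_id // clamp_norm // ltW.
exists (fun t => \row_i (x0 0 i + P i (clamp a t))); split.
- move=> t; apply/continuous_mxP => i0 i; rewrite (ord1 i0).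
  rewrite (_ : (fun t => _) = (fun t => x0 0 i + P i (clamp a t))); last first.
    by apply/funext => s; rewrite mxE.
  apply: cvgD; first exact: cvg_cst.
  apply: continuous_comp; first exact: clamp_continuous.
  have ct : `|clamp a t| < 2 * a.
    by rewrite (le_lt_trans (clamp_norm _ (ltW a0))) // ltr_pMl // ltr1n.
  have [_ /(_ _ ct)[dP _]] := PE i.
  exact/differentiable_continuous/derivable1_diffP.
- apply/rowP => i; rewrite mxE clamp_id ?normr0 ?ltW //.
  by have [-> _] := PE i; rewrite addr0.
- by move=> t; apply/rowP => i; rewrite !mxE idem.
- move=> t ta; apply: is_derive_rV => i.
  rewrite (_ : (fun t => _) = (fun t => x0 0 i + P i (clamp a t))); last first.
    by apply/funext => s; rewrite mxE.
  have dP : is_derive t 1 (fun t => x0 0 i + P i t) (c t 0 i).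
    rewrite -[c t 0 i]add0r; apply: is_deriveD.
    by apply: (PE i).2; rewrite (lt_trans ta) // ltr_pMl // ltr1n.
  apply: near_eq_is_derive dP; near=> s; rewrite clamp_id //.
  have : `|t - s| < a - `|t| by near: s; apply: (@near_dist R R); rewrite subr_gt0.
  have := ler_normD t (s - t); rewrite addrC subrK distrC; lra.
Unshelve. all: by end_near. Qed.

(** Picard-Lindelof for a globally Lipschitz field on a time interval where
    the iteration contracts by 1/2. *)
Lemma picard_global X (L : R) (x0 : 'rV[R]_n) (a : R) :
  0 < a -> L * a <= 1 / 2 ->
  (forall x y, `|X x - X y| <= L * `|x - y|) ->
  exists y : R -> 'rV[R]_n, [/\ continuous y, y 0 = x0 &
    forall t : R, `|t| < a -> is_derive t 1 y (X (y t))].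
Proof.
move=> a0 La XL; have cX := lipschitz_continuous XL.
pose good y z := [/\ continuous z, z 0 = x0,
    (forall t, z t = z (clamp a t)) &
    forall t : R, `|t| < a -> is_derive t 1 z (X (y t))].
have ex (y : R -> 'rV[R]_n) : exists z, continuous y -> good y z.
  have [cy|ncy] := pselect (continuous y); last by exists y.
  have cXy : continuous (X \o y) by move=> t; apply: continuous_comp; [exact: cy|exact: cX].
  by have [z zP] := picard_step x0 a0 cXy; exists z.
have [T TP] := choice ex.
(* mean value inequality for the difference of two curves with the same start *)
have est (z z' : R -> 'rV[R]_n) (d d' : R -> 'rV[R]_n) (K : R) :
    continuous z -> continuous z' -> z 0 = z' 0 ->
    (forall t, z t = z (clamp a t)) -> (forall t, z' t = z' (clamp a t)) ->
    (forall t : R, `|t| < a -> is_derive t 1 z (d t)) ->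
    (forall t : R, `|t| < a -> is_derive t 1 z' (d' t)) ->
    (forall t, `|d t - d' t| <= K) -> forall t, `|z t - z' t| <= K * a.
  move=> cz cz' z00 fz fz' dz dz' dK t.
  have K0 : 0 <= K by exact: le_trans (normr_ge0 _) (dK 0).
  rewrite fz fz'; apply: norm_rV_le => [|i]; first by rewrite mulr_ge0 // ltW.
  rewrite !mxE.
  have ca := clamp_norm t (ltW a0).
  apply: (@le_trans _ _ (K * `|clamp a t|)); last by rewrite ler_wpM2l.
  apply: (@mean_value_bound _ (fun s => z s 0 i - z' s 0 i)
    (fun s => d s 0 i - d' s 0 i) a) => //.
  - move=> s; apply: cvgB.
      exact: (continuous_mxP z s).1 (cz s) 0 i.
    exact: (continuous_mxP z' s).1 (cz' s) 0 i.
  - by rewrite z00 subrr.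
  - move=> s sa; apply: is_deriveB; apply: is_derive_entry; [exact: dz|exact: dz'].
  - move=> s sa; apply: le_trans (dK s).
    by have := norm_coord_le (d s - d' s) i; rewrite !mxE.
have contr (p q : R -> 'rV[R]_n) (D : R) : continuous p -> continuous q ->
    (forall s, `|p s - q s| <= D) -> forall t, `|T p t - T q t| <= D / 2.
  move=> cp cq pq t.
  have [c1 z1 f1 d1] := TP _ cp; have [c2 z2 f2 d2] := TP _ cq.
  have D0 : 0 <= D by exact: le_trans (normr_ge0 _) (pq 0).
  have [L0|L0] := leP 0 L.
    apply: (@le_trans _ _ (L * D * a)); last first.
      by rewrite mulrAC; have := ler_wpM2r D0 La; lra.
    apply: (est _ _ _ _ _ c1 c2 (etrans z1 (esym z2)) f1 f2 d1 d2).
    by move=> s; apply: le_trans (XL _ _) _; rewrite ler_wpM2l.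
  apply: (@le_trans _ _ (0 * a)); last by rewrite mul0r divr_ge0.
  apply: (est _ _ _ _ _ c1 c2 (etrans z1 (esym z2)) f1 f2 d1 d2).
  by move=> s; apply: le_trans (XL _ _) _; rewrite nmulr_rle0.
pose u k := iter k T (cst x0).
have cu k : continuous (u k).
  elim: k => [|k IH]; first by move=> t; exact: cvg_cst.
  by have [] := TP _ IH.
pose C := `|X x0| * a.
have uC k t : `|u k.+1 t - u k t| <= C / 2 ^+ k.
  elim: k t => [|k IH] t.
    have [c1 z1 f1 d1] := TP _ (cu 0%N).
    have c0 : continuous (cst x0 : R -> _) by move=> s; exact: cvg_cst.
    have d0 (s : R) : `|s| < a -> is_derive s 1 (cst x0 : R -> _) ((cst 0 : R -> _) s).
      by move=> _; exact: is_derive_cst.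
    rewrite expr0 divr1; apply: (est _ _ _ _ _ c1 c0 z1 f1 (fun=> erefl) d1 d0).
    by move=> s; rewrite subr0.
  rewrite exprS invfM mulrCA mulrC.
  by apply: (contr (u k.+1) (u k)).
have [y cy yu] := uniform_limit cu uC.
have Ty : T y = y.
  apply/funext => t; apply/eqP; rewrite -subr_eq0 -normr_eq0; apply/eqP/le_anti.
  rewrite normr_ge0 andbT; apply: (@halves_le0 _ _ (2 * C)) => k.
  apply: (le_trans (ler_distD (u k.+1 t) _ _)).
  have H1 : `|T y t - u k.+1 t| <= C / 2 ^+ k.
    have -> : C / 2 ^+ k = (2 * C / 2 ^+ k) / 2 by field; rewrite expf_neq0.
    by apply: (contr y (u k)) => // s; rewrite distrC.
  have H2 : `|u k.+1 t - y t| <= C / 2 ^+ k.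
    have -> : C / 2 ^+ k = 2 * C / 2 ^+ k.+1 by rewrite exprS; field; rewrite expf_neq0.
    exact: yu.
  by rewrite -mulrA mulr2n mulrDl mul1r lerD.
have [c1 z1 f1 d1] := TP _ cy; rewrite Ty in c1 z1 f1 d1.
by exists y.
Qed.

End Picard.

Section LocalODE.
Context {R : realType} {n : nat}.
Implicit Types (D : set 'rV[R]_n) (X : 'rV[R]_n -> 'rV[R]_n).

Lemma Ck1_lipschitz D X (x0 : 'rV[R]_n) : open D -> Ck 1 D X -> D x0 ->
  exists r L : R, [/\ 0 < r, 0 <= L,
    forall x, `|x - x0| <= r -> D x &
    forall x y, `|x - x0| <= r -> `|y - x0| <= r -> `|X x - X y| <= L * `|x - y|].
Proof.
move=> oD CX Dx0.
have [r0 r00 r0D] := open_ballP oD Dx0.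
have CXi i : Ck 1 D (fun x => X x 0 i) by exact: Ck_entry.
pose dX (ij : 'I_n * 'I_n) := 'D_(e_ ij.2) (fun x => X x 0 ij.1).
have /nbhs_ballP[r1 /= r10 r1P] :
    \forall y \near x0, forall ij, `|dX ij x0 - dX ij y| < 1.
  apply: (filter_forall (nbhs_filter x0)) => ij.
  have C : {for x0, continuous (dX ij)}.
    exact: (Ck_cont (Ck_derive (e_ ij.2) (CXi ij.1)) Dx0).
  by have /cvgrPdist_lt/(_ _ ltr01) := C.
pose K := \sum_ij `|dX ij x0| + 1.
have dXK y ij : `|y - x0| < r1 -> `|dX ij y| <= K.
  move=> yr; have /(_ ij) H : forall ij, `|dX ij x0 - dX ij y| < 1.
    by apply: r1P; rewrite -ball_normE /= distrC.
  have H1 : `|dX ij x0| <= \sum_ij `|dX ij x0|.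
    by rewrite (bigD1 ij) //= lerDl sumr_ge0.
  have := ler_distD (dX ij x0) (dX ij y) 0; rewrite !subr0 distrC /K.
  lra.
pose r := Num.min r0 r1 / 2.
have m0 : 0 < Num.min r0 r1 by rewrite lt_min r00.
have r_lt0 : r < r0 by rewrite (@lt_le_trans _ _ (Num.min r0 r1)) ?ge_min ?lexx //
  /r ltr_pdivrMr // ltr_pMr // ltr1n.
have r_lt1 : r < r1 by rewrite (@lt_le_trans _ _ (Num.min r0 r1)) ?ge_min ?lexx ?orbT //
  /r ltr_pdivrMr // ltr_pMr // ltr1n.
have K0 : 0 <= K by rewrite addr_ge0 // sumr_ge0.
have inD x : `|x - x0| <= r -> D x.
  by move=> xr; rewrite -(subrK x0 x); apply: r0D; exact: le_lt_trans r_lt0.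
exists r, (n%:R * K); split => //; first by rewrite divr_gt0.
  by rewrite mulr_ge0.
move=> x y xr yr.
have seg (s : R) : 0 <= s <= 1 -> `|s *: (x - y) + y - x0| <= r.
  move=> /andP[s0 s1].
  have -> : s *: (x - y) + y - x0 = s *: (x - x0) + (1 - s) *: (y - x0).
    by apply/rowP => i; rewrite !mxE; ring.
  rewrite (le_trans (ler_normD _ _)) // !normrZ (ger0_norm s0) ger0_norm ?subr_ge0 //.
  have s1' : 0 <= 1 - s by rewrite subr_ge0.
  have := ler_wpM2l s0 xr; have := ler_wpM2l s1' yr; lra.
apply: norm_rV_le => [|i]; first by rewrite !mulr_ge0.
rewrite !mxE.
have [|s s01] := @mean_value_line R _ (fun x => X x 0 i) y (x - y).
  by move=> s s01; apply: (Ck_derivable (CXi i)); exact/inD/seg.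
rewrite subrK => ->.
have s01' : 0 <= s <= 1 by case/andP: s01 => ? ?; rewrite !ltW.
rewrite (derive_coord _ oD (CXi i) (inD _ (seg _ s01'))).
rewrite (le_trans (ler_norm_sum _ _ _)) //.
rewrite (@le_trans _ _ (\sum_(j < n) `|x - y| * K)) //.
  apply: ler_sum => j _; rewrite normrM ler_pM //; first exact: norm_coord_le.
  by apply: (dXK _ (i, j)); exact: le_lt_trans (seg _ s01') r_lt1.
rewrite sumr_const card_ord -[X in X <= _]mulr_natl.
by rewrite (_ : n%:R * (_ * K) = n%:R * K * `|x - y|) //; ring.
Qed.

(** The retraction onto a cube. Composed with it, a field which is Lipschitz
    on the cube becomes globally Lipschitz. *)
Definition clampv (x0 : 'rV[R]_n) (r : R) (x : 'rV[R]_n) : 'rV[R]_n :=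
  \row_i (x0 0 i + clamp r (x 0 i - x0 0 i)).

Lemma clampv_norm x0 r x : 0 <= r -> `|clampv x0 r x - x0| <= r.
Proof.
move=> r0; apply: norm_rV_le => // i; rewrite !mxE addrAC subrr add0r.
exact: clamp_norm.
Qed.

Lemma clampv_id x0 r x : `|x - x0| <= r -> clampv x0 r x = x.
Proof.
move=> xr; apply/rowP => i; rewrite !mxE clamp_id ?[x0 0 i + _]addrC ?subrK //.
by have := norm_coord_le (x - x0) i; rewrite !mxE => /le_trans; apply.
Qed.

Lemma clampv_lipschitz x0 r x y : `|clampv x0 r x - clampv x0 r y| <= `|x - y|.
Proof.
apply: norm_rV_le => // i; rewrite !mxE.
have -> (a b c : R) : a + b - (a + c) = b - c by ring.
apply: le_trans (clamp_lipschitz _ _ _) _.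
rewrite mul1r; have := norm_coord_le (x - y) i; rewrite !mxE.
by have -> (a b c : R) : a - b - (c - b) = a - c by ring.
Qed.

Lemma Ck_curve k m (I : set R) (y d : R -> 'rV[R]_m) : open I ->
  (forall t, I t -> is_derive t 1 y (d t)) -> Ck k I d -> Ck k.+1 I y.
Proof.
move=> oI dy Cd.
have dfy t : I t -> differentiable y t.
  by move=> /dy[? _]; exact/derivable1_diffP.
split=> [t It|v]; first exact/differentiable_continuous/dfy.
split=> [t It|]; first exact/diff_derivable/dfy.
apply/Ck_mxP => // i j.
have C1 : Ck k I (fun t => v * d t i j).
  by apply: Ck_mul => //; [exact: Ck_cst|exact: Ck_entry].
apply: (Ck_ext oI _ C1) => t It.
have [D1 D2] := dy t It.
have -> : v = v *: 1 :> R by rewrite [_%:A]mulr1.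
by rewrite derive_scale // D2 mxE [_%:A]mulr1.
Qed.

Lemma open_ball0 (a : R) : open [set t : R | `|t| < a].
Proof.
have -> : [set t : R | `|t| < a] = `]- a, a[%classic.
  by apply/seteqP; split => t /=; rewrite in_itv /= ltr_norml.
exact: itv_open.
Qed.

(** Solve for the field composed with the retraction onto a cube; the
    solution stays in the cube for small times. Each derivative of the field
    gives one more derivative of the solution, by bootstrapping the
    equation. *)
Lemma ode_local k D X (x0 : 'rV[R]_n) : open D -> Ck k.+1 D X -> D x0 ->
  exists a (y : R -> 'rV[R]_n), [/\ 0 < a, y 0 = x0,
    forall t : R, `|t| < a -> D (y t) /\ is_derive t 1 y (X (y t)) &
    Ck k.+2 [set t : R | `|t| < a] y].
Proof.
move=> oD CX Dx0.
have [r [L [r0 L0 rD XL]]] := Ck1_lipschitz oD (Ck_le (ltn0Sn k) CX) Dx0.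
have XL' x y : `|X (clampv x0 r x) - X (clampv x0 r y)| <= L * `|x - y|.
  apply: le_trans (XL _ _ _ _) _; try exact/clampv_norm/ltW.
  by rewrite ler_wpM2l // clampv_lipschitz.
have N0 : 0 < L + 1 by rewrite ltr_wpDl.
(* L + 1 rather than L, which may be 0 *)
pose a := 1 / (2 * (L + 1)).
have a0 : 0 < a by rewrite divr_gt0 // mulr_gt0.
have La : L * a <= 1 / 2.
  have : (L + 1) * a = 1 / 2 by rewrite /a; field; rewrite gt_eqF.
  rewrite mulrDl mul1r; lra.
have [y [cy y0 dy]] := picard_global x0 a0 La XL'.
have /cvgrPdist_lt/(_ _ r0)/nbhs_ballP[b /= b0 bP] := cy 0.
have ynear (t : R) : `|t| < b -> `|y t - x0| <= r.
  move=> tb; rewrite ltW // -y0 distrC; apply: bP.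
  by rewrite -ball_normE /= sub0r normrN.
pose c := Num.min a b.
have dy' (t : R) : `|t| < c -> D (y t) /\ is_derive t 1 y (X (y t)).
  rewrite lt_min => /andP[ta tb]; split; first exact/rD/ynear.
  by have := dy t ta; rewrite clampv_id //; exact: ynear.
exists c, y; split => //; first by rewrite lt_min a0.
have oI := @open_ball0 c.
have CC j : (j <= k.+2)%N -> Ck j [set t : R | `|t| < c] y.
  elim: j => [|j IH] jk.
    split=> // t It; have [_ [D1 _]] := dy' t It.
    exact/differentiable_continuous/derivable1_diffP.
  apply: (Ck_curve oI (fun t It => (dy' t It).2)).
  apply: (Ck_comp_mx oI oD (fun t It => (dy' t It).1)); first exact/IH/ltnW.
  exact: Ck_le CX.
exact: CC (leqnn _).
Qed.

End LocalODE.

Section ZeroODE.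
Context {R : realType}.

Lemma mean_value_bound_open (f df : R -> R) (a K : R) : f 0 = 0 ->
  (forall s : R, `|s| < a -> is_derive s 1 f (df s)) ->
  (forall s, `|s| < a -> `|df s| <= K) ->
  forall t, `|t| < a -> `|f t| <= K * `|t|.
Proof.
move=> f0 dff dK t ta.
have seg (s : R) : 0 <= s <= 1 -> `|s *: t + 0| < a.
  by move=> s01; rewrite addr0; exact: norm_segment.
have dft (s : R) : 0 <= s <= 1 ->
    derivable f (s *: t + 0) t /\ 'D_t f (s *: t + 0) = t *: df (s *: t + 0).
  move=> /seg /dff[D1 D2]; split; first exact/diff_derivable/derivable1_diffP.
  by have := derive_scale t D1; rewrite [_%:A]mulr1 D2.
have [s s01|s s01] := @mean_value_line R R f 0 t; first by have [] := dft s s01.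
have s01' : 0 <= s <= 1 by case/andP: s01 => ? ?; rewrite !ltW.
have [_ ->] := dft s s01'.
rewrite addr0 f0 subr0 => ->; rewrite normrM mulrC ler_wpM2r //.
by apply: dK; exact: seg.
Qed.

(** On a short interval the equation halves any bound on the solution, by
    the mean value theorem; the bounds 1 / 2^k tend to 0. *)
Lemma linear_ode_zero n (z dz : 'I_n -> R -> R) (a K : R) : 0 < a ->
  (forall i, z i 0 = 0) ->
  (forall i (t : R), `|t| < a -> is_derive t 1 (z i) (dz i t)) ->
  (forall i (t : R), `|t| < a -> `|dz i t| <= K * \sum_j `|z j t|) ->
  exists2 b, 0 < b <= a & forall i (t : R), `|t| < b -> z i t = 0.
Proof.
move=> a0 z0 dz_ dzK.
have cz i : {for 0, continuous (z i)}.
  have [D _] := dz_ i 0 (eq_ind_r (fun x => x < a) a0 (normr0 _)).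
  exact/differentiable_continuous/derivable1_diffP.
have /nbhs_ballP[c /= c0 cP] : \forall t \near (0 : R), forall i, `|z i 0 - z i t| < 1.
  apply: (filter_forall (nbhs_filter (0 : R))) => i.
  by have /cvgrPdist_lt/(_ _ ltr01) := cz i.
have N0 : 0 < `|K| * n%:R + 1 by rewrite ltr_wpDl // mulr_ge0.
pose e := 1 / (2 * (`|K| * n%:R + 1)).
have e0 : 0 < e by rewrite divr_gt0 // mulr_gt0.
have eK : `|K| * n%:R * e <= 1 / 2.
  have : (`|K| * n%:R + 1) * e = 1 / 2 by rewrite /e; field; rewrite gt_eqF.
  rewrite mulrDl mul1r; lra.
pose b := Num.min a (Num.min c e).
have bP (t : R) : `|t| < b -> [/\ `|t| < a, `|t| < c & `|t| < e].
  by rewrite !lt_min => /andP[? /andP[]].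
exists b; first by rewrite !lt_min a0 c0 e0 ge_min lexx.
have bound k : forall i (t : R), `|t| < b -> `|z i t| <= 1 / 2 ^+ k.
  elim: k => [|k IH] i t tb.
    have [ta tc te] := bP t tb.
    have /(_ i) : forall i, `|z i 0 - z i t| < 1.
      by apply: cP; rewrite -ball_normE /= sub0r normrN.
    by rewrite z0 sub0r normrN expr0 divr1 => /ltW.
  have [ta tc te] := bP t tb.
  have dK (s : R) : `|s| < b -> `|dz i s| <= `|K| * (n%:R * (1 / 2 ^+ k)).
    move=> sb; have [sa _ _] := bP s sb; apply: le_trans (dzK i s sa) _.
    have S0 : 0 <= \sum_j `|z j s| by exact: sumr_ge0.
    apply: (le_trans (ler_wpM2r S0 (ler_norm K))); rewrite ler_wpM2l //.
    apply: (@le_trans _ _ (\sum_(j < n) 1 / 2 ^+ k)).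
      by apply: ler_sum => j _; exact: IH.
    by rewrite sumr_const card_ord -[X in X <= _]mulr_natl.
  have dzb (s : R) : `|s| < b -> is_derive s 1 (z i) (dz i s).
    by move=> /bP[sa _ _]; exact: dz_.
  apply: le_trans (mean_value_bound_open (z0 i) dzb dK tb) _.
  have p0 : 0 <= 1 / 2 ^+ k :> R by rewrite divr_ge0 // exprn_ge0.
  rewrite exprS invfM (_ : _ * _ * _ = (`|K| * n%:R * `|t|) * (1 / 2 ^+ k)); last by ring.
  have KN : 0 <= `|K| * n%:R by rewrite mulr_ge0.
  have := ler_wpM2r p0 (le_trans (ler_wpM2l KN (ltW te)) eK).
  by move/le_trans; apply; rewrite !mul1r.
move=> i t tb; apply/eqP; rewrite -normr_eq0; apply/eqP/le_anti.
rewrite normr_ge0 andbT; apply: (@halves_le0 _ _ 1) => k; exact: bound.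
Qed.

End ZeroODE.

(** * Inverses and cofactors of bordered matrices *)

Section Border.

Lemma sum_lift_max (V : nmodType) n (F : 'I_n.+1 -> V) :
  \sum_a F a = \sum_(i < n) F (lift ord_max i) + F ord_max.
Proof.
rewrite big_ord_recr /=; congr (_ + _); apply: eq_bigr => i _; congr F.
by apply: val_inj; rewrite /= /bump leqNgt ltn_ord.
Qed.

(** The block of H left after deleting its last row and column. *)
Definition core (T : Type) n (H : 'M[T]_n.+1) : 'M[T]_n := row' ord_max (col' ord_max H).

Lemma coreE (T : Type) n (H : 'M[T]_n.+1) i j :
  core H i j = H (lift ord_max i) (lift ord_max j).
Proof. by rewrite !mxE. Qed.

Lemma adj_max (R : comNzRingType) n (H : 'M[R]_n.+1) :
  \adj H ord_max ord_max = \det (core H).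
Proof. by rewrite mxE /cofactor addnn -signr_odd odd_double mul1r. Qed.

(** Multiplying the block of 2 x 2 minors of the adjugate by the core of H
    gives a scalar matrix, because H times its adjugate is det H. Comparing
    with the adjugate of the core requires to cancel the determinant of the
    core. *)
Lemma desnanot_jacobi_idom (R : idomainType) n (H : 'M[R]_n.+1) i j :
  \det (core H) != 0 ->
  \adj H ord_max ord_max * \adj H (lift ord_max i) (lift ord_max j)
  - \adj H (lift ord_max i) ord_max * \adj H ord_max (lift ord_max j)
  = \det H * \adj (core H) i j.
Proof.
move=> S0; set m := ord_max; set K := \adj H; set S := core H.
have HK a b : \sum_c H a c * K c b = (\det H) *+ (a == b).
  by have /matrixP/(_ a b) := mul_mx_adj H; rewrite !mxE.
pose T := \matrix_(i, j) (K m m * K (lift m i) (lift m j)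
  - K (lift m i) m * K m (lift m j)).
have ST : S *m T = (\det S * \det H)%:M.
  apply/matrixP => k l; rewrite !mxE.
  have E1 := HK (lift m k) (lift m l); have E2 := HK (lift m k) m.
  rewrite sum_lift_max (inj_eq lift_inj) in E1.
  rewrite sum_lift_max [_ == m]eq_sym (negPf (neq_lift _ _)) mulr0n in E2.
  transitivity (K m m * (\sum_j H (lift m k) (lift m j) * K (lift m j) (lift m l))
     - (\sum_j H (lift m k) (lift m j) * K (lift m j) m) * K m (lift m l)).
    rewrite mulr_sumr mulr_suml -sumrB; apply: eq_bigr => j' _.
    by rewrite !mxE; ring.
  rewrite -mulr_natr -adj_max -/m -/K mulrAC mulrC -mulrA [_ * \det H]mulrC mulr_natr -E1.
  move/eqP: E2; rewrite addr_eq0 => /eqP ->.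
  ring.
have := congr1 (mulmx (\adj S)) ST.
rewrite mulmxA mul_adj_mx mul_scalar_mx mul_mx_scalar => /matrixP/(_ i j).
by rewrite [LHS]mxE [RHS]mxE -mulrA => /(mulfI S0); rewrite mxE.
Qed.

(** A polynomial identity in the entries of H. It is applied to H + X over
    the polynomial ring, where the core has a monic, hence nonzero,
    determinant, and evaluated at X = 0. *)
Lemma desnanot_jacobi (R : fieldType) n (H : 'M[R]_n.+1) i j :
  \adj H ord_max ord_max * \adj H (lift ord_max i) (lift ord_max j)
  - \adj H (lift ord_max i) ord_max * \adj H ord_max (lift ord_max j)
  = \det H * \adj (core H) i j.
Proof.
pose HX : 'M[{poly R}]_n.+1 := 'X%:M + map_mx polyC H.
have coreX : core HX = char_poly_mx (- core H).
  apply/matrixP => a b; rewrite !mxE (inj_eq lift_inj).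
  by rewrite rmorphN opprK.
have S0 : \det (core HX) != 0.
  by rewrite coreX -/(char_poly _) monic_neq0 // char_poly_monic.
have ev0 : map_mx (horner_eval 0) HX = H.
  by apply/matrixP => a b; rewrite !mxE /horner_eval hornerD hornerMn hornerX hornerC mul0rn add0r.
have := congr1 (horner_eval 0) (desnanot_jacobi_idom i j S0).
have adjE p (A : 'M[{poly R}]_p) a b :
    horner_eval 0 (\adj A a b) = \adj (map_mx (horner_eval 0) A) a b.
  by rewrite -map_mx_adj [RHS]mxE.
rewrite rmorphB !rmorphM /= !adjE -det_map_mx ev0.
suff -> : map_mx (horner_eval 0) (core HX) = core H by [].
by rewrite -[in RHS]ev0; apply/matrixP => a b; rewrite !mxE.
Qed.

Lemma inv_sym_entry (R : fieldType) n (H : 'M[R]_n) a b :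
  H^T = H -> invmx H a b = invmx H b a.
Proof. by move=> Hsym; rewrite -[in LHS]Hsym -trmx_inv mxE. Qed.

Context {R : fieldType} {n : nat} (H : 'M[R]_n.+1).
Hypothesis Hsym : H^T = H.
Hypothesis Hunit : H \in unitmx.
Local Notation m := (@ord_max n).
Local Notation l := (lift (@ord_max n)).
Local Notation Q := (invmx H).

Lemma sym_entry a b : H a b = H b a.
Proof. by rewrite -[in LHS]Hsym mxE. Qed.

Lemma border_kernel i : \sum_j H (l i) (l j) * Q (l j) m + H (l i) m * Q m m = 0.
Proof.
have /matrixP/(_ (l i) m) := mulmxV Hunit.
by rewrite !mxE sum_lift_max eq_sym (negPf (neq_lift _ _)).
Qed.

Lemma border_norm : \sum_j H (l j) m * Q (l j) m + H m m * Q m m = 1.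
Proof.
have /matrixP/(_ m m) := mulmxV Hunit.
rewrite !mxE sum_lift_max eqxx mulr1n => <-; congr (_ + _).
by apply: eq_bigr => j _; rewrite sym_entry.
Qed.

Lemma det_core : \det (core H) = \det H * Q m m.
Proof.
rewrite /invmx Hunit mxE -adj_max mulrA mulfV ?mul1r //.
by rewrite -unitfE -unitmxE.
Qed.

(** Modulo the corner Q m m of the inverse, the cofactor matrix of the core
    has rank one: the first n entries of the last column of Q, times their
    transpose, times - det H. *)
Lemma cofactor_core i j : cofactor (core H) i j =
  \det H * (Q m m * Q (l i) (l j) - Q (l i) m * Q (l j) m).
Proof.
have dH : \det H != 0 by rewrite -unitfE -unitmxE.
apply: (mulfI dH).
have -> : cofactor (core H) i j = \adj (core H) j i by rewrite mxE.
rewrite -desnanot_jacobi [Q (l i) (l j)]inv_sym_entry //.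
rewrite [Q (l i) m]inv_sym_entry // /invmx Hunit !mxE; field.
exact: dH.
Qed.

End Border.

(** * Bilinear forms and the Koszul formula *)

(* Comparing two different derivatives up to conversion would unfold the limits
   that define them. *)
Local Opaque derive derivable.

Section Bilinear.
Context {R : realType} {m : nat}.
Implicit Types (A : 'M[R]_m) (u v w : 'rV[R]_m).

(** This is the scalar product of row vectors for the matrix A. It is made
    opaque once its algebra is known, because unifying two scalar products
    must not expand matrix products. *)
Definition bil A u v : R := (u *m A *m v^T) 0 0.

Lemma bilE A u v : bil A u v = \sum_a \sum_b u 0 a * A a b * v 0 b.
Proof.
rewrite /bil mxE exchange_big; apply: eq_bigr => b _.
by rewrite !mxE mulr_suml.
Qed.

Lemma bilDl A u v w : bil A (u + v) w = bil A u w + bil A v w.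
Proof. by rewrite /bil !mulmxDl mxE. Qed.

Lemma bilZl A k u w : bil A (k *: u) w = k * bil A u w.
Proof. by rewrite /bil -!scalemxAl mxE. Qed.

Lemma bilDr A u v w : bil A w (u + v) = bil A w u + bil A w v.
Proof. by rewrite /bil linearD mulmxDr mxE. Qed.

Lemma bilZr A k u w : bil A w (k *: u) = k * bil A w u.
Proof. by rewrite /bil linearZ -scalemxAr mxE. Qed.

Lemma bil0l A w : bil A 0 w = 0.
Proof. by rewrite /bil !mul0mx mxE. Qed.

Lemma bil0r A w : bil A w 0 = 0.
Proof. by rewrite /bil linear0 mulmx0 mxE. Qed.

Lemma bil_suml A (I : Type) (r : seq I) (F : I -> 'rV[R]_m) w :
  bil A (\sum_(i <- r) F i) w = \sum_(i <- r) bil A (F i) w.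
Proof.
elim: r => [|i r IH]; first by rewrite !big_nil bil0l.
by rewrite !big_cons bilDl IH.
Qed.

Lemma bil_sumr A (I : Type) (r : seq I) (F : I -> 'rV[R]_m) w :
  bil A w (\sum_(i <- r) F i) = \sum_(i <- r) bil A w (F i).
Proof.
elim: r => [|i r IH]; first by rewrite !big_nil bil0r.
by rewrite !big_cons bilDr IH.
Qed.

Lemma bilC A u v : A^T = A -> bil A u v = bil A v u.
Proof.
move=> sA; rewrite /bil -[in LHS](trmxK (u *m A *m v^T)) [LHS]mxE.
by rewrite !trmx_mul trmxK sA mulmxA.
Qed.

Lemma bil_mul p (J : 'M[R]_(p, m)) A (u v : 'rV[R]_p) :
  bil A (u *m J) (v *m J) = (u *m (J *m A *m J^T) *m v^T) 0 0.
Proof. by rewrite /bil trmx_mul !mulmxA. Qed.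

Lemma bil_nondegenerate A u : A \in unitmx -> (forall z, bil A u z = 0) -> u = 0.
Proof.
move=> uA H; have : u *m A = 0.
  apply/rowP => j; have := H (delta_mx 0 j); rewrite /bil !mxE.
  rewrite (bigD1 j) //= big1 => [|k kj]; last by rewrite !mxE (negPf kj) andbF mulr0.
  by rewrite !mxE !eqxx mulr1 addr0.
by move/(congr1 (mulmx^~ (invmx A))); rewrite mulmxK // mul0mx.
Qed.

Context {V : normedModType R}.

Lemma is_derive_sum_fun n (F : 'I_n -> V -> R) (dF : 'I_n -> R) x z :
  (forall i, is_derive x z (F i) (dF i)) ->
  is_derive x z (fun y => \sum_i F i y) (\sum_i dF i).
Proof.
move=> H; have := is_derive_sum H.
by rewrite (_ : \sum_i F i = (fun y => \sum_i F i y)) //; apply/funext => y; rewrite fct_sumE.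
Qed.

Lemma is_derive_mul (f g : V -> R) (df dg : R) x z :
  is_derive x z f df -> is_derive x z g dg ->
  is_derive x z (fun y => f y * g y) (df * g x + f x * dg).
Proof.
move=> Df Dg; have := is_deriveM Df Dg.
by rewrite addrC [g x *: _]mulrC.
Qed.

Lemma is_derive_bil (A : V -> 'M[R]_m) (u v : V -> 'rV[R]_m) dA du dv x z :
  is_derive x z A dA -> is_derive x z u du -> is_derive x z v dv ->
  is_derive x z (fun y => bil (A y) (u y) (v y))
    (bil dA (u x) (v x) + bil (A x) du (v x) + bil (A x) (u x) dv).
Proof.
move=> DA Du Dv.
rewrite (_ : (fun y => _) = (fun y => \sum_a \sum_b u y 0 a * A y a b * v y 0 b));
  last by apply/funext => y; rewrite bilE.
rewrite (_ : _ + _ + _ = \sum_a \sum_b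
    ((du 0 a * A x a b + u x 0 a * dA a b) * v x 0 b + u x 0 a * A x a b * dv 0 b)).
  apply: is_derive_sum_fun => a; apply: is_derive_sum_fun => b.
  apply: is_derive_mul; last exact: is_derive_entry.
  by apply: is_derive_mul; exact: is_derive_entry.
rewrite !bilE -!big_split; apply: eq_bigr => a _.
rewrite -!big_split; apply: eq_bigr => b _ /=; ring.
Qed.

End Bilinear.

Local Opaque bil.

Section Covariant.
Context {R : realType} {m : nat}.
Implicit Types (G : 'rV[R]_m -> 'M[R]_m) (Y : set 'rV[R]_m).

(** The Christoffel symbols, and below the covariant derivative, for a
    metric G given on an open set of coordinate space; they agree by
    definition with those of the manifold in each chart. *)
Definition christoffel_coef G (y : 'rV[R]_m) (k a b : 'I_m) : R :=
  2^-1 * \sum_l invmx (G y) k l *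
    ('D_(e_ a) (fun z => G z b l) y
     + 'D_(e_ b) (fun z => G z a l) y
     - 'D_(e_ l) (fun z => G z a b) y).

Definition cov_coord {V : normedModType R} G (f : V -> 'rV[R]_m) (p v w : V) :=
  'D_v ('D_w f) p +
  \row_k \sum_a \sum_b
    christoffel_coef G (f p) k a b * ('D_v f p) 0 a * ('D_w f p) 0 b.

(** Lowering the index cancels the inverse metric. *)
Lemma christoffel_coef_lower G y a b c : (G y)^T = G y -> G y \in unitmx ->
  \sum_k christoffel_coef G y k a b * G y k c =
  2^-1 * ('D_(e_ a) (fun z => G z b c) y + 'D_(e_ b) (fun z => G z a c) y
     - 'D_(e_ c) (fun z => G z a b) y).
Proof.
move=> sG uG; pose t l := 'D_(e_ a) (fun z => G z b l) y
  + 'D_(e_ b) (fun z => G z a l) y - 'D_(e_ l) (fun z => G z a b) y.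
transitivity (2^-1 * \sum_l (\sum_k invmx (G y) l k * G y k c) * t l).
  rewrite mulr_sumr.
  under eq_bigr => k _ do rewrite /christoffel_coef mulr_sumr mulr_suml.
  rewrite exchange_big; apply: eq_bigr => l _ /=.
  rewrite mulr_suml mulr_sumr; apply: eq_bigr => k _.
  rewrite inv_sym_entry // /t; ring.
have QG l : \sum_k invmx (G y) l k * G y k c = (l == c)%:R.
  by have /matrixP/(_ l c) := mulVmx uG; rewrite !mxE.
congr (_ * _); rewrite (bigD1 c) //= QG eqxx mul1r [X in _ + X]big1 ?addr0 // => l lc.
by rewrite QG (negPf lc) mul0r.
Qed.

Lemma derive_mx_coord G Y y u a b : open Y -> Ck 1 Y G -> Y y ->
  ('D_u G y) a b = \sum_c u 0 c * 'D_(e_ c) (fun z => G z a b) y.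
Proof.
move=> oY CG Yy; rewrite derive_mx ?mxE; last exact: (Ck_derivable CG Yy).
exact: derive_coord oY (Ck_entry a b oY CG) Yy.
Qed.

Lemma bil_christoffel G Y y (u v z : 'rV[R]_m) : open Y -> Ck 1 Y G -> Y y ->
  (G y)^T = G y -> G y \in unitmx ->
  bil (G y) (\row_k \sum_a \sum_b christoffel_coef G y k a b * u 0 a * v 0 b) z =
  2^-1 * (bil ('D_u G y) v z + bil ('D_v G y) u z - bil ('D_z G y) u v).
Proof.
move=> oY CG Yy sG uG; pose t a b c := 'D_(e_ a) (fun z => G z b c) y.
have dGE w p q : bil ('D_w G y) p q = \sum_a \sum_b \sum_c w 0 c * t c a b * p 0 a * q 0 b.
  rewrite bilE; apply: eq_bigr => a _; apply: eq_bigr => b _.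
  rewrite (derive_mx_coord _ _ _ oY CG Yy) mulr_sumr mulr_suml.
  by apply: eq_bigr => c _; rewrite /t; ring.
rewrite bilE.
transitivity (\sum_a \sum_b \sum_c u 0 a * v 0 b * z 0 c * (2^-1 *
   (t a b c + t b a c - t c a b))).
  transitivity (\sum_a \sum_b \sum_c u 0 a * v 0 b * z 0 c *
      \sum_k christoffel_coef G y k a b * G y k c).
    under [RHS]eq_bigr => a _ do under eq_bigr => b _ do
      under eq_bigr => c _ do rewrite mulr_sumr.
    under [LHS]eq_bigr => k _ do under eq_bigr => c _ do
      rewrite mxE !mulr_suml.
    under [LHS]eq_bigr => k _ do under eq_bigr => c _ do
      under eq_bigr => a _ do rewrite !mulr_suml.
    under [LHS]eq_bigr => k _ do rewrite exchange_big.
    rewrite exchange_big; apply: eq_bigr => a _ /=.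
    under [LHS]eq_bigr => k _ do rewrite exchange_big.
    rewrite exchange_big; apply: eq_bigr => b _ /=.
    rewrite exchange_big; apply: eq_bigr => c _ /=.
    by apply: eq_bigr => k _; ring.
  apply: eq_bigr => a _; apply: eq_bigr => b _; apply: eq_bigr => c _.
  by rewrite christoffel_coef_lower.
rewrite (dGE u v z) (dGE v u z) (dGE z u v).
have -> : \sum_a \sum_b \sum_c u 0 c * t c a b * v 0 a * z 0 b =
   \sum_a \sum_b \sum_c u 0 a * t a b c * v 0 b * z 0 c.
  under eq_bigr => a _ do rewrite exchange_big.
  by rewrite exchange_big.
have -> : \sum_a \sum_b \sum_c v 0 c * t c a b * u 0 a * z 0 b =
   \sum_a \sum_b \sum_c v 0 b * t b a c * u 0 a * z 0 c.
  by apply: eq_bigr => a _; rewrite exchange_big.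
rewrite -big_split -sumrB mulr_sumr; apply: eq_bigr => a _ /=.
rewrite -big_split -sumrB mulr_sumr; apply: eq_bigr => b _ /=.
rewrite -big_split -sumrB mulr_sumr; apply: eq_bigr => c _ /=.
move: (t a b c) (t b a c) (t c a b) => t1 t2 t3; ring.
Qed.

Context {V : normedModType R}.

Lemma bil_cov_coord G Y (f : V -> 'rV[R]_m) p v w z :
  open Y -> Ck 1 Y G -> Y (f p) -> (G (f p))^T = G (f p) -> G (f p) \in unitmx ->
  bil (G (f p)) (cov_coord G f p v w) z = bil (G (f p)) ('D_v ('D_w f) p) z +
  2^-1 * (bil ('D_('D_v f p) G (f p)) ('D_w f p) z
    + bil ('D_('D_w f p) G (f p)) ('D_v f p) z
    - bil ('D_z G (f p)) ('D_v f p) ('D_w f p)).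
Proof.
move=> oY CG Yfp sG uG.
by rewrite bilDl; congr (_ + _); exact: bil_christoffel oY CG Yfp sG uG.
Qed.

Lemma is_derive_mx_comp Y G (f : V -> 'rV[R]_m) x z :
  open Y -> Ck 1 Y G -> Y (f x) -> derivable f x z ->
  is_derive x z (fun y => G (f y)) ('D_('D_z f x) G (f x)).
Proof.
move=> oY CG Yfx df.
have dij i j : is_derive x z (fun y => G (f y) i j) (('D_('D_z f x) G (f x)) i j).
  rewrite derive_mx ?mxE; last exact: (Ck_derivable CG Yfx).
  apply: (is_derive_comp (h := fun y => G y i j)) => //.
  exact: (Ck1_differentiable oY (Ck_entry i j oY CG) Yfx).
have D : derivable (fun y => G (f y)) x z.
  by apply/derivable_mxP => i j; have [] := dij i j.
split; first exact: D.
rewrite (derive_mx D); apply/matrixP => i j; rewrite mxE.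
by have [] := dij i j.
Qed.

(** The function differentiated here is the coefficient (v, w) of the metric
    induced by f. *)
Lemma is_derive_pullback Y G (D : set V) (f : V -> 'rV[R]_m) x v w z :
  open Y -> Ck 1 Y G -> Ck 2 D f -> D x -> Y (f x) ->
  is_derive x z (fun y => bil (G (f y)) ('D_v f y) ('D_w f y))
   (bil ('D_('D_z f x) G (f x)) ('D_v f x) ('D_w f x)
    + bil (G (f x)) ('D_z ('D_v f) x) ('D_w f x)
    + bil (G (f x)) ('D_v f x) ('D_z ('D_w f) x)).
Proof.
move=> oY CG Cf Dx Yfx; apply: is_derive_bil.
- apply: is_derive_mx_comp oY CG Yfx _; exact: (Ck_derivable (Ck_pred Cf) Dx).
- by apply: derivableP; exact: (Ck_derivable (Ck_derive v Cf) Dx).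
- by apply: derivableP; exact: (Ck_derivable (Ck_derive w Cf) Dx).
Qed.

(** The tangential part of the covariant derivative is determined by the
    first derivatives of the induced metric. In the sum, the six terms with
    second derivatives of f reduce to one by symmetry. The lemma serves
    twice: for the hypersurface, and for changes of coordinates. *)
Lemma koszul Y G (D : set V) (f : V -> 'rV[R]_m) p v w z :
  open Y -> Ck 1 Y G -> open D -> Ck 2 D f -> D p -> Y (f p) ->
  (G (f p))^T = G (f p) -> G (f p) \in unitmx ->
  let s a b x := bil (G (f x)) ('D_a f x) ('D_b f x) in
  bil (G (f p)) (cov_coord G f p v w) ('D_z f p) =
  2^-1 * ('D_v (s w z) p + 'D_w (s v z) p - 'D_z (s v w) p).
Proof.
move=> oY CG oD Cf Dp Yfp sG uG s.
have dsE a b c : 'D_c (s a b) p =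
    bil ('D_('D_c f p) G (f p)) ('D_a f p) ('D_b f p)
    + bil (G (f p)) ('D_c ('D_a f) p) ('D_b f p)
    + bil (G (f p)) ('D_a f p) ('D_c ('D_b f) p).
  by have [_ ->] := is_derive_pullback a b c oY CG Cf Dp Yfp.
have e1 : bil (G (f p)) ('D_w ('D_v f) p) ('D_z f p)
        = bil (G (f p)) ('D_v ('D_w f) p) ('D_z f p).
  exact: (congr1 (fun q => bil (G (f p)) q ('D_z f p)) (derive2C_mx w v oD Cf Dp)).
have e2 a b : bil (G (f p)) ('D_a f p) ('D_z ('D_b f) p)
        = bil (G (f p)) ('D_a f p) ('D_b ('D_z f) p).
  exact: (congr1 (bil (G (f p)) ('D_a f p)) (derive2C_mx z b oD Cf Dp)).
have e3 : bil (G (f p)) ('D_z ('D_v f) p) ('D_w f p)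
        = bil (G (f p)) ('D_w f p) ('D_v ('D_z f) p).
  by apply: etrans (bilC _ _ sG) _; exact: e2.
apply: (etrans (bil_cov_coord v w ('D_z f p) oY CG Yfp sG uG)).
have arith (S1 S2 S3 a1 a2 a3 x1 x2 x3 x4 x5 x6 : R) :
    S1 = a1 + x6 + x2 -> S2 = a2 + x1 + x3 -> S3 = a3 + x4 + x5 ->
    x1 = x6 -> x4 = x2 -> x5 = x3 ->
    x6 + 2^-1 * (a1 + a2 - a3) = 2^-1 * (S1 + S2 - S3).
  by move=> -> -> -> -> -> ->; field.
exact: arith (dsE w z v) (dsE v z w) (dsE v w z) e1 e3 (e2 v w).
Qed.

End Covariant.

(** * The covariant derivative under a change of coordinates *)

Section SecondDerivative.
Context {R : realType} {V : normedModType R} {m : nat}.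

(** The second derivative of a composite, with the term that makes it differ
    from a tensor. *)
Lemma derive2_comp (D : set V) (O : set 'rV[R]_m) (h : 'rV[R]_m -> R)
    (f : V -> 'rV[R]_m) p v w :
  open D -> open O -> (forall x, D x -> O (f x)) -> Ck 2 D f -> Ck 2 O h -> D p ->
  'D_v ('D_w (h \o f)) p = 'D_('D_v ('D_w f) p) h (f p)
     + 'D_('D_v f p) ('D_('D_w f p) h) (f p).
Proof.
move=> oD oO DO Cf Ch Dp; set y := f p; have Oy : O y by exact: DO.
have Cf1 := Ck_pred Cf; have Ch1 := Ck_pred Ch.
have E1 x : D x ->
    'D_w (h \o f) x = \sum_a ('D_w f x) 0 a * 'D_(e_ a) h (f x).
  move=> Dx; have [_ ->] := is_derive_compC1 oO Ch1 (DO x Dx) (Ck_derivable (v := w) Cf1 Dx).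
  by [].
rewrite (derive_ext v oD Dp E1).
have dfw : is_derive p v ('D_w f) ('D_v ('D_w f) p).
  by apply: derivableP; exact: (Ck_derivable (Ck_derive w Cf) Dp).
have dfv : derivable f p v by exact: (Ck_derivable Cf1 Dp).
have dh a : is_derive p v (fun x => 'D_(e_ a) h (f x)) ('D_('D_v f p) ('D_(e_ a) h) y).
  apply: (is_derive_comp (h := 'D_(e_ a) h) dfv).
  exact: (Ck1_differentiable oO (Ck_derive (e_ a) Ch) Oy).
have [_ ->] := is_derive_sum_fun (fun a =>
   is_derive_mul (is_derive_entry 0 a dfw) (dh a)).
rewrite big_split /= -(derive_coord _ oO Ch1 Oy); congr (_ + _).
have E2 x : O x -> 'D_('D_w f p) h x = \sum_a ('D_w f p) 0 a * 'D_(e_ a) h x.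
  by move=> Ox; exact: derive_coord oO Ch1 Ox.
rewrite (derive_ext _ oO Oy E2).
have dc a : is_derive y ('D_v f p) (fun x => ('D_w f p) 0 a * 'D_(e_ a) h x)
    (0 * 'D_(e_ a) h y + ('D_w f p) 0 a * 'D_('D_v f p) ('D_(e_ a) h) y).
  apply: (is_derive_mul (f := cst (('D_w f p) 0 a))).
  apply: derivableP; exact: (Ck_derivable (Ck_derive (e_ a) Ch) Oy).
have [_ ->] := is_derive_sum_fun dc.
by apply: eq_bigr => a _; rewrite mul0r add0r.
Qed.

Lemma derive2_comp_mx (D : set V) (O : set 'rV[R]_m) q (h : 'rV[R]_m -> 'rV[R]_q)
    (f : V -> 'rV[R]_m) p v w :
  open D -> open O -> (forall x, D x -> O (f x)) -> Ck 2 D f -> Ck 2 O h -> D p ->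
  'D_v ('D_w (h \o f)) p = 'D_('D_v ('D_w f) p) h (f p)
     + 'D_('D_v f p) ('D_('D_w f p) h) (f p).
Proof.
move=> oD oO DO Cf Ch Dp; have Oy : O (f p) by exact: DO.
have Chf : Ck 2 D (h \o f) by exact: (Ck_comp_mx oD oO DO).
have E (W : normedModType R) (S : set W) (F : W -> 'rV[R]_q) x a b i :
    open S -> S x -> Ck 2 S F ->
    ('D_a ('D_b F) x) 0 i = 'D_a ('D_b (fun z => F z 0 i)) x.
  move=> oS Sx CF; rewrite derive_mx ?mxE; last exact: (Ck_derivable (Ck_derive b CF) Sx).
  apply: derive_ext oS Sx _ => z Sz.
  by rewrite derive_mx ?mxE //; exact: (Ck_derivable (Ck_pred CF) Sz).
apply/rowP => i; rewrite [RHS]mxE.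
apply: (etrans (E _ _ _ _ v w i oD Dp Chf)).
apply: (etrans (derive2_comp v w oD oO DO Cf (Ck_entry 0 i oO Ch) Dp)).
congr (_ + _); last exact: (esym (E _ _ _ _ _ _ i oO Oy Ch)).
have dh : derivable h (f p) ('D_v ('D_w f) p) by exact: (Ck_derivable (Ck_pred Ch) Oy).
by have [_ ->] := is_derive_entry 0 i (derivableP dh).
Qed.

End SecondDerivative.

Section Transformation.
Context {R : realType} {V : normedModType R} {m : nat}.
Variables (Gc Gd : 'rV[R]_m -> 'M[R]_m) (Yc Yd O : set 'rV[R]_m).
Variable (theta : 'rV[R]_m -> 'rV[R]_m).
Hypotheses (oYc : open Yc) (oYd : open Yd) (oO : open O).
Hypotheses (CGc : Ck 1 Yc Gc) (CGd : Ck 1 Yd Gd) (Ctheta : Ck 2 O theta).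
Hypotheses (OYc : forall y, O y -> Yc y) (OYd : forall y, O y -> Yd (theta y)).
Hypothesis symGc : forall y, Yc y -> (Gc y)^T = Gc y.
Hypothesis symGd : forall y, Yd y -> (Gd y)^T = Gd y.
Hypothesis unitGc : forall y, Yc y -> Gc y \in unitmx.
Hypothesis unitGd : forall y, Yd y -> Gd y \in unitmx.
Hypothesis isometry : forall y u v, O y ->
  bil (Gc y) u v = bil (Gd (theta y)) ('D_u theta y) ('D_v theta y).
Hypothesis theta_onto : forall y u, O y -> exists v, 'D_v theta y = u.

(** The Koszul formula for the change of coordinates itself, whose induced
    metric is Gc: the right side is the Christoffel part of the covariant
    derivative for Gc. *)
Lemma cov_coord_change_of_variables y a b z : O y ->
  bil (Gd (theta y)) (cov_coord Gd theta y a b) ('D_z theta y) =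
  2^-1 * (bil ('D_a Gc y) b z + bil ('D_b Gc y) a z - bil ('D_z Gc y) a b).
Proof.
move=> Oy; have Yy := OYc Oy.
apply: (etrans (koszul a b z oYd CGd oO Ctheta Oy (OYd Oy) (symGd (OYd Oy)) (unitGd (OYd Oy)))).
have E u v w : 'D_w (fun x => bil (Gd (theta x)) ('D_u theta x) ('D_v theta x)) y
    = bil ('D_w Gc y) u v.
  have E1 x : O x -> bil (Gd (theta x)) ('D_u theta x) ('D_v theta x) = bil (Gc x) u v.
    by move=> Ox; rewrite isometry.
  rewrite (derive_ext w oO Oy E1).
  have dG : is_derive y w Gc ('D_w Gc y) by apply: derivableP; exact: (Ck_derivable CGc Yy).
  have [_ ->] := is_derive_bil dG (is_derive_cst u y w) (is_derive_cst v y w).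
  by rewrite bil0l bil0r !addr0.
congr (2^-1 * _); congr (_ + _ - _); exact: E.
Qed.

(** The vectors agree because they have the same scalar product with every
    derivative of theta: the second derivatives of theta produced by the
    chain rule are exactly what the Koszul formula for theta absorbs. *)
Lemma cov_coord_transform (D : set V) (f : V -> 'rV[R]_m) p v w :
  open D -> Ck 2 D f -> (forall x, D x -> O (f x)) -> D p ->
  cov_coord Gd (theta \o f) p v w = 'D_(cov_coord Gc f p v w) theta (f p).
Proof.
move=> oD Cf DO Dp; set y := f p; have Oy : O y by exact: DO.
have Yy := OYc Oy; have Ydy := OYd Oy.
have dth : differentiable theta y by exact: Ck1_differentiable_rV oO (Ck_pred Ctheta) Oy.
have thD a b : 'D_(a + b) theta y = 'D_a theta y + 'D_b theta y.
  by rewrite !deriveE // linearD.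
have thZ k a : 'D_(k *: a) theta y = k *: 'D_a theta y.
  by rewrite !deriveE // linearZ.
have dtf u : 'D_u (theta \o f) p = 'D_('D_u f p) theta y.
  by have [_ ->] := is_derive_comp (Ck_derivable (v := u) (Ck_pred Cf) Dp) dth.
have E2 : cov_coord Gd (theta \o f) p v w = 'D_('D_v ('D_w f) p) theta y
   + cov_coord Gd theta y ('D_v f p) ('D_w f p).
  rewrite /cov_coord (derive2_comp_mx v w oD oO DO Cf Ctheta Dp) !dtf.
  by rewrite -addrA.
apply/eqP; rewrite -subr_eq0; apply/eqP.
apply: (bil_nondegenerate (unitGd Ydy)) => u.
have [z <-] := theta_onto u Oy.
rewrite -[X in bil _ (_ + X) _]scaleN1r bilDl bilZl E2 bilDl cov_coord_change_of_variables //.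
rewrite -!isometry // (bil_cov_coord _ _ _ oYc CGc Yy (symGc Yy) (unitGc Yy)).
by rewrite mulN1r subrr.
Qed.

End Transformation.

(** * Frames with one transverse vector *)

Section Frames.
Context {R : realType} {n : nat}.
Local Notation m := (@ord_max n).
Local Notation l := (lift (@ord_max n)).
Implicit Types (F : 'I_n -> 'rV[R]_n.+1) (w Z : 'rV[R]_n.+1).

Definition frame_mx F w : 'M[R]_n.+1 :=
  \matrix_(i < n.+1) (if unlift ord_max i is Some j then F j else w).

Lemma row_frame_mx F w j : row (l j) (frame_mx F w) = F j.
Proof. by rewrite rowK liftK. Qed.

Lemma row_frame_mx_max F w : row m (frame_mx F w) = w.
Proof. by rewrite rowK unlift_none. Qed.

Lemma mul_frame_mx F w (v : 'rV[R]_n.+1) :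
  v *m frame_mx F w = \sum_i v 0 (l i) *: F i + v 0 m *: w.
Proof.
rewrite mulmx_sum_row sum_lift_max row_frame_mx_max; congr (_ + _).
by apply: eq_bigr => i _; rewrite row_frame_mx.
Qed.

Lemma frame_mx_mul F w (J : 'M[R]_n.+1) :
  frame_mx F w *m J = frame_mx (fun i => F i *m J) (w *m J).
Proof.
apply/row_matrixP => i; rewrite row_mul.
case: (unliftP m i) => [j|] ->; first by rewrite !row_frame_mx.
by rewrite !row_frame_mx_max.
Qed.

Lemma det_frame_mx_delta w : \det (frame_mx (fun i => delta_mx 0 (l i)) w) = w 0 m.
Proof.
rewrite det_trig.
  rewrite (bigD1 m) //= [X in _ * X]big1 ?mulr1.
    by move: (row_frame_mx_max (fun i => delta_mx 0 (l i)) w) => /rowP/(_ m); rewrite mxE.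
  move=> i; case: (unliftP m i) => [j|] -> => [_|]; last by rewrite eqxx.
  by have := row_frame_mx (fun i => delta_mx 0 (l i)) w j => /rowP/(_ (l j));
    rewrite mxE => ->; rewrite mxE !eqxx.
apply/is_trig_mxP => i j; case: (unliftP m i) => [k|] -> ij.
  have := row_frame_mx (fun i => delta_mx 0 (l i)) w k => /rowP/(_ j).
  rewrite mxE => ->; rewrite mxE eqxx /=.
  by case: eqP => // E; rewrite E ltnn in ij.
by have := ltn_ord j; rewrite ltnS leqNgt ij.
Qed.

(** In the old frame, the new one is the identity matrix with its last row
    replaced. *)
Lemma det_frame_mx F Z w : frame_mx F Z \in unitmx ->
  \det (frame_mx F w) = (w *m invmx (frame_mx F Z)) 0 m * \det (frame_mx F Z).
Proof.
move=> uE; set E := frame_mx F Z.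
rewrite -det_frame_mx_delta -det_mulmx frame_mx_mul mulmxKV //.
congr (\det (frame_mx _ w)); apply/funext => i.
by rewrite -rowE row_frame_mx.
Qed.

(** If no vector completed the F i to a basis, every vector of the canonical
    basis would be a combination of the F i, and the identity matrix would
    have rank at most n. *)
Lemma exists_transverse F :
  (forall c : 'I_n -> R, \sum_i c i *: F i = 0 -> forall i, c i = 0) ->
  exists Z, \det (frame_mx F Z) != 0.
Proof.
move=> free; apply: contrapT => /forallNP noZ.
have dep k : exists u : 'rV[R]_n, delta_mx 0 k = u *m (\matrix_(i < n) F i).
  have /eqP/det0P[v v0 vE] : \det (frame_mx F (delta_mx 0 k)) = 0.
    by apply/eqP/negP => /negP H; exact: (noZ (delta_mx 0 k)).
  rewrite mul_frame_mx in vE.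
  have vm : v 0 m != 0.
    apply: contra v0 => /eqP vm; rewrite vm scale0r addr0 in vE.
    apply/eqP/rowP => i; rewrite mxE.
    by case: (unliftP m i) => [j|] ->; [exact: free vE j|].
  exists (\row_i (- (v 0 m)^-1 * v 0 (l i))).
  rewrite mulmx_sum_row.
  move/(congr1 (fun q => (v 0 m)^-1 *: q)): vE.
  rewrite scaler0 scalerDr scalerA mulVf // scale1r => /eqP.
  rewrite addrC addr_eq0 => /eqP ->.
  rewrite scaler_sumr -sumrN; apply: eq_bigr => i _.
  by rewrite rowK mxE scalerA mulNr scaleNr.
have [U UE] := choice dep.
have E1 : 1%:M = (\matrix_(k < n.+1) U k) *m (\matrix_(i < n) F i) :> 'M[R]_n.+1.
  apply/row_matrixP => k; rewrite row_mul rowK -UE row1.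
  by [].
have := mxrankM_maxr (\matrix_(k < n.+1) U k) (\matrix_(i < n) F i).
rewrite -E1 mxrank1 => H.
by have := leq_trans H (rank_leq_row _); rewrite ltnn.
Qed.

End Frames.

Section MoreDerivatives.
Context {R : realType}.

(** At a zero of h the product rule needs no derivative of the other factor.
    This is why the coefficient of the transport equation for beta has to be
    continuous only. *)
Lemma is_derive_mul_vanish {V : normedModType R} (f h : V -> R) x v :
  {for x, continuous f} -> derivable h x v -> h x = 0 ->
  is_derive x v (fun y => f y * h y) (f x * 'D_v h x).
Proof.
move=> cf dh h0.
suff L : (fun k : R => k^-1 *: (((fun y => f y * h y) \o shift x) (k *: v) - f x * h x))
    @ 0^' --> f x * 'D_v h x.
  by split; [apply/cvg_ex; exists (f x * 'D_v h x)|exact: cvg_lim].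
have -> : (fun k : R => k^-1 *: (((fun y => f y * h y) \o shift x) (k *: v) - f x * h x))
   = (fun k : R => f (k *: v + x) * (k^-1 *: ((h \o shift x) (k *: v) - h x))).
  by apply/funext => k /=; rewrite h0 mulr0 !subr0 mulrCA.
apply: cvgM; last exact: dh.
suff : {for 0, continuous (fun k : R => f (k *: v + x))}.
  by move=> /continuous_withinNx; rewrite scale0r add0r.
apply: continuous_comp; last by rewrite scale0r add0r.
by apply: cvgD; [exact: scalel_continuous|exact: cvg_cst].
Qed.

Lemma derive_coord_rV n q (D : set 'rV[R]_n) (f : 'rV[R]_n -> 'rV[R]_q) x v :
  open D -> Ck 1 D f -> D x -> 'D_v f x = \sum_i v 0 i *: 'D_(e_ i) f x.
Proof.
move=> oD Cf Dx; apply/rowP => j; rewrite summxE.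
have dE u : ('D_u f x) 0 j = 'D_u (fun y => f y 0 j) x.
  have du : derivable f x u by exact: (Ck_derivable Cf Dx).
  by have [_ ->] := is_derive_entry 0 j (derivableP du).
rewrite dE (derive_coord _ oD (Ck_entry 0 j oD Cf) Dx).
by apply: eq_bigr => i _; rewrite mxE dE.
Qed.

Lemma derive2_coord_rV n q (D : set 'rV[R]_n) (f : 'rV[R]_n -> 'rV[R]_q) x u v :
  open D -> Ck 2 D f -> D x ->
  'D_u ('D_v f) x = \sum_i \sum_j (u 0 i * v 0 j) *: 'D_(e_ i) ('D_(e_ j) f) x.
Proof.
move=> oD Cf Dx; have Cf1 := Ck_pred Cf.
apply: etrans (derive_coord_rV u oD (Ck_derive v Cf) Dx) _.
apply: eq_bigr => i _.
have E y : D y -> 'D_v f y = \sum_j v 0 j *: 'D_(e_ j) f y.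
  by move=> Dy; exact: derive_coord_rV oD Cf1 Dy.
rewrite (derive_ext _ oD Dx E).
have dj j : derivable (v 0 j \*: 'D_(e_ j) f) x (e_ i).
  by apply: derivableZ; exact: (Ck_derivable (Ck_derive (e_ j) Cf) Dx).
have -> : (fun y => \sum_j v 0 j *: 'D_(e_ j) f y) = \sum_j (v 0 j \*: 'D_(e_ j) f).
  by apply/funext => y; rewrite fct_sumE.
rewrite derive_sum // scaler_sumr; apply: eq_bigr => j _.
rewrite deriveZ ?scalerA //; exact: (Ck_derivable (Ck_derive (e_ j) Cf) Dx).
Qed.

Lemma trilinear_coord n q (C : 'I_q -> 'I_q -> 'I_q -> R) (F : 'I_n -> 'rV[R]_q)
    (u v : 'I_n -> R) :
  \row_k \sum_a \sum_b C k a b * (\sum_i u i *: F i) 0 a * (\sum_j v j *: F j) 0 b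
  = \sum_i \sum_j (u i * v j) *: \row_k \sum_a \sum_b C k a b * F i 0 a * F j 0 b.
Proof.
apply/rowP => k; rewrite mxE summxE.
under [RHS]eq_bigr => i _ do rewrite summxE.
under [RHS]eq_bigr => i _ do under eq_bigr => j _ do rewrite !mxE mulr_sumr.
transitivity (\sum_a \sum_b \sum_i \sum_j C k a b *
   (u i * F i 0 a) * (v j * F j 0 b)).
  apply: eq_bigr => a _; apply: eq_bigr => b _.
  rewrite !summxE [X in X * _]mulr_sumr mulr_suml; apply: eq_bigr => i _.
  by rewrite mulr_sumr; apply: eq_bigr => j _; rewrite !mxE.
under [LHS]eq_bigr => a _ do rewrite exchange_big.
rewrite exchange_big; apply: eq_bigr => i _ /=.
under [LHS]eq_bigr => a _ do rewrite exchange_big.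
rewrite exchange_big; apply: eq_bigr => j _ /=.
by apply: eq_bigr => a _; rewrite mulr_sumr; apply: eq_bigr => b _; ring.
Qed.

(** Reduces the covariant derivative along a curve to those along coordinate
    fields. *)
Lemma cov_coord_bilinear n q G (D : set 'rV[R]_n) (f : 'rV[R]_n -> 'rV[R]_q) x u v :
  open D -> Ck 2 D f -> D x ->
  cov_coord G f x u v = \sum_i \sum_j (u 0 i * v 0 j) *: cov_coord G f x (e_ i) (e_ j).
Proof.
move=> oD Cf Dx; have Cf1 := Ck_pred Cf.
under [RHS]eq_bigr => i _ do under eq_bigr => j _ do rewrite scalerDr.
under [RHS]eq_bigr => i _ do rewrite big_split /=.
rewrite big_split /= -(derive2_coord_rV u v oD Cf Dx) /cov_coord; congr (_ + _).
rewrite (derive_coord_rV u oD Cf1 Dx) (derive_coord_rV v oD Cf1 Dx).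
exact: trilinear_coord.
Qed.

End MoreDerivatives.

(** * The flow along the kernel of the first fundamental form *)

Section NullFlow.
Context {R : realType} {n : nat}.
Local Notation m := (@ord_max n).
Local Notation l := (lift (@ord_max n)).
Variables (W : set 'rV[R]_n) (xi : 'rV[R]_n -> 'rV[R]_n) (beta chi kappa : 'rV[R]_n -> R).
Hypotheses (oW : open W) (Cxi : Ck 1 W xi) (Cbeta : Ck 2 W beta) (Ckappa : Ck 1 W kappa).
Hypothesis cchi : forall p, W p -> {for p, continuous chi}.
Hypothesis xibeta : forall p, W p -> 'D_(xi p) beta p = chi p * beta p.

(** The flow lives in dimension n + 1: a point of U in the first n
    coordinates, and the factor tau in the last one. *)
Definition base_of (w : 'rV[R]_n.+1) : 'rV[R]_n := \row_i w 0 (l i).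

Lemma Ck_base_of k D : open D -> Ck k D base_of.
Proof.
move=> oD; apply/Ck_mxP => // i j.
by apply: Ck_ext oD _ (Ck_coord k D (l j)) => w _; rewrite mxE.
Qed.

(** The equations y' = tau xi(y) and tau' = - tau^2 kappa(y). The second one
    is the equation that makes the parameter affine when kappa measures the
    failure of the integral curves of xi to be geodesics. *)
Definition flow_field (w : 'rV[R]_n.+1) : 'rV[R]_n.+1 :=
  \row_a (if unlift m a is Some i then w 0 m * xi (base_of w) 0 i
          else - (w 0 m * w 0 m * kappa (base_of w))).

Lemma open_base_of : open [set w | W (base_of w)].
Proof.
apply: open_comp oW => w _.
exact: (Ck_cont (Ck_base_of 0 openT) I).
Qed.

Lemma Ck_flow_field : Ck 1 [set w | W (base_of w)] flow_field.
Proof.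
have oD := open_base_of; apply/Ck_mxP => // i0 a; rewrite (ord1 i0).
have Cb := Ck_base_of 1 oD.
have Cm : Ck 1 [set w | W (base_of w)] (fun w : 'rV[R]_n.+1 => w 0 m) by exact: Ck_coord.
case: (unliftP m a) => [i|] ->.
  have Ci : Ck 1 [set w | W (base_of w)] ((fun p => xi p 0 i) \o base_of).
    exact: (Ck_comp oD oW (fun w Dw => Dw) Cb (Ck_entry 0 i oW Cxi)).
  by apply: Ck_ext oD _ (Ck_mul oD Cm Ci) => w _; rewrite mxE liftK.
have Ci : Ck 1 [set w | W (base_of w)] (kappa \o base_of).
  exact: (Ck_comp oD oW (fun w Dw => Dw) Cb Ckappa).
by apply: Ck_ext oD _ (Ck_opp oD (Ck_mul oD (Ck_mul oD Cm Cm) Ci)) => w _; rewrite mxE unlift_none.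
Qed.

Lemma flow_curve o : W o -> exists a (y : R -> 'rV[R]_n) (tau : R -> R),
  [/\ 0 < a, y 0 = o, tau 0 = 1, Ck 2 [set t : R | `|t| < a] y &
   forall t : R, `|t| < a -> [/\ W (y t), is_derive t 1 y (tau t *: xi (y t)) &
     is_derive t 1 tau (- (tau t * tau t * kappa (y t)))]].
Proof.
move=> Wo; pose w0 : 'rV[R]_n.+1 := \row_a (if unlift m a is Some i then o 0 i else 1).
have b0 : base_of w0 = o by apply/rowP => i; rewrite !mxE liftK.
have Dw0 : W (base_of w0) by rewrite b0.
have [a [w [a0 ww0 dw Cw]]] := ode_local open_base_of Ck_flow_field Dw0.
have oI := @open_ball0 R a.
exists a, (base_of \o w), (fun t => w t 0 m); split.
- exact: a0.
- by rewrite /= ww0.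
- by rewrite ww0 mxE unlift_none.
- exact: (Ck_comp_mx oI openT (fun t _ => I) Cw (Ck_base_of 2 openT)).
move=> t ta; have [Wt dwt] := dw t ta; split; first exact: Wt.
- apply: is_derive_rV => i.
  have := is_derive_entry 0 (l i) dwt; rewrite [X in is_derive _ _ _ X -> _]mxE liftK.
  rewrite (_ : (fun s => (base_of \o w) s 0 i) = (fun s => w s 0 (l i))).
    by rewrite [X in _ -> is_derive _ _ _ X]mxE.
  by apply/funext => s /=; rewrite mxE.
- by have := is_derive_entry 0 m dwt; rewrite [X in is_derive _ _ _ X -> _]mxE unlift_none.
Qed.

(** Differentiate d beta (xi) = chi beta at a zero of beta, and exchange the
    derivatives of beta. *)
Lemma flow_second_order p i : W p -> beta p = 0 ->
  \sum_k xi p 0 k * 'D_(e_ k) ('D_(e_ i) beta) p =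
  chi p * 'D_(e_ i) beta p - \sum_k 'D_(e_ i) (fun q => xi q 0 k) p * 'D_(e_ k) beta p.
Proof.
move=> Wp bp; have Cb1 := Ck_pred Cbeta.
have E q : W q -> \sum_k xi q 0 k * 'D_(e_ k) beta q = chi q * beta q.
  by move=> Wq; rewrite -(xibeta Wq) (derive_coord _ oW Cb1 Wq).
have dchi : is_derive p (e_ i) (fun q => chi q * beta q) (chi p * 'D_(e_ i) beta p).
  by apply: is_derive_mul_vanish (cchi Wp) _ bp; exact: (Ck_derivable Cb1 Wp).
have dk k : is_derive p (e_ i) (fun q => xi q 0 k * 'D_(e_ k) beta q)
   ('D_(e_ i) (fun q => xi q 0 k) p * 'D_(e_ k) beta p
    + xi p 0 k * 'D_(e_ i) ('D_(e_ k) beta) p).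
  apply: is_derive_mul; apply: derivableP.
    exact: (Ck_derivable (Ck_entry 0 k oW Cxi) Wp).
  exact: (Ck_derivable (Ck_derive (e_ k) Cbeta) Wp).
have [_ E1] := is_derive_sum_fun dk.
have [_ E2] := dchi.
have E3 := derive_ext (e_ i) oW Wp E.
rewrite big_split /= in E1.
have E4 := etrans (esym E1) (etrans E3 E2).
rewrite -E4 addrAC subrr add0r; apply: eq_bigr => k _.
exact: (congr1 (fun q => xi p 0 k * q) (derive2C (e_ k) (e_ i) oW Cbeta Wp)).
Qed.

Lemma bounded_near0 (f : R -> R) : {for 0, continuous f} ->
  exists a K : R, 0 < a /\ forall t, `|t| < a -> `|f t| <= K.
Proof.
move=> cf; have [d d0 dP] := continuous_at_eps cf ltr01.
exists d, (`|f 0| + 1); split=> // t td; have := dP t td; rewrite addr0.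
have := ler_normD (f t - f 0) (f 0); rewrite subrK; lra.
Qed.

(** Along the curve, beta solves a scalar linear equation, hence vanishes;
    then, by flow_second_order, the partial derivatives of beta solve a
    linear system, hence vanish too. *)
Theorem null_flow o : W o -> beta o = 0 -> (forall v, 'D_v beta o = 0) ->
  exists a (y : R -> 'rV[R]_n) (tau : R -> R),
  [/\ 0 < a, y 0 = o, Ck 2 [set t : R | `|t| < a] y &
   forall t : R, `|t| < a -> [/\ W (y t), tau t != 0 /\ beta (y t) = 0,
     forall v, 'D_v beta (y t) = 0,
     is_derive t 1 y (tau t *: xi (y t)) &
     is_derive t 1 tau (- (tau t * tau t * kappa (y t)))]].
Proof.
move=> Wo bo dbo.
have [a [y [tau [a0 y0 tau0 Cy dy]]]] := flow_curve Wo.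
have Cb1 := Ck_pred Cbeta.
have zero_in : `|0 : R| < a by rewrite normr0.
have cy : {for 0, continuous y} by exact: (Ck_cont Cy zero_in).
have ctau : {for 0, continuous tau}.
  have [_ _ [D _]] := dy 0 zero_in; exact/differentiable_continuous/derivable1_diffP.
have cyf (f : 'rV[R]_n -> R) : {for o, continuous f} -> {for 0, continuous (f \o y)}.
  by move=> cf; apply: continuous_comp => //; rewrite y0.
have along (f : 'rV[R]_n -> R) (t : R) : Ck 1 W f -> `|t| < a ->
    is_derive t 1 (f \o y) (\sum_k (tau t * xi (y t) 0 k) * 'D_(e_ k) f (y t)).
  move=> Cf ta; have [Wt [D1 D2] _] := dy t ta.
  have := is_derive_compC1 oW Cf Wt D1; rewrite D2.
  rewrite (_ : \sum_a _ = \sum_k (tau t * xi (y t) 0 k) * 'D_(e_ k) f (y t)) //.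
  by apply: eq_bigr => k _; rewrite mxE.
have c1 : {for 0, continuous (fun t => tau t * chi (y t))}.
  by apply: cvgM; [exact: ctau|exact: cyf (cchi Wo)].
(* beta o y solves the linear equation z' = (tau chi) z with z(0) = 0 *)
have [b1 [b10 b1a by0]] : exists b, [/\ 0 < b, b <= a &
    forall t : R, `|t| < b -> beta (y t) = 0].
  have [a1 [K [a10 K1]]] := bounded_near0 c1.
  pose a' := Num.min a a1.
  have a'0 : 0 < a' by rewrite lt_min a0.
  have [|i t ta|i t ta|b /andP[b0 ba] bP] := @linear_ode_zero R 1
     (fun _ => beta \o y) (fun _ t => tau t * chi (y t) * beta (y t)) a' K a'0.
  - by move=> _ /=; rewrite y0.
  - have ta' : `|t| < a by apply: lt_le_trans ta _; rewrite ge_min lexx.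
    have [Wt _ _] := dy t ta'.
    have := along beta t Cb1 ta'.
    rewrite (_ : \sum_k _ = tau t * chi (y t) * beta (y t)) //.
    rewrite -mulrA -(xibeta Wt) (derive_coord _ oW Cb1 Wt) mulr_sumr.
    by apply: eq_bigr => k _; rewrite mulrA.
  - rewrite big_ord1 normrM ler_wpM2r //; apply: K1.
    by apply: lt_le_trans ta _; rewrite ge_min lexx orbT.
  - exists b; split=> //; first by apply: le_trans ba _; rewrite ge_min lexx.
    by move=> t tb; exact: bP 0 t tb.
(* rho bounds the coefficients of the linear system solved by the functions
   d_i beta o y *)
pose rho t := `|tau t| * (`|chi (y t)|
   + \sum_i \sum_k `|'D_(e_ i) (fun q => xi q 0 k) (y t)|).
have crho : {for 0, continuous rho}.
  apply: cvgM; first exact: cvg_norm ctau.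
  apply: cvgD; first exact: cvg_norm (cyf _ (cchi Wo)).
  have CF : Ck 0 W (fun q => \sum_i \sum_k `|'D_(e_ i) (fun q => xi q 0 k) q|).
    apply: (Ck_sum (W := R)) => // i _; apply: (Ck_sum (W := R)) => // k _.
    split=> [p Wp|]; last exact: I.
    have C := Ck_cont (Ck_derive (e_ i) (Ck_entry 0 k oW Cxi)) Wp.
    exact: cvg_norm C.
  exact: cyf (Ck_cont CF Wo).
have [a2 [K [a20 K2]]] := bounded_near0 crho.
pose a' := Num.min b1 a2.
have a'0 : 0 < a' by rewrite lt_min b10.
pose dz (i : 'I_n) (t : R) := \sum_k (tau t * xi (y t) 0 k) * 'D_(e_ k) ('D_(e_ i) beta) (y t).
have [i|i t ta|i t ta|b /andP[b0 ba] bP] := @linear_ode_zero R n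
     (fun i => 'D_(e_ i) beta \o y) dz a' K a'0.
- by rewrite /= y0.
- have ta' : `|t| < a.
    by apply: lt_le_trans ta _; rewrite ge_min b1a.
  exact: along _ _ (Ck_derive (e_ i) Cbeta) ta'.
- have tb : `|t| < b1 by apply: lt_le_trans ta _; rewrite ge_min lexx.
  have ta2 : `|t| < a2 by apply: lt_le_trans ta _; rewrite ge_min lexx orbT.
  have [Wt _ _] := dy t (lt_le_trans tb b1a).
  have -> : dz i t = tau t * (chi (y t) * 'D_(e_ i) beta (y t)
     - \sum_k 'D_(e_ i) (fun q => xi q 0 k) (y t) * 'D_(e_ k) beta (y t)).
    rewrite -(flow_second_order i Wt (by0 t tb)) mulr_sumr.
    by apply: eq_bigr => k _; rewrite mulrA.
  apply: (@le_trans _ _ (rho t * \sum_j `|'D_(e_ j) beta (y t)|)); last first.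
    by rewrite ler_wpM2r ?sumr_ge0 //; exact: le_trans (ler_norm _) (K2 t ta2).
  have S j : `|'D_(e_ j) beta (y t)| <= \sum_j `|'D_(e_ j) beta (y t)|.
    by rewrite (bigD1 j) //= lerDl sumr_ge0.
  rewrite normrM /rho -mulrA ler_wpM2l // mulrDl.
  rewrite (le_trans (ler_normB _ _)) // lerD //.
    by rewrite normrM ler_wpM2l // S.
  rewrite (le_trans (ler_norm_sum _ _ _)) //.
  apply: (@le_trans _ _ (\sum_k `|'D_(e_ i) (fun q => xi q 0 k) (y t)|
      * \sum_j `|'D_(e_ j) beta (y t)|)).
    by apply: ler_sum => k _; rewrite normrM ler_wpM2l // S.
  rewrite -mulr_suml ler_wpM2r ?sumr_ge0 //.
  by rewrite [leRHS](bigD1 i) //= lerDl sumr_ge0 // => j _; rewrite sumr_ge0.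
(* tau may vanish away from 0: the interval shrinks once more *)
have tau_near : \forall t \near (0 : R), tau t != 0.
  have /cvgrPdist_lt/(_ _ ltr01) := ctau; rewrite tau0.
  by apply: filterS => t; apply: contraTneq => ->; rewrite subr0 normr1 ltxx.
have /nbhs_ballP[a3 /= a30 a3P] := tau_near.
pose c := Num.min b a3.
have cP (t : R) : `|t| < c -> [/\ `|t| < b, `|t| < b1, `|t| < a & `|t| < a3].
  rewrite lt_min => /andP[tb t3].
  have tb1 : `|t| < b1.
    by apply: lt_le_trans tb (le_trans ba _); rewrite ge_min lexx.
  by split=> //; exact: lt_le_trans tb1 b1a.
exists c, y, tau; split.
- by rewrite lt_min b0.
- exact: y0.
- by apply: Ck_sub Cy => t /= /cP[].
move=> t /cP[tb tb1 ta t3]; have [Wt dyt dtau] := dy t ta.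
split.
- exact: Wt.
- split; last exact: by0.
  by apply: a3P; rewrite -ball_normE /= sub0r normrN.
- move=> v; rewrite (derive_coord v oW Cb1 Wt) big1 // => k _.
  by have /= -> := bP k t tb; rewrite mulr0.
- exact: dyt.
- exact: dtau.
Qed.

End NullFlow.

(** * Identities between the jets of the Gram matrix at a point *)

Section ArrayIdentities.
Context {R : realType} {n : nat}.
(* S, b, d are the blocks of a Gram matrix and P, xi, beta those of its inverse;
   dS k, dxi k, db k, dbeta k are the derivatives of S, xi, b, beta in the k-th
   coordinate; h is the second fundamental form and z its transverse part. *)
Variables (S P h z : 'I_n -> 'I_n -> R) (xi b : 'I_n -> R) (d beta : R).
Variables (dS : 'I_n -> 'I_n -> 'I_n -> R) (dxi db : 'I_n -> 'I_n -> R) (dbeta : 'I_n -> R).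
Hypothesis Ssym : forall i j, S i j = S j i.
Hypothesis kern : forall i, \sum_j S i j * xi j + b i * beta = 0.
Hypothesis norm1 : \sum_j b j * xi j + d * beta = 1.
Hypothesis dSsym : forall k i j, dS k i j = dS k j i.
Hypothesis dkern : forall k i,
  \sum_j (dS k i j * xi j + S i j * dxi k j) + (db k i * beta + b i * dbeta k) = 0.

(** The factor of beta that remains when the derivative of S is contracted
    twice with xi. *)
Definition kernel_defect (k : 'I_n) : R :=
  d * dbeta k + \sum_j b j * dxi k j - \sum_i xi i * db k i.

(** Contract the derivative of the kernel equation with xi, and use the
    kernel equation and the normalization b . xi + d beta = 1. *)
Lemma xi_xi_dS k : \sum_i \sum_j xi i * xi j * dS k i j
  = - dbeta k + beta * kernel_defect k.
Proof.
have Sx j : \sum_i xi i * S i j = - (b j * beta).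
  apply/eqP; rewrite -addr_eq0; apply/eqP; rewrite -[RHS](kern j); congr (_ + _).
  by apply: eq_bigr => i _; rewrite Ssym mulrC.
have E : \sum_i xi i * (\sum_j (dS k i j * xi j + S i j * dxi k j)
    + (db k i * beta + b i * dbeta k)) = 0.
  by apply: big1 => i _; rewrite dkern mulr0.
have E2 : \sum_i xi i * (\sum_j (dS k i j * xi j + S i j * dxi k j)
    + (db k i * beta + b i * dbeta k)) =
   \sum_i \sum_j xi i * xi j * dS k i j + \sum_j (\sum_i xi i * S i j) * dxi k j
   + (\sum_i xi i * db k i) * beta + (\sum_i b i * xi i) * dbeta k.
  have -> : \sum_j (\sum_i xi i * S i j) * dxi k j = \sum_i \sum_j xi i * S i j * dxi k j.
    by rewrite exchange_big; apply: eq_bigr => j _; rewrite mulr_suml.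
  rewrite !mulr_suml -!big_split; apply: eq_bigr => i _ /=.
  rewrite big_split /= !mulrDr !mulr_sumr !addrA; congr (_ + _ + _ + _).
  - by apply: eq_bigr => j _; ring.
  - by apply: eq_bigr => j _; ring.
  - by ring.
  - by ring.
have E3 : \sum_j (\sum_i xi i * S i j) * dxi k j = - (beta * \sum_j b j * dxi k j).
  rewrite mulr_sumr -sumrN; apply: eq_bigr => j _; rewrite Sx; ring.
move: E; rewrite E2 E3 /kernel_defect; move: norm1.
move: (\sum_i \sum_j _) (\sum_j b j * dxi k j) (\sum_i xi i * db k i) (\sum_i b i * xi i).
move=> X B D N NE E.
have -> : X = - (beta * - B) - D * beta - N * dbeta k by lra.
have -> : N = 1 - d * beta by lra.
ring.
Qed.

(** When the three arguments of the Koszul formula are equal, two of its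
    three terms cancel. *)
Lemma cubic_koszul : \sum_i \sum_j xi i * xi j *
    (2^-1 * \sum_k xi k * (dS i j k + dS j i k - dS k i j)) =
  2^-1 * \sum_k xi k * \sum_i \sum_j xi i * xi j * dS k i j.
Proof.
pose X := \sum_k \sum_i \sum_j xi k * xi i * xi j * dS k i j.
have X1 : \sum_i \sum_j \sum_k xi i * xi j * xi k * dS i j k = X by [].
have X2 : \sum_i \sum_j \sum_k xi i * xi j * xi k * dS j i k = X.
  rewrite exchange_big; apply: eq_bigr => i _; apply: eq_bigr => j _.
  by apply: eq_bigr => k _; ring.
have X3 : \sum_i \sum_j \sum_k xi i * xi j * xi k * dS k i j = X.
  under eq_bigr => i _ do rewrite exchange_big.
  rewrite exchange_big; apply: eq_bigr => k _; apply: eq_bigr => i _.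
  by apply: eq_bigr => j _; ring.
have -> : \sum_k xi k * \sum_i \sum_j xi i * xi j * dS k i j = X.
  apply: eq_bigr => k _; rewrite mulr_sumr; apply: eq_bigr => i _.
  by rewrite mulr_sumr; apply: eq_bigr => j _; ring.
have -> : \sum_i \sum_j xi i * xi j * (2^-1 * \sum_k xi k * (dS i j k + dS j i k - dS k i j))
   = 2^-1 * (\sum_i \sum_j \sum_k xi i * xi j * xi k * dS i j k
   + \sum_i \sum_j \sum_k xi i * xi j * xi k * dS j i k
   - \sum_i \sum_j \sum_k xi i * xi j * xi k * dS k i j).
  rewrite -big_split -sumrB mulr_sumr; apply: eq_bigr => i _ /=.
  rewrite -big_split -sumrB mulr_sumr; apply: eq_bigr => j _ /=.
  rewrite -big_split -sumrB !mulr_sumr; apply: eq_bigr => k _ /=; ring.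
by rewrite X1 X2 X3 addrK.
Qed.

Section Transport.
Variables (delta phi : R).
Hypothesis delta0 : delta != 0.
Hypothesis hE : forall i j, h i j =
  2^-1 * \sum_k xi k * (dS i j k + dS j i k - dS k i j) + beta * z i j.
Hypothesis mean : \sum_i \sum_j
  (delta * (beta * P i j - xi i * xi j)) * h i j = phi * (delta * beta).

Definition transport_coef : R :=
  \sum_k xi k * kernel_defect k + 2 * (\sum_i \sum_j xi i * xi j * z i j)
  - 2 * (\sum_i \sum_j P i j * h i j) + 2 * phi.

(** Up to multiples of beta, the hypothesis on the mean curvature says that
    the second fundamental form vanishes on xi, since the cofactor matrix
    has rank one there. By the Koszul formula this value is - dbeta(xi) / 2. *)
Lemma transport_beta : \sum_k xi k * dbeta k = transport_coef * beta.
Proof.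
have E1 : \sum_i \sum_j xi i * xi j * h i j =
   2^-1 * (- \sum_k xi k * dbeta k + beta * \sum_k xi k * kernel_defect k)
   + beta * \sum_i \sum_j xi i * xi j * z i j.
  have -> : \sum_i \sum_j xi i * xi j * h i j =
     \sum_i \sum_j xi i * xi j * (2^-1 * \sum_k xi k * (dS i j k + dS j i k - dS k i j))
     + beta * \sum_i \sum_j xi i * xi j * z i j.
    rewrite mulr_sumr -big_split; apply: eq_bigr => i _ /=.
    rewrite mulr_sumr -big_split; apply: eq_bigr => j _ /=.
    rewrite hE; move: (2^-1 * _) => c; ring.
  rewrite cubic_koszul; congr (_ * _ + _).
  rewrite -sumrN mulr_sumr -big_split; apply: eq_bigr => k _ /=.
  by rewrite xi_xi_dS; ring.
have E2 : beta * \sum_i \sum_j P i j * h i j - \sum_i \sum_j xi i * xi j * h i j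
    = phi * beta.
  apply: (mulfI delta0).
  have -> : delta * (phi * beta) = phi * (delta * beta) by ring.
  rewrite -mean mulr_sumr -sumrB mulr_sumr; apply: eq_bigr => i _.
  rewrite mulr_sumr -sumrB mulr_sumr; apply: eq_bigr => j _; ring.
move: E2; rewrite E1 /transport_coef.
move: (\sum_k xi k * dbeta k) (\sum_k xi k * kernel_defect k)
  (\sum_i \sum_j xi i * xi j * z i j) (\sum_i \sum_j P i j * h i j).
move=> X K Zz PH E; lra.
Qed.

End Transport.

(** Where beta and dbeta vanish, the covariant acceleration of an integral
    curve of xi has no component along the tangent space: dbeta = 0 replaces
    the derivatives of xi by derivatives of S, and the Koszul formula leaves
    half of xi xi d_l S, which is 0. *)
Lemma geodesic_identity : beta = 0 -> (forall k, dbeta k = 0) -> forall l,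
  \sum_k (\sum_i xi i * dxi i k) * S k l +
  \sum_i \sum_j xi i * xi j * (2^-1 * (dS i j l + dS j i l - dS l i j)) = 0.
Proof.
move=> b0 db0 l.
have Xl : \sum_i \sum_j xi i * xi j * dS l i j = 0.
  by rewrite xi_xi_dS b0 db0 oppr0 mul0r addr0.
have D i : \sum_k dxi i k * S k l = - \sum_j dS i j l * xi j.
  apply/eqP; rewrite -addr_eq0 -big_split /=; apply/eqP.
  have dk : \sum_j (dS i l j * xi j + S l j * dxi i j) = 0.
    by have := dkern i l; rewrite b0 db0 !mulr0 !addr0.
  apply: etrans _ dk; apply: eq_bigr => k _.
  by rewrite addrC (dSsym i k l) (Ssym k l) [_ * S l k]mulrC.
have -> : \sum_k (\sum_i xi i * dxi i k) * S k l = - \sum_i \sum_j xi i * xi j * dS i j l.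
  under eq_bigr => k _ do rewrite mulr_suml.
  rewrite exchange_big -sumrN; apply: eq_bigr => i _ /=.
  transitivity (xi i * \sum_k dxi i k * S k l).
    by rewrite mulr_sumr; apply: eq_bigr => k _; rewrite mulrA.
  rewrite D mulrN mulr_sumr; congr (- _); apply: eq_bigr => j _; ring.
have X2 : \sum_i \sum_j xi i * xi j * dS j i l = \sum_i \sum_j xi i * xi j * dS i j l.
  by rewrite exchange_big; apply: eq_bigr => i _; apply: eq_bigr => j _; ring.
have -> : \sum_i \sum_j xi i * xi j * (2^-1 * (dS i j l + dS j i l - dS l i j)) =
  2^-1 * (\sum_i \sum_j xi i * xi j * dS i j l + \sum_i \sum_j xi i * xi j * dS j i l
   - \sum_i \sum_j xi i * xi j * dS l i j).
  rewrite -big_split -sumrB mulr_sumr; apply: eq_bigr => i _ /=.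
  rewrite -big_split -sumrB mulr_sumr; apply: eq_bigr => j _ /=; ring.
rewrite X2 Xl subr0; move: (\sum_i _) => X; lra.
Qed.

End ArrayIdentities.

(** * A hypersurface in one chart *)

Section CkMatrices.
Context {R : realType} {V : normedModType R}.

Lemma Ck_bil k (D : set V) q (A : V -> 'M[R]_q) (u v : V -> 'rV[R]_q) : open D ->
  Ck k D A -> Ck k D u -> Ck k D v -> Ck k D (fun x => bil (A x) (u x) (v x)).
Proof.
move=> oD CA Cu Cv.
apply: (Ck_ext (f := fun x => \sum_a \sum_b u x 0 a * A x a b * v x 0 b) oD).
  by move=> x _; rewrite bilE.
apply: (Ck_sum (W := R)) => // a _; apply: (Ck_sum (W := R)) => // b _.
apply: Ck_mul => //; last exact: Ck_entry.
by apply: Ck_mul => //; exact: Ck_entry.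
Qed.

Lemma Ck_invmx k (D : set V) q (A : V -> 'M[R]_q) : open D ->
  (forall x, D x -> A x \in unitmx) -> Ck k D A -> Ck k D (fun x => invmx (A x)).
Proof.
move=> oD uA CA; apply/Ck_mxP => // i j.
have Cij a b : Ck k D (fun x => A x a b) by exact: Ck_entry.
have Cd : Ck k D (fun x => \det (A x)) by exact: Ck_det.
have d0 x : D x -> \det (A x) != 0 by move=> /uA; rewrite unitmxE unitfE.
have Ca : Ck k D (fun x => (-1) ^+ (j + i) * \det (row' j (col' i (A x)))).
  apply: Ck_mul => //; first exact: (@Ck_cst R V R).
  apply: Ck_det => // a b.
  by apply: Ck_ext oD _ (Cij (lift j a) (lift i b)) => x _; rewrite !mxE.
apply: (Ck_ext oD _ (Ck_mul oD (Ck_inv oD d0 Cd) Ca)) => x Dx.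
by rewrite /invmx uA // !mxE.
Qed.

Lemma Ck_derive_along k (D : set V) q (Y : set 'rV[R]_q) (G : 'rV[R]_q -> 'M[R]_q)
    (f u : V -> 'rV[R]_q) : open D -> open Y -> (forall x, D x -> Y (f x)) ->
  Ck k.+1 Y G -> Ck k D f -> Ck k D u ->
  Ck k D (fun x => 'D_(u x) G (f x)).
Proof.
move=> oD oY DY CG Cf Cu; apply/Ck_mxP => // i j.
apply: (Ck_ext (f := fun x => \sum_c u x 0 c * 'D_(e_ c) (fun y => G y i j) (f x)) oD).
  by move=> x Dx; rewrite (derive_mx_coord _ _ _ oY (Ck_le (ltn0Sn k) CG) (DY x Dx)).
apply: (Ck_sum (W := R)) => // c _; apply: Ck_mul => //; first exact: Ck_entry.
exact: (Ck_comp oD oY DY Cf (Ck_derive (e_ c) (Ck_entry i j oY CG))).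
Qed.

End CkMatrices.

Section LocalGeometry.
Context {R : realType} {n : nat}.
Local Notation m := (@ord_max n).
Local Notation l := (lift (@ord_max n)).
Variables (Om : set 'rV[R]_n) (Y : set 'rV[R]_n.+1).
Variables (f : 'rV[R]_n -> 'rV[R]_n.+1) (G : 'rV[R]_n.+1 -> 'M[R]_n.+1).
Hypotheses (oOm : open Om) (oY : open Y) (Cf : Ck 4 Om f) (CG : Ck 4 Y G).
Hypothesis OmY : forall p, Om p -> Y (f p).
Hypothesis symG : forall y, Y y -> (G y)^T = G y.
Hypothesis unitG : forall y, Y y -> G y \in unitmx.
Variable Z : 'rV[R]_n.+1.

Definition coord_vec (i : 'I_n) := 'D_(e_ i) f.
(** The coordinate vectors of the hypersurface completed by the constant
    vector Z. *)
Definition adapted (p : 'rV[R]_n) : 'M[R]_n.+1 := frame_mx (fun i => coord_vec i p) Z.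
Definition transverse_at : set 'rV[R]_n := [set p | Om p /\ \det (adapted p) != 0].
Local Notation W := transverse_at.
Definition gram (p : 'rV[R]_n) : 'M[R]_n.+1 := adapted p *m G (f p) *m (adapted p)^T.
Definition first_form (p : 'rV[R]_n) : 'M[R]_n :=
  \matrix_(i, j) bil (G (f p)) (coord_vec i p) (coord_vec j p).
(** The last column of the inverse Gram matrix, without its corner. In the
    frame, this column gives a multiple of the normal vector; its corner is
    the component along Z. *)
Definition null_dir (p : 'rV[R]_n) : 'rV[R]_n := \row_i invmx (gram p) (l i) m.
(** The corner of the inverse Gram matrix vanishes exactly where the normal
    vector is tangent. *)
Definition null_defect (p : 'rV[R]_n) : R := invmx (gram p) m m.
Local Notation xi := null_dir.
Local Notation beta := null_defect.

Lemma Ck_coord_vec k i : (k <= 3)%N -> Ck k Om (coord_vec i).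
Proof. by move=> k3; exact: Ck_le k3 (Ck_derive (e_ i) Cf). Qed.

Lemma Ck_Gf k : (k <= 4)%N -> Ck k Om (fun p => G (f p)).
Proof.
by move=> k4; exact: Ck_le k4 (Ck_comp_mx oOm oY OmY Cf CG).
Qed.

Lemma Ck_adapted : Ck 3 Om adapted.
Proof.
apply/Ck_mxP => // a c; case: (unliftP m a) => [i|] ->.
  apply: Ck_ext oOm _ (Ck_entry 0 c oOm (Ck_coord_vec i (leqnn 3))) => p _.
  by rewrite !mxE liftK.
apply: Ck_ext oOm _ (@Ck_cst R _ R 3 Om (Z 0 c)) => p _.
by rewrite !mxE unlift_none.
Qed.

Lemma open_transverse : open W.
Proof.
rewrite openE => p [Op dp].
have cd : {for p, continuous (fun p => \det (adapted p))}.
  by apply: (Ck_cont (k := 3) (Ck_det oOm _) Op) => i j; exact: Ck_entry oOm Ck_adapted.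
have nO : nbhs p Om by exact: open_nbhs_nbhs.
have nd : nbhs p [set q | \det (adapted q) != 0].
  have N : nbhs (\det (adapted p)) [set x : R | x != 0].
    by apply: open_nbhs_nbhs; split => //; exact: open_neq.
  exact: (cd _ N).
by apply: filterS2 nO nd => q.
Qed.

Let oW := open_transverse.

Lemma WOm p : W p -> Om p. Proof. by case. Qed.
Lemma WY p : W p -> Y (f p). Proof. by move=> /WOm /OmY. Qed.

Lemma adapted_unit p : W p -> adapted p \in unitmx.
Proof. by move=> [_]; rewrite unitmxE unitfE. Qed.

Lemma gram_entry p a c :
  gram p a c = bil (G (f p)) (row a (adapted p)) (row c (adapted p)).
Proof.
Local Transparent bil.
by rewrite /bil -row_mul /gram !mxE; apply: eq_bigr => k _; rewrite !mxE.
Local Opaque bil.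
Qed.

Lemma row_adapted p i : row (l i) (adapted p) = coord_vec i p.
Proof. exact: row_frame_mx. Qed.

Lemma row_adapted_max p : row m (adapted p) = Z.
Proof. exact: row_frame_mx_max. Qed.

Lemma gram_core p : core (gram p) = first_form p.
Proof. by apply/matrixP => i j; rewrite coreE gram_entry !row_adapted [RHS]mxE. Qed.

Lemma gram_sym p : W p -> (gram p)^T = gram p.
Proof.
by move=> Wp; rewrite /gram !trmx_mul trmxK (symG (WY Wp)) mulmxA.
Qed.

Lemma gram_unit p : W p -> gram p \in unitmx.
Proof.
move=> Wp; rewrite !unitmx_mul unitmx_tr adapted_unit //=.
by rewrite (unitG (WY Wp)).
Qed.

Lemma Ck_gram : Ck 3 Om gram.
Proof.
apply/Ck_mxP => // a c.
have Crow k : Ck 3 Om (fun p => row k (adapted p)).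
  apply/Ck_mxP => // i j.
  by apply: Ck_ext oOm _ (Ck_entry k j oOm Ck_adapted) => p _; rewrite [RHS]mxE.
apply: (Ck_ext oOm _ (Ck_bil oOm (Ck_Gf (leqnSn 3)) (Crow a) (Crow c))) => p _.
by rewrite gram_entry.
Qed.

Lemma Ck_invgram a c : Ck 3 W (fun p => invmx (gram p) a c).
Proof.
have C : Ck 3 W gram by apply: Ck_sub Ck_gram => p /WOm.
exact: (Ck_entry a c oW (Ck_invmx oW gram_unit C)).
Qed.

Lemma Ck_xi : Ck 3 W xi.
Proof.
apply/Ck_mxP => // i j.
by apply: Ck_ext oW _ (Ck_invgram (l j) m) => p _; rewrite [RHS]mxE.
Qed.

(** Short names for the blocks of the Gram matrix and of its inverse, as
    functions of the point. *)
Definition Sij (i j : 'I_n) : 'rV[R]_n -> R := fun p => gram p (l i) (l j).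
Definition bi (i : 'I_n) : 'rV[R]_n -> R := fun p => gram p (l i) m.
Definition Pij (i j : 'I_n) : 'rV[R]_n -> R := fun p => invmx (gram p) (l i) (l j).
Definition xij (j : 'I_n) : 'rV[R]_n -> R := fun p => xi p 0 j.
Definition cov_transverse (i j : 'I_n) : 'rV[R]_n -> R :=
  fun p => bil (G (f p)) (cov_coord G f p (e_ i) (e_ j)) Z.

Lemma Ck_W k F : Ck k Om F -> Ck k W (F : 'rV[R]_n -> R).
Proof. by apply: Ck_sub => p /WOm. Qed.

Lemma Ck_Sij i j : Ck 3 W (Sij i j).
Proof. exact: Ck_W (Ck_entry (l i) (l j) oOm Ck_gram). Qed.

Lemma Ck_bi i : Ck 3 W (bi i).
Proof. exact: Ck_W (Ck_entry (l i) m oOm Ck_gram). Qed.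

Lemma Ck_xij j : Ck 3 W (xij j).
Proof. exact: Ck_entry 0 j oW Ck_xi. Qed.

Lemma Ck_beta : Ck 3 W beta.
Proof. exact: Ck_invgram. Qed.

Lemma Ck_detgram : Ck 3 W (fun p => \det (gram p)).
Proof. by apply: Ck_W; apply: Ck_det oOm _ => i j; exact: Ck_entry oOm Ck_gram. Qed.

Lemma Sij_eq i j : Sij i j = (fun p => bil (G (f p)) ('D_(e_ i) f p) ('D_(e_ j) f p)).
Proof. by apply/funext => p; rewrite /Sij gram_entry !row_adapted. Qed.

Lemma Sij_sym p i j : W p -> Sij i j p = Sij j i p.
Proof. by move=> Wp; rewrite /Sij sym_entry // gram_sym. Qed.

Lemma Ck_cov_transverse i j : Ck 2 Om (cov_transverse i j).
Proof.
have C1 : Ck 2 Om ('D_(e_ i) (coord_vec j)) by exact: Ck_derive (Ck_coord_vec j (leqnn 3)).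
have CZ : Ck 2 Om (cst Z : 'rV[R]_n -> _) by exact: Ck_cst.
have CG2 : Ck 3 Y G by exact: Ck_le CG.
have Cf2 : Ck 2 Om f by exact: Ck_le Cf.
have CA u : Ck 2 Om u -> Ck 2 Om (fun p => 'D_(u p) G (f p)).
  exact: (Ck_derive_along oOm oY OmY CG2 Cf2).
have Ci := Ck_coord_vec i (isT : (2 <= 3)%N); have Cj := Ck_coord_vec j (isT : (2 <= 3)%N).
have T0 := Ck_bil oOm (Ck_Gf (isT : (2 <= 4)%N)) C1 CZ.
have T1 := Ck_bil oOm (CA _ Ci) Cj CZ.
have T2 := Ck_bil oOm (CA _ Cj) Ci CZ.
have T3 := Ck_bil oOm (CA _ CZ) Ci Cj.
have T := Ck_add oOm T0 (Ck_mul oOm (@Ck_cst R _ R 2 Om 2^-1)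
  (Ck_sub_fun oOm (Ck_add oOm T1 T2) T3)).
apply: (Ck_ext oOm _ T) => p Op.
have Yp := OmY Op.
by rewrite /cov_transverse (bil_cov_coord (e_ i) (e_ j) Z oY (Ck_le (isT : (1 <= 4)%N) CG) Yp (symG Yp) (unitG Yp)).
Qed.

Lemma kern_eq p i : W p -> \sum_j Sij i j p * xij j p + bi i p * beta p = 0.
Proof.
move=> Wp; apply: etrans _ (border_kernel (gram_unit Wp) i).
by congr (_ + _); apply: eq_bigr => j _; rewrite /xij mxE.
Qed.

Lemma norm_eq p : W p -> \sum_j bi j p * xij j p + gram p m m * beta p = 1.
Proof.
move=> Wp; apply: etrans _ (border_norm (gram_sym Wp) (gram_unit Wp)).
by congr (_ + _); apply: eq_bigr => j _; rewrite /xij mxE.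
Qed.

Local Notation partial k F p := ('D_(e_ k) F p).

Lemma dkern_eq p k i : W p ->
  \sum_j (partial k (Sij i j) p * xij j p + Sij i j p * partial k (xij j) p)
  + (partial k (bi i) p * beta p + bi i p * partial k beta p) = 0.
Proof.
move=> Wp.
have D (F : 'rV[R]_n -> R) : Ck 3 W F -> is_derive p (e_ k) F (partial k F p).
  by move=> CF; apply: derivableP; exact: (Ck_derivable CF Wp).
have D1 := is_derive_sum_fun (fun j => is_derive_mul (D _ (Ck_Sij i j)) (D _ (Ck_xij j))).
have D2 := is_derive_mul (D _ (Ck_bi i)) (D _ Ck_beta).
have [_ <-] := is_deriveD D1 D2.
have E q : W q -> ((fun q => \sum_j Sij i j q * xij j q) + (fun q => bi i q * beta q)) q
    = cst (0 : R) q by exact: kern_eq.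
by rewrite (derive_ext _ oW Wp E) derive_cst.
Qed.

Lemma dSij_sym p k i j : W p -> partial k (Sij i j) p = partial k (Sij j i) p.
Proof. by move=> Wp; apply: derive_ext oW Wp _ => q; exact: Sij_sym. Qed.

Lemma bil_cov_coord_vec p i j k : W p ->
  bil (G (f p)) (cov_coord G f p (e_ i) (e_ j)) (coord_vec k p) =
  2^-1 * (partial i (Sij j k) p + partial j (Sij i k) p - partial k (Sij i j) p).
Proof.
move=> Wp; have Yp := WY Wp; rewrite !Sij_eq.
exact: (koszul (e_ i) (e_ j) (e_ k) oY (Ck_le (isT : (1 <= 4)%N) CG) oOm
  (Ck_le (isT : (2 <= 4)%N) Cf) (WOm Wp) Yp (symG Yp) (unitG Yp)).
Qed.

(** The component along Z of the covariant derivative of the coordinate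
    vectors; it is the second fundamental form up to a factor independent of
    i and j. The Koszul formula gives its tangential part, and the rest is a
    multiple of beta. *)
Definition cov_normal (i j : 'I_n) : 'rV[R]_n -> R := fun p =>
  2^-1 * (\sum_k xij k p * (partial i (Sij j k) p + partial j (Sij i k) p - partial k (Sij i j) p))
  + beta p * cov_transverse i j p.

Lemma det_frame_mx_gram p w : W p ->
  \det (frame_mx (fun i => coord_vec i p) w) = \det (adapted p) *
   (\sum_k bil (G (f p)) w (coord_vec k p) * xij k p + bil (G (f p)) w Z * beta p).
Proof.
move=> Wp; have uE := adapted_unit Wp.
rewrite (det_frame_mx _ uE) mulrC; congr (_ * _).
have -> : w *m invmx (adapted p) =
    w *m G (f p) *m (adapted p)^T *m invmx (gram p).
  have uH := gram_unit Wp; apply: (can_inj (mulmxK uH)).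
  by rewrite mulmxKV // /gram !mulmxA mulmxKV.
rewrite mxE sum_lift_max.
have E a : (w *m G (f p) *m (adapted p)^T) 0 a = bil (G (f p)) w (row a (adapted p)).
  Local Transparent bil.
  by rewrite /bil !mxE; apply: eq_bigr => b _; rewrite !mxE.
  Local Opaque bil.
congr (_ + _); last by rewrite E row_adapted_max.
by apply: eq_bigr => k _; rewrite E row_adapted /xij [xi p 0 k]mxE.
Qed.

Lemma det_frame_mx_cov p i j : W p ->
  \det (frame_mx (fun i => coord_vec i p) (cov_coord G f p (e_ i) (e_ j))) = \det (adapted p) * cov_normal i j p.
Proof.
move=> Wp; rewrite (det_frame_mx_gram _ Wp) /cov_normal; congr (_ * (_ + _)); last exact: mulrC.
by rewrite mulr_sumr; apply: eq_bigr => k _; rewrite (bil_cov_coord_vec i j k Wp) -mulrA;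
  congr (_ * _); exact: mulrC.
Qed.

Lemma det_first_form p : W p -> \det (first_form p) = \det (gram p) * beta p.
Proof. by move=> Wp; rewrite -gram_core det_core // gram_unit. Qed.

Lemma cofactor_first_form p i j : W p -> cofactor (first_form p) i j =
  \det (gram p) * (beta p * Pij i j p - xij i p * xij j p).
Proof.
move=> Wp; rewrite -gram_core (cofactor_core (gram_sym Wp) (gram_unit Wp)).
by rewrite /Pij /xij !mxE.
Qed.

Section MeanCurvature.
Variables (lam phi : 'rV[R]_n -> R) (second_form : 'rV[R]_n -> 'I_n -> 'I_n -> R).
Hypothesis clam : Ck 0 W lam.
Hypothesis cphi : Ck 0 W phi.
Hypothesis lam0 : forall p, W p -> lam p != 0.
Hypothesis second_formE : forall p i j, W p -> second_form p i j =
  lam p * \det (frame_mx (fun i => coord_vec i p) (cov_coord G f p (e_ i) (e_ j))).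
Hypothesis meanE : forall p, W p ->
  \sum_i \sum_j cofactor (first_form p) i j * second_form p i j = phi p * \det (first_form p).

(** The arguments are the values at p of the Gram matrix, of its inverse and
    of their partial derivatives; the last one is the mean curvature factor,
    rescaled to the normalization of cov_normal. *)
Definition chi (p : 'rV[R]_n) : R :=
  transport_coef (fun i j => Pij i j p) (fun i j => cov_normal i j p) (fun i j => cov_transverse i j p)
    (fun i => xij i p) (fun i => bi i p) (gram p m m)
    (fun k j => partial k (xij j) p) (fun k i => partial k (bi i) p) (fun k => partial k beta p)
    (phi p / (lam p * \det (adapted p))).

(** The hypothesis A = phi B, in the form used by the flow. *)
Lemma transport p : W p -> 'D_(xi p) beta p = chi p * beta p.
Proof.
move=> Wp; have Cb : Ck 1 W beta by exact: Ck_le Ck_beta.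
rewrite (derive_coord _ oW Cb Wp).
have mu0 : lam p * \det (adapted p) != 0.
  by rewrite mulf_neq0 ?lam0 //; case: Wp.
have d0 : \det (gram p) != 0 by have := gram_unit Wp; rewrite unitmxE unitfE.
apply: (@transport_beta R n (fun i j => Sij i j p) (fun i j => Pij i j p)
  (fun i j => cov_normal i j p) (fun i j => cov_transverse i j p) (fun i => xij i p) (fun i => bi i p)
  (gram p m m) (beta p) (fun k i j => partial k (Sij i j) p) (fun k j => partial k (xij j) p)
  (fun k i => partial k (bi i) p) (fun k => partial k beta p) (fun i j => Sij_sym i j Wp)
  (fun i => kern_eq i Wp) (norm_eq Wp) (fun k i => dkern_eq k i Wp)
  (\det (gram p)) _ d0 (fun i j => erefl)).
have := meanE Wp; rewrite (det_first_form Wp) => E.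
apply: (mulfI mu0).
have -> : lam p * \det (adapted p) * (phi p / (lam p * \det (adapted p)) * (\det (gram p) * beta p))
   = phi p * (\det (gram p) * beta p).
  by rewrite mulrA [X in X * _]mulrC (divfK mu0).
rewrite -E mulr_sumr; apply: eq_bigr => i _.
rewrite mulr_sumr; apply: eq_bigr => j _.
rewrite (cofactor_first_form i j Wp) (second_formE i j Wp) (det_frame_mx_cov i j Wp).
move: (\det (gram p) * _) (cov_normal i j p) (lam p) (\det (adapted p)) => c1 c2 c3 c4.
ring.
Qed.

Lemma chi_continuous p : W p -> {for p, continuous chi}.
Proof.
move=> Wp.
have C3 (F : 'rV[R]_n -> R) : Ck 3 W F -> Ck 0 W F by exact: Ck_le.
have Cd k (F : 'rV[R]_n -> R) : Ck 3 W F -> Ck 0 W (fun p => partial k F p).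
  by move=> CF; exact: Ck_le (Ck_derive (e_ k) CF).
have Cz i j : Ck 0 W (cov_transverse i j) by exact: Ck_le (Ck_W (Ck_cov_transverse i j)).
have Cgm : Ck 0 W (fun p => gram p m m) by exact: C3 (Ck_W (Ck_entry m m oOm Ck_gram)).
have CP i j : Ck 0 W (Pij i j) by exact: C3 (Ck_invgram _ _).
have Cs (I : finType) (F : I -> 'rV[R]_n -> R) : (forall i, Ck 0 W (F i)) ->
    Ck 0 W (fun p => \sum_i F i p) by move=> CF; exact: Ck_sum.
have Cc (c : R) : Ck 0 W (fun=> c : R) by exact: Ck_cst.
have Chn i j : Ck 0 W (cov_normal i j).
  have Cb (i' j' k' : 'I_n) := Ck_sub_fun oW (Ck_add oW (Cd i' _ (Ck_Sij j' k'))
    (Cd j' _ (Ck_Sij i' k'))) (Cd k' _ (Ck_Sij i' j')).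
  have C1 := Ck_mul oW (Cc 2^-1) (Cs _ _ (fun k => Ck_mul oW (C3 _ (Ck_xij k)) (Cb i j k))).
  exact: (Ck_add oW C1 (Ck_mul oW (C3 _ Ck_beta) (Cz i j))).
have Ck0 k : Ck 0 W (fun p => gram p m m * partial k beta p
   + \sum_j bi j p * partial k (xij j) p - \sum_i xij i p * partial k (bi i) p).
  exact: (Ck_sub_fun oW (Ck_add oW (Ck_mul oW Cgm (Cd k _ Ck_beta))
      (Cs _ _ (fun j => Ck_mul oW (C3 _ (Ck_bi j)) (Cd k _ (Ck_xij j)))))
    (Cs _ _ (fun j => Ck_mul oW (C3 _ (Ck_xij j)) (Cd k _ (Ck_bi j))))).
have T1 : Ck 0 W (fun p => \sum_k xij k p * (gram p m m * partial k beta p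
   + \sum_j bi j p * partial k (xij j) p - \sum_i xij i p * partial k (bi i) p)).
  exact: (Cs _ _ (fun k => Ck_mul oW (C3 _ (Ck_xij k)) (Ck0 k))).
have T2 : Ck 0 W (fun p => 2 * \sum_i \sum_j xij i p * xij j p * cov_transverse i j p).
  exact: (Ck_mul oW (Cc 2) (Cs _ _ (fun i => Cs _ _ (fun j =>
    Ck_mul oW (Ck_mul oW (C3 _ (Ck_xij i)) (C3 _ (Ck_xij j))) (Cz i j))))).
have T3 : Ck 0 W (fun p => 2 * \sum_i \sum_j Pij i j p * cov_normal i j p).
  exact: (Ck_mul oW (Cc 2) (Cs _ _ (fun i => Cs _ _ (fun j =>
    Ck_mul oW (CP i j) (Chn i j))))).
have cdet : Ck 0 W (fun p => \det (adapted p)).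
  exact: C3 (Ck_W (Ck_det oOm (fun i j => Ck_entry i j oOm Ck_adapted))).
have mu0 q : W q -> lam q * \det (adapted q) != 0.
  by move=> Wq; rewrite mulf_neq0 ?lam0 //; case: Wq.
have T4 := Ck_mul oW (Cc 2) (Ck_mul oW cphi (Ck_inv oW mu0 (Ck_mul oW clam cdet))).
exact: (Ck_cont (Ck_add oW (Ck_sub_fun oW (Ck_add oW T1 T2) T3) T4) Wp).
Qed.

(** The scalar product with Z of the covariant acceleration of an integral
    curve of xi. Where beta vanishes, df(xi) has scalar product 1 with Z, so
    this is the factor relating the acceleration to the velocity. *)
Definition kappa (p : 'rV[R]_n) : R :=
  \sum_k (\sum_i xij i p * partial i (xij k) p) * bi k p
  + \sum_i \sum_j xij i p * xij j p * cov_transverse i j p.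

Lemma Ck_kappa : Ck 1 W kappa.
Proof.
have C3 (F : 'rV[R]_n -> R) : Ck 3 W F -> Ck 1 W F by exact: Ck_le.
have Cd k (F : 'rV[R]_n -> R) : Ck 3 W F -> Ck 1 W (fun p => partial k F p).
  by move=> CF; exact: Ck_le (Ck_derive (e_ k) CF).
have Cz i j : Ck 1 W (cov_transverse i j) by exact: Ck_le (Ck_W (Ck_cov_transverse i j)).
have Cs (I : finType) (F : I -> 'rV[R]_n -> R) : (forall i, Ck 1 W (F i)) ->
    Ck 1 W (fun p => \sum_i F i p) by move=> CF; exact: Ck_sum.
have T1 := Cs _ _ (fun k => Ck_mul oW (Cs _ _ (fun i =>
  Ck_mul oW (C3 _ (Ck_xij i)) (Cd i _ (Ck_xij k)))) (C3 _ (Ck_bi k))).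
have T2 := Cs _ _ (fun i => Cs _ _ (fun j =>
    Ck_mul oW (Ck_mul oW (C3 _ (Ck_xij i)) (C3 _ (Ck_xij j))) (Cz i j))).
exact: (Ck_add oW T1 T2).
Qed.

Lemma derive_det_first_form p v : W p -> beta p = 0 ->
  'D_v (fun q => \det (first_form q)) p = \det (gram p) * 'D_v beta p.
Proof.
move=> Wp b0.
rewrite (derive_ext v oW Wp det_first_form).
have D1 : is_derive p v (fun q => \det (gram q)) ('D_v (fun q => \det (gram q)) p).
  by apply: derivableP; exact: (Ck_derivable Ck_detgram Wp).
have D2 : is_derive p v beta ('D_v beta p).
  by apply: derivableP; exact: (Ck_derivable Ck_beta Wp).
by have [_ ->] := is_derive_mul D1 D2; rewrite b0 mulr0 add0r.
Qed.

Lemma xi_S_eq0 p k : W p -> beta p = 0 -> \sum_i xij i p * Sij i k p = 0.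
Proof.
move=> Wp b0; have := kern_eq k Wp; rewrite b0 mulr0 addr0 => E.
by apply: etrans _ E; apply: eq_bigr => i _; rewrite (Sij_sym _ _ Wp) mulrC.
Qed.

Lemma adapted_nondegenerate p u : W p ->
  (forall l', bil (G (f p)) u (coord_vec l' p) = 0) -> bil (G (f p)) u Z = 0 -> u = 0.
Proof.
move=> Wp ul uZ.
have E : u *m (G (f p) *m (adapted p)^T) = 0.
  apply/rowP => a; rewrite [RHS]mxE.
  have -> : (u *m (G (f p) *m (adapted p)^T)) 0 a = bil (G (f p)) u (row a (adapted p)).
    Local Transparent bil.
    by rewrite /bil mulmxA !mxE; apply: eq_bigr => b _; rewrite !mxE.
    Local Opaque bil.
  by case: (unliftP m a) => [i|] ->; rewrite ?row_adapted ?row_adapted_max.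
have U : G (f p) *m (adapted p)^T \in unitmx.
  by rewrite unitmx_mul (unitG (WY Wp)) unitmx_tr adapted_unit.
by rewrite -(mulmxK U u) E mul0mx.
Qed.

Section AlongCurve.
Variables (a : R) (y : R -> 'rV[R]_n) (tau : R -> R) (t : R).
Local Notation I := [set s : R | `|s| < a].
Hypothesis Cy : Ck 2 I y.
Hypothesis Wy : forall s : R, `|s| < a -> W (y s).
Hypothesis dy : forall s : R, `|s| < a -> is_derive s 1 y (tau s *: xi (y s)).
Hypothesis dtau : forall s : R, `|s| < a ->
  is_derive s 1 tau (- (tau s * tau s * kappa (y s))).
Hypothesis ta : `|t| < a.
Hypothesis tau0 : tau t != 0.
Hypothesis b0 : beta (y t) = 0.
Hypothesis db0 : forall v, 'D_v beta (y t) = 0.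

Let p := y t.
Let Wp : W p := Wy ta.

Lemma velocity : 'D_1 (f \o y) t = \sum_k (tau t * xij k p) *: coord_vec k p.
Proof.
have df : differentiable f (y t).
  exact: Ck1_differentiable_rV oOm (Ck_le (isT : (1 <= 4)%N) Cf) (WOm Wp).
have [D1 D2] := dy ta.
have [_ ->] := is_derive_comp D1 df; rewrite D2.
rewrite (derive_coord_rV _ oOm (Ck_le (isT : (1 <= 4)%N) Cf) (WOm Wp)).
by apply: eq_bigr => k _; rewrite mxE.
Qed.

(** If xi vanished at a zero of beta, the last column of the inverse Gram
    matrix would be 0. *)
Lemma velocity_neq0 : 'D_1 (f \o y) t <> 0.
Proof.
rewrite velocity => v0.
pose v : 'rV[R]_n.+1 := \row_a (if unlift m a is Some i then tau t * xij i p else 0).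
have vi i : v 0 (l i) = tau t * xij i p by rewrite mxE liftK.
have vm : v 0 m = 0 by rewrite mxE unlift_none.
have vE : v *m adapted p = 0.
  rewrite mul_frame_mx vm scale0r addr0 -[RHS]v0.
  by apply: eq_bigr => k _; rewrite vi.
have {}v0 : v = 0 by rewrite -(mulmxK (adapted_unit Wp) v) vE mul0mx.
have x0 i : xij i p = 0.
  by apply: (mulfI tau0); rewrite mulr0 -vi v0 mxE.
have := norm_eq Wp; rewrite b0 mulr0 addr0 big1 => [/eqP|i _].
  by rewrite eq_sym oner_eq0.
by rewrite x0 mulr0.
Qed.

Lemma velocity_null :
  bil (G (f p)) ('D_1 (f \o y) t) ('D_1 (f \o y) t) = 0.
Proof.
rewrite velocity bil_sumr big1 // => k _; rewrite bilZr bil_suml.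
apply/eqP; rewrite mulf_eq0; apply/orP; right; apply/eqP.
transitivity (tau t * \sum_i xij i p * Sij i k p); last first.
  by rewrite xi_S_eq0 // mulr0.
rewrite mulr_sumr; apply: eq_bigr => i _.
by rewrite bilZl mulrA /Sij gram_entry !row_adapted.
Qed.

Definition accel k := tau t * tau t *
  (\sum_i xij i p * partial i (xij k) p - kappa p * xij k p).

Lemma acceleration k : ('D_1 ('D_1 y) t) 0 k = accel k.
Proof.
have oI := @open_ball0 R a.
have E s : I s -> 'D_1 y s = tau s *: xi (y s) by move=> /dy[].
have It : I t := ta.
have D : derivable ('D_1 y) t 1 by exact: (Ck_derivable (Ck_derive (1 : R) Cy) It).
have [_ <-] := is_derive_entry 0 k (derivableP D).
have E' s : I s -> ('D_1 y s) 0 k = tau s * xij k (y s).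
  by move=> /E ->; rewrite mxE.
rewrite (derive_ext (1 : R) oI It E').
have [D1 D2] := dy ta.
have := is_derive_compC1 oW (Ck_le (isT : (1 <= 3)%N) (Ck_xij k)) Wp D1; rewrite D2 => Dx.
have [_ ->] := is_derive_mul (dtau ta) Dx.
rewrite /accel /= (_ : \sum_a _ = tau t * \sum_i xij i p * partial i (xij k) p); last first.
  by rewrite mulr_sumr; apply: eq_bigr => i _; rewrite mxE mulrA.
move: (\sum_i _) (kappa _) (xij k _) (tau t) => c1 c2 c3 c4; ring.
Qed.

(** The acceleration is tested against the frame. Against the coordinate
    vectors it vanishes by geodesic_identity; against Z it vanishes by the
    choice of the equation for tau. *)
Lemma curve_geodesic : cov_coord G (f \o y) t 1 1 = 0.
Proof.
have oI := @open_ball0 R a.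
have It : I t := ta.
have Cf2 := Ck_le (isT : (2 <= 4)%N) Cf.
have Op := WOm Wp.
have df : differentiable f (y t).
  exact: Ck1_differentiable_rV oOm (Ck_le (isT : (1 <= 4)%N) Cf) Op.
have [D1 D2] := dy ta.
have dfy : 'D_1 (f \o y) t = 'D_('D_1 y t) f p.
  by have [_ ->] := is_derive_comp D1 df.
have -> : cov_coord G (f \o y) t 1 1 = 'D_('D_1 ('D_1 y) t) f p
   + cov_coord G f p ('D_1 y t) ('D_1 y t).
  rewrite /cov_coord (derive2_comp_mx (1 : R) (1 : R) oI oOm (fun s sI => WOm (Wy sI)) Cy Cf2 It) dfy.
  by rewrite -addrA.
rewrite (cov_coord_bilinear G _ _ oOm Cf2 Op) (derive_coord_rV _ oOm (Ck_pred Cf2) Op).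
rewrite (eq_bigr (fun k => accel k *: coord_vec k p)); last first.
  by move=> k _; rewrite acceleration.
rewrite D2.
have E w : bil (G (f p)) (\sum_k accel k *: coord_vec k p +
   \sum_i \sum_j ((tau t *: xi (y t)) 0 i * (tau t *: xi (y t)) 0 j) *:
      cov_coord G f p (e_ i) (e_ j)) w =
   tau t * tau t * (\sum_k (\sum_i xij i p * partial i (xij k) p) * bil (G (f p)) (coord_vec k p) w
     + \sum_i \sum_j xij i p * xij j p * bil (G (f p)) (cov_coord G f p (e_ i) (e_ j)) w
     - kappa p * \sum_k xij k p * bil (G (f p)) (coord_vec k p) w).
  rewrite bilDl !bil_suml addrAC mulrDr; congr (_ + _).
    rewrite mulr_sumr -sumrB mulr_sumr; apply: eq_bigr => k _.
    rewrite bilZl /accel; move: (bil _ _ _) (\sum_i _) (kappa p) => c1 c2 c3.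
    ring.
  rewrite mulr_sumr; apply: eq_bigr => i _; rewrite bil_suml mulr_sumr.
  apply: eq_bigr => j _; rewrite bilZl !mxE -/(xij i p) -/(xij j p).
  rewrite /xij !mxE; move: (bil _ _ _) => c; ring.
apply: (adapted_nondegenerate Wp) => [l'|]; rewrite {}E.
  have S k : bil (G (f p)) (coord_vec k p) (coord_vec l' p) = Sij k l' p.
    by rewrite /Sij gram_entry !row_adapted.
  have -> : \sum_k xij k p * bil (G (f p)) (coord_vec k p) (coord_vec l' p) = 0.
    by apply: etrans _ (xi_S_eq0 l' Wp b0); apply: eq_bigr => k _; rewrite S.
  rewrite mulr0 subr0; apply/eqP; rewrite mulf_eq0; apply/orP; right; apply/eqP.
  have := @geodesic_identity R n (fun i j => Sij i j p) (fun i => xij i p)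
    (fun i => bi i p) (gram p m m) (beta p) (fun k i j => partial k (Sij i j) p)
    (fun k j => partial k (xij j) p) (fun k i => partial k (bi i) p) (fun k => partial k beta p)
    (fun i j => Sij_sym i j Wp) (fun i => kern_eq i Wp) (norm_eq Wp)
    (fun k i j => dSij_sym k i j Wp) (fun k i => dkern_eq k i Wp) b0 (fun k => db0 _) l'.
  apply: etrans; congr (_ + _); first by apply: eq_bigr => k _; rewrite S.
  by apply: eq_bigr => i _; apply: eq_bigr => j _; rewrite (bil_cov_coord_vec i j l' Wp).
have S k : bil (G (f p)) (coord_vec k p) Z = bi k p.
  by rewrite /bi gram_entry row_adapted row_adapted_max.
have -> : \sum_k xij k p * bil (G (f p)) (coord_vec k p) Z = 1.
  rewrite -[RHS](norm_eq Wp) b0 mulr0 addr0; apply: eq_bigr => k _.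
  by rewrite S mulrC.
rewrite mulr1 /kappa (eq_bigr (fun k => (\sum_i xij i p * partial i (xij k) p) * bi k p)).
  by rewrite subrr mulr0.
by move=> k _; rewrite S.
Qed.

End AlongCurve.

(** The statement in one chart. A zero of B is a zero of beta, and dB and
    dbeta are proportional there, so that the flow starts with the required
    initial values. *)
Theorem null_geodesic o : W o -> \det (first_form o) = 0 ->
  (forall v, 'D_v (fun q => \det (first_form q)) o = 0) ->
  exists a (y : R -> 'rV[R]_n), [/\ 0 < a, y 0 = o, Ck 2 [set t : R | `|t| < a] y &
   forall t : R, `|t| < a -> [/\ W (y t), \det (first_form (y t)) = 0,
     forall v, 'D_v (fun q => \det (first_form q)) (y t) = 0,
     cov_coord G (f \o y) t 1 1 = 0 &
     'D_1 (f \o y) t <> 0 /\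
       bil (G (f (y t))) ('D_1 (f \o y) t) ('D_1 (f \o y) t) = 0]].
Proof.
move=> Wo B0 dB0; have {}B0 := etrans (esym (det_first_form Wo)) B0.
have d0 : \det (gram o) != 0 by have := gram_unit Wo; rewrite unitmxE unitfE.
have bo : beta o = 0 by move/eqP: B0; rewrite mulf_eq0 (negPf d0) => /eqP.
have dbo v : 'D_v beta o = 0.
  by apply: (mulfI d0); rewrite -derive_det_first_form // dB0 mulr0.
have [a [y [tau [a0 y0 Cy H]]]] := null_flow oW (Ck_le (isT : (1 <= 3)%N) Ck_xi)
  (Ck_le (isT : (2 <= 3)%N) Ck_beta) Ck_kappa chi_continuous transport Wo bo dbo.
exists a, y; split; [exact: a0|exact: y0|exact: Cy|].
have Wy (s : R) : `|s| < a -> W (y s) by move=> /H[].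
have dy (s : R) : `|s| < a -> is_derive s 1 y (tau s *: xi (y s)) by move=> /H[].
have dtau (s : R) : `|s| < a -> is_derive s 1 tau (- (tau s * tau s * kappa (y s))).
  by move=> /H[].
move=> t ta; have [Wt [tau0 b0] db0 _ _] := H t ta.
split.
- exact: Wt.
- by rewrite (det_first_form Wt) b0 mulr0.
- by move=> v; rewrite (derive_det_first_form v Wt b0) db0 mulr0.
- exact: (curve_geodesic Cy Wy dy dtau ta b0 db0).
- split; first exact: (velocity_neq0 Wy dy ta tau0 b0).
  exact: (velocity_null Wy dy ta b0).
Qed.

End MeanCurvature.

End LocalGeometry.

(** * Independence of the chart *)

(** The charts and their inverses are total functions, continuous only on an
    open set. *)
Lemma open_preimage_on (T T' : topologicalType) (A : set T) (B : set T') (h : T -> T') :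
  open A -> open B -> (forall x, A x -> {for x, continuous h}) ->
  open (A `&` h @^-1` B).
Proof.
move=> oA oB ch; rewrite openE => x [Ax Bx].
have nA : nbhs x A by exact: open_nbhs_nbhs.
have nB : nbhs (h x) B by exact: open_nbhs_nbhs.
exact: filterI nA (ch x Ax _ nB).
Qed.

Lemma of_class_Ck (R : realType) (V W : normedModType R) k (r : regularity)
    (D : set V) (h : V -> W) : at_least k r -> of_class r D h -> Ck k D h.
Proof.
case: r => [j kj|_|_]; [exact: Ck_le kj| |] => /=; first by apply.
by case=> + _; apply.
Qed.

Section Charts.
Context {R : realType} {m : nat} {r : regularity} (M : lorentz_manifold R m r).
Hypothesis hr : at_least 4 r.
Implicit Types (c d : atlas M).

Definition range_of c := chart c @` cdom c.
Definition overlap c d := chart c @` (cdom c `&` cdom d).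
Definition transition c d := chart d \o cinv c.
Definition transition_jac c d (y : 'rV[R]_m) : 'M[R]_m := jacobian (transition c d) y.

Lemma open_range c : open (range_of c). Proof. exact: crange_open. Qed.

Lemma overlap_range c d y : overlap c d y -> range_of c y.
Proof. by move=> [x [cx dx] <-]; exists x. Qed.

Lemma overlapE c d : overlap c d = range_of c `&` cinv c @^-1` cdom d.
Proof.
apply/seteqP; split=> [y [x [cx dx] <-]|y [[x cx <-] /=]].
  by split; [exists x|rewrite /= chartK].
by rewrite chartK // => dx; exists x.
Qed.

Lemma open_overlap c d : open (overlap c d).
Proof.
rewrite overlapE; apply: open_preimage_on; [exact: open_range|exact: cdom_open|].
exact: cinv_continuous.
Qed.

Lemma Ck_metric c : Ck 4 (range_of c) (metric c).
Proof. exact: of_class_Ck hr (metric_class c). Qed.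

Lemma metric_unit c y : range_of c y -> metric c y \in unitmx.
Proof.
move=> /metric_signature [P uP E].
have : Defs.minkowski R m \in unitmx.
  rewrite unitmxE /Defs.minkowski det_diag unitfE; apply/prodf_neq0 => i _.
  by rewrite mxE; case: ifP; rewrite ?oner_eq0 ?oppr_eq0 ?oner_eq0.
by rewrite -E !unitmx_mul => /andP[/andP[]].
Qed.

Lemma Ck_transition k c d : Ck k (overlap c d) (transition c d).
Proof. by have [+ _] := transition_analytic c d; apply. Qed.

Lemma transition_range c d y : overlap c d y -> range_of d (transition c d y).
Proof. by move=> [x [cx dx] <-]; exists x => //; rewrite /transition /= chartK. Qed.

Lemma differentiable_transition c d y : overlap c d y ->
  differentiable (transition c d) y.
Proof.
move=> Oy.
exact: (Ck1_differentiable_rV (@open_overlap c d) (@Ck_transition 1 c d) Oy).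
Qed.

Lemma derive_transition c d y u : overlap c d y ->
  'D_u (transition c d) y = u *m transition_jac c d y.
Proof. by move=> Oy; apply: deriveEjacobian; exact: differentiable_transition. Qed.

Lemma transition_jac_det c d y : overlap c d y -> 0 < \det (transition_jac c d y).
Proof. exact: transition_oriented. Qed.

Lemma transition_jac_unit c d y : overlap c d y -> transition_jac c d y \in unitmx.
Proof. by move=> /transition_jac_det; rewrite unitmxE unitfE => /lt0r_neq0. Qed.

Lemma metric_transition_jac c d y : overlap c d y ->
  metric c y = transition_jac c d y *m metric d (transition c d y) *m (transition_jac c d y)^T.
Proof. exact: metric_transition. Qed.

Lemma bil_metric c d y u v : overlap c d y ->
  bil (metric c y) u v =
  bil (metric d (transition c d y)) (u *m transition_jac c d y) (v *m transition_jac c d y).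
Proof.
by move=> Oy; rewrite bil_mul -metric_transition_jac.
Qed.

Section ChangeOfChart.
Context {V : normedModType R}.
Variables (D : set V) (F : V -> M).
Hypotheses (oD : open D) (CF : Ck_map 2 D F).

Variables (p : V) (c d : atlas M).
Hypotheses (Dp : D p) (cp : cdom c (F p)) (dp : cdom d (F p)).
Local Notation J := (transition_jac c d (chart c (F p))).
Let D' := D `&` F @^-1` (cdom c `&` cdom d).

Let oD' : open D'.
Proof.
by apply: open_preimage_on => //; [exact: openI (cdom_open c) (cdom_open d)|case: CF].
Qed.

Let D'p : D' p. Proof. by []. Qed.
Let Op : overlap c d (chart c (F p)). Proof. by exists (F p). Qed.
Let E x : D' x -> (chart d \o F) x = (transition c d \o (chart c \o F)) x.
Proof. by move=> [_ [cx dx]]; rewrite /transition /= chartK. Qed.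
Let Cc : Ck 2 D' (chart c \o F).
Proof. by have [_ /(_ c)] := CF; apply: Ck_sub => x [Dx [cx _]]. Qed.
Let Oc x : D' x -> overlap c d ((chart c \o F) x).
Proof. by move=> [_ [cx dx]]; exists (F x). Qed.

Lemma derive_chart v : 'D_v (chart d \o F) p = 'D_v (chart c \o F) p *m J.
Proof.
rewrite (derive_ext v oD' D'p E).
have dc : derivable (chart c \o F) p v by exact: (Ck_derivable (Ck_pred Cc) D'p).
have [_ ->] := is_derive_comp dc (differentiable_transition Op).
exact: derive_transition.
Qed.

(** The covariant derivative of a map into the manifold is a tangent vector:
    the coordinates in two charts are related by the Jacobian of the
    transition. *)
Lemma cov_coord_chart v w : cov_coord (metric d) (chart d \o F) p v w =
  cov_coord (metric c) (chart c \o F) p v w *m J.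
Proof.
have -> : cov_coord (metric d) (chart d \o F) p v w =
    cov_coord (metric d) (transition c d \o (chart c \o F)) p v w.
  have E2 x : D' x -> 'D_w (chart d \o F) x = 'D_w (transition c d \o (chart c \o F)) x.
    by move=> Dx; exact: derive_ext oD' Dx E.
  by rewrite /cov_coord (derive_ext v oD' D'p E2) !(E2 _ D'p) (E D'p) (derive_ext v oD' D'p E).
have iso y u z : overlap c d y -> bil (metric c y) u z =
    bil (metric d (transition c d y)) ('D_u (transition c d) y) ('D_z (transition c d) y).
  by move=> Oy; rewrite !derive_transition // -bil_metric.
have onto y u : overlap c d y -> exists z, 'D_z (transition c d) y = u.
  move=> Oy; exists (u *m invmx (transition_jac c d y)).
  by rewrite derive_transition // mulmxKV // transition_jac_unit.
apply: etrans (derive_transition _ Op).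
exact: (cov_coord_transform (@open_range c) (@open_range d) (@open_overlap c d)
  (Ck_le (isT : (1 <= 4)%N) (@Ck_metric c)) (Ck_le (isT : (1 <= 4)%N) (@Ck_metric d))
  (@Ck_transition 2 c d) (@overlap_range c d) (@transition_range c d)
  (@Defs.metric_sym _ _ _ M c) (@Defs.metric_sym _ _ _ M d)
  (@metric_unit c) (@metric_unit d) iso onto v w oD' Cc Oc D'p).
Qed.

End ChangeOfChart.
End Charts.

(** * The invariants of a hypersurface, read in one chart *)

Section HypersurfaceInChart.
Context {R : realType} {n : nat} {r : regularity} (M : lorentz_manifold R n.+1 r).
Hypothesis hr : at_least 4 r.
Variables (Om : set 'rV[R]_n) (F : 'rV[R]_n -> M) (c0 : atlas M).
Hypotheses (oOm : open Om) (CF : Ck_map 4 Om F).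
Hypothesis Omc : forall p, Om p -> cdom c0 (F p).
Local Notation f := (chart c0 \o F).
Local Notation G := (metric c0).
Local Notation J p := (transition_jac c0 (chart_at (F p)) (f p)).

Lemma g_bil (x : M) u v : g x u v = bil (gmx x) u v.
Proof.
Local Transparent bil.
by [].
Local Opaque bil.
Qed.

Let CF2 : Ck_map 2 Om F.
Proof. by have [c1 c2] := CF; split=> [|c]; [exact: c1|exact: Ck_le (c2 c)]. Qed.

Lemma overlap_at p : Om p -> overlap c0 (chart_at (F p)) (f p).
Proof. by move=> Op; exists (F p) => //; split; [exact: Omc|exact: chart_atP]. Qed.

Lemma transition_at p : Om p -> transition c0 (chart_at (F p)) (f p) = chart (chart_at (F p)) (F p).
Proof. by move=> Op; rewrite /transition /= chartK //; exact: Omc. Qed.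

Lemma bil_gmx p u v : Om p ->
  bil (gmx (F p)) (u *m J p) (v *m J p) = bil (G (f p)) u v.
Proof. by move=> Op; rewrite (bil_metric _ _ (overlap_at Op)) transition_at. Qed.

Lemma dmap_chart p v : Om p -> dmap F p v = 'D_v f p *m J p.
Proof.
move=> Op.
exact: (derive_chart oOm CF2 Op (Omc Op) (chart_atP (F p)) v).
Qed.

Lemma cov_chart p v w : Om p -> cov F p v w = cov_coord G f p v w *m J p.
Proof.
move=> Op.
exact: (cov_coord_chart hr oOm CF2 Op (Omc Op) (chart_atP (F p)) v w).
Qed.

Lemma S_chart p : Om p -> S_ F p = first_form f G p.
Proof.
move=> Op; apply/matrixP => i j.
rewrite !mxE g_bil /Fu (dmap_chart _ Op) (dmap_chart _ Op).
exact: bil_gmx.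
Qed.

Lemma frame_chart p w : Om p ->
  frame F p (w *m J p) = frame_mx (fun i => coord_vec f i p) w *m J p.
Proof.
move=> Op; rewrite frame_mx_mul; congr (frame_mx _ _).
by apply/funext => i; rewrite /Fu dmap_chart.
Qed.

Lemma gmx_unit (x : M) : gmx x \in unitmx.
Proof. by apply: metric_unit; exists x => //; exact: chart_atP. Qed.

Lemma gmx_sym (x : M) : (gmx x)^T = gmx x.
Proof. by apply: Defs.metric_sym; exists x => //; exact: chart_atP. Qed.

(** The vector nu is a chosen solution of linear equations. A solution
    exists because the determinant is linear in its last row and the metric
    is nondegenerate. *)
Lemma nuP p w : g (F p) (nu F p) w = vol (F p) (frame F p w).
Proof.
suff : exists v, forall w, g (F p) v w = vol (F p) (frame F p w) by move=> /getPex.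
pose k := Num.sqrt `|\det (gmx (F p))|.
pose u : 'rV[R]_n.+1 := \row_j cofactor (frame F p 0) ord_max j.
exists (k *: (u *m invmx (gmx (F p)))) => w'.
rewrite /g -scalemxAl mulmxKV ?gmx_unit // -scalemxAl mxE /vol -/k; congr (_ * _).
rewrite (expand_det_row _ ord_max) mxE; apply: eq_bigr => j _.
rewrite !mxE unlift_none mulrC; congr (_ * _).
rewrite /cofactor; congr (_ * \det _); apply/matrixP => a b; rewrite !mxE.
by rewrite liftK.
Qed.

(** The density of the volume form in the fixed chart; it does not depend on
    the chart selected at the point. *)
Definition volume_factor p : R := Num.sqrt `|\det (G (f p))|.

Lemma volume_factor_chart p : Om p ->
  volume_factor p = Num.sqrt `|\det (gmx (F p))| * \det (J p).
Proof.
move=> Op; have d0 := transition_jac_det (overlap_at Op).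
rewrite /volume_factor (metric_transition_jac (overlap_at Op)) transition_at //.
have -> : \det (J p *m gmx (F p) *m (J p)^T) = \det (J p) ^+ 2 * \det (gmx (F p)).
  by rewrite !det_mulmx det_tr mulrAC -expr2.
rewrite normrM normrX sqrtrM ?exprn_ge0 // sqrtr_sqr normr_id (gtr0_norm d0).
exact: mulrC.
Qed.

(** Pairing with nu is a determinant, which transforms like the volume form. *)
Lemma h_chart p i j : Om p -> h_ F p i j =
  volume_factor p * \det (frame_mx (fun i => coord_vec f i p) (cov_coord G f p (e_ i) (e_ j))).
Proof.
move=> Op; rewrite /h_ g_bil bilC ?gmx_sym // -g_bil nuP cov_chart //.
rewrite frame_chart // /vol det_mulmx volume_factor_chart //.
by rewrite -mulrA; congr (_ * _); rewrite mulrC.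
Qed.

Lemma A_chart p : Om p -> A_ F p =
  \sum_i \sum_j cofactor (first_form f G p) i j * h_ F p i j.
Proof. by move=> Op; rewrite /A_ S_chart. Qed.

Lemma Ck_f : Ck 4 Om f.
Proof. by have [_ /(_ c0)] := CF; apply: Ck_sub => p Op; split => //; exact: Omc. Qed.

Lemma f_range p : Om p -> range_of c0 (f p).
Proof. by move=> Op; exists (F p) => //; exact: Omc. Qed.

Lemma metric_f_unit p : Om p -> G (f p) \in unitmx.
Proof. by move=> Op; apply: metric_unit; exact: f_range. Qed.

Lemma volume_factor_neq0 p : Om p -> volume_factor p != 0.
Proof.
move=> Op; rewrite gt_eqF // sqrtr_gt0 normr_gt0.
by have := metric_f_unit Op; rewrite unitmxE unitfE.
Qed.

Lemma Ck_volume_factor : Ck 0 Om volume_factor.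
Proof.
have C : Ck 0 Om (fun p => \det (G (f p))).
  apply: Ck_det => // i j; apply: Ck_entry => //.
  exact: Ck_le (isT : (0 <= 4)%N) (Ck_comp_mx oOm (@open_range _ _ _ M c0) f_range Ck_f (@Ck_metric _ _ _ _ hr c0)).
split=> // p Op.
have cn : {for p, continuous (fun p => `|\det (G (f p))|)} by exact: cvg_norm (Ck_cont C Op).
exact: (continuous_comp cn (@sqrt_continuous _ _)).
Qed.

End HypersurfaceInChart.

(** * The light-like geodesic through a degenerate light-like point *)

Theorem theoremA (R : realType) (n : nat) (r : regularity)
    (M : lorentz_manifold R n.+1 r)
    (U : set 'rV[R]_n) (o : 'rV[R]_n) (ohat : M)
    (k : nat) (F : 'rV[R]_n -> M)
    (hn : (2 <= n)%N) (hr : at_least 4 r)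
    (hU : open U) (hUc : connected U) (hUo : U o)
    (hk : (2 <= k)%N) (hF : immersion k U F) (hFo : F o = ohat)
    (hX : calX40 F o ohat)
    (hdeg : degenerate_points F U o) :
  exists S : set M,
    [/\ lightlike_geodesic_segment ohat S,
        S `<=` F @` Sigma F U
      & S `<=` F @` degenerate_points F U].
Proof.
have [N [[oN No] [CFN injF] _ _ [phi Cphi AE]]] := hX.
pose c0 := chart_at ohat.
pose Om := (N `&` U) `&` F @^-1` cdom c0.
have oNU : open (N `&` U) by exact: openI.
have oOm : open Om.
  apply: open_preimage_on => //; first exact: cdom_open.
  by move=> x [Nx _]; case: CFN => + _; apply.
have OmN p : Om p -> N p by case=> -[].
have OmU p : Om p -> U p by case=> -[].
have Omc p : Om p -> cdom c0 (F p) by case.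
have Oo : Om o by split=> //; rewrite /= hFo; exact: chart_atP.
have CF : Ck_map 4 Om F.
  have [c1 c2] := CFN; split=> [p /OmN/c1 //|c].
  by apply: Ck_sub (c2 c) => p [/OmN Np cp].
pose f := chart c0 \o F; pose G := metric c0.
have Cf : Ck 4 Om f := Ck_f CF Omc.
have fY p : Om p -> range_of c0 (f p) := @f_range _ _ _ M Om F c0 Omc p.
have [Z Z0] : exists Z, \det (frame_mx (fun i => coord_vec f i o) Z) != 0.
  apply: exists_transverse => c c0E i.
  have Cf1 := Ck_le (isT : (1 <= 4)%N) Cf.
  have D0 : 'D_(\row_i c i) f o = 0.
    rewrite (derive_coord_rV _ oOm Cf1 Oo) -[RHS]c0E.
    by apply: eq_bigr => j _; rewrite mxE.
  have := injF o No (\row_i c i); rewrite /dmap hFo => /(_ D0)/rowP/(_ i).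
  by rewrite !mxE.
pose W := transverse_at Om f Z.
have Wo : W o by split.
have WOm' p : W p -> Om p by case.
have oW : open W by exact: (open_transverse oOm Cf).
have BE p : Om p -> B_ F p = \det (first_form f G p).
  by move=> Op; rewrite /B_ (S_chart oOm CF Omc Op).
have CB : Ck 1 Om (B_ F).
  apply: (Ck_ext oOm (f := fun p => \det (core (gram f G Z p)))).
    by move=> p Op; rewrite gram_core BE.
  apply: Ck_det => // i j.
  apply: (Ck_ext oOm (f := fun p => gram f G Z p (lift ord_max i) (lift ord_max j))).
    by move=> p _; rewrite coreE.
  apply: Ck_le (isT : (1 <= 3)%N) (Ck_entry _ _ oOm _).
  exact: Ck_gram oOm (@open_range _ _ _ M c0) Cf (@Ck_metric _ _ _ _ hr c0) fY Z.
have dBE p v : Om p -> 'd (B_ F) p v = 'D_v (fun q => \det (first_form f G q)) p.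
  move=> Op; rewrite -(deriveE _ (Ck1_differentiable oOm CB Op)).
  exact: derive_ext oOm Op BE.
have [[_ B0] dB0] := hdeg.
have clam : Ck 0 W (volume_factor F c0).
  by apply: Ck_sub (Ck_volume_factor hr oOm CF Omc) => p /WOm'.
have cphi : Ck 0 W phi.
  by apply: (Ck_sub _ (Ck_le (isT : (0 <= 2)%N) Cphi)) => p /WOm' /OmN.
have second_formE p i j : W p -> h_ F p i j = volume_factor F c0 p *
    \det (frame_mx (fun i => coord_vec f i p) (cov_coord G f p (e_ i) (e_ j))).
  by move=> /WOm' Op; exact: (h_chart hr oOm CF Omc).
have lam0 p : W p -> volume_factor F c0 p != 0.
  by move=> /WOm' Op; exact: (volume_factor_neq0 Omc Op).
have meanE p : W p -> \sum_i \sum_j cofactor (first_form f G p) i j * h_ F p i j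
    = phi p * \det (first_form f G p).
  by move=> /WOm' Op; rewrite -(A_chart oOm CF Omc Op) -(BE p Op) AE //; exact: OmN.
have B0' : \det (first_form f G o) = 0 by rewrite -(BE o Oo).
have dB0' v : 'D_v (fun q => \det (first_form f G q)) o = 0.
  by rewrite -(dBE o v Oo) dB0.
have [a [y [a0 y0 Cy H]]] := null_geodesic oOm (@open_range _ _ _ M c0) Cf
  (@Ck_metric _ _ _ _ hr c0) fY (@Defs.metric_sym _ _ _ M c0) (@metric_unit _ _ _ M c0)
  clam cphi lam0 second_formE meanE Wo B0' dB0'.
have inI (t : R) : - a < t < a -> `|t| < a by rewrite ltr_norml.
have IE : `]- a, a[%classic = [set t : R | `|t| < a].
  by apply/seteqP; split => t /=; rewrite in_itv /= ltr_norml.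
have inIs (t : R) : `]- a, a[%classic t -> `|t| < a.
  by rewrite /= in_itv; exact: inI.
pose s := F \o y.
have Oy (t : R) : `|t| < a -> Om (y t) by move=> /H[/WOm'].
have oI := @open_ball0 R a.
have Cs : Ck_map 2 [set t : R | `|t| < a] s.
  split=> [t ta|c].
    apply: continuous_comp; first exact: (Ck_cont Cy ta).
    by case: CF => + _; apply; exact: Oy.
  have oD : open (Om `&` F @^-1` cdom c).
    apply: open_preimage_on => //; first exact: cdom_open.
    by case: CF.
  have oD' : open ([set t : R | `|t| < a] `&` s @^-1` cdom c).
    apply: open_preimage_on => //; first exact: cdom_open.
    move=> t ta; apply: continuous_comp; first exact: (Ck_cont Cy ta).
    by case: CF => + _; apply; exact: Oy.
  have Cy' : Ck 2 ([set t : R | `|t| < a] `&` s @^-1` cdom c) y.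
    by apply: Ck_sub Cy => t [].
  have Cc : Ck 4 (Om `&` F @^-1` cdom c) (chart c \o F) by case: CF.
  have yD t : ([set t : R | `|t| < a] `&` s @^-1` cdom c) t ->
      (Om `&` F @^-1` cdom c) (y t) by move=> [ta ct]; split; [exact: Oy|].
  exact: (Ck_comp_mx oD' oD yD Cy' (Ck_le (isT : (2 <= 4)%N) Cc)).
have cs (t : R) : `|t| < a -> cdom c0 (s t) by move=> ta; apply: Omc; exact: Oy.
pose Js t := transition_jac c0 (chart_at (s t)) (f (y t)).
have Js_unit (t : R) : `|t| < a -> Js t \in unitmx.
  by move=> ta; apply: transition_jac_unit; exact: (overlap_at Omc (Oy t ta)).
have dsE (t : R) : `|t| < a -> dmap s t 1 = 'D_1 (f \o y) t *m Js t.
  by move=> ta; exact: (derive_chart oI Cs ta (cs t ta) (chart_atP (s t)) 1).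
exists (s @` `]- a, a[); split.
- exists (- a), a, s; split.
  + by rewrite oppr_lt0 a0.
  + split=> [|t /inI ta]; first by rewrite IE.
    have -> : cov s t 1 1 = cov_coord G (f \o y) t 1 1 *m Js t.
      exact: (cov_coord_chart hr oI Cs ta (cs t ta) (chart_atP (s t)) 1 1).
    by have [_ _ _ -> _] := H t ta; rewrite mul0mx.
  + by rewrite /s /= y0 hFo.
  + move=> t /inI ta; have [_ _ _ _ [v0 vv]] := H t ta.
    rewrite (dsE t ta); split.
      by move=> E; apply: v0; rewrite -(mulmxK (Js_unit t ta) ('D_1 _ t)) E mul0mx.
    by rewrite g_bil; apply: etrans (bil_gmx Omc _ _ (Oy t ta)) vv.
  + by [].
- move=> _ [t /inIs ta <-]; exists (y t); last by [].
  have [_ Bt _ _ _] := H t ta; split; first exact/OmU/Oy.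
  by rewrite BE //; exact: Oy.
- move=> _ [t /inIs ta <-]; exists (y t); last by [].
  have [_ Bt dBt _ _] := H t ta; split.
    by split; [exact/OmU/Oy|rewrite BE //; exact: Oy].
  by move=> v; rewrite dBE ?dBt //; exact: Oy.
Qed.
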